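(* Let $p_1,p_2,p_2'\in[1,\infty)$ satisfy $\underline p:=\frac{p_1(p_2'\wedge p_2)}{p_1+(p_2'\wedge p_2)-1}\ge3$. Assume that $\mathcal P$ has a $p_1$-moment, that the marked point process $\hat{\mathcal P}$ exhibits exponential decay of dependence (EDD), that the score $\xi$ has a $p_2$-moment, and that there is a family of short-range scores $(\hat\xi^{[r]})_{r\in(0,\infty)}$ which satisfies the moment condition of order $p_2'$. Assume $\operatorname{Var}H_\lambda=\Omega(\lambda^\nu)$ for some $\nu>2/3$. Let $Z$ be standard normal. (a) If $\xi$ satisfies exponential $L^{p_3}$-stabilization for the given family $(\hat\xi^{[r]})_{r\in(0,\infty)}$ with $p_3\ge\underline p/(\underline p-2)$, then $$d_W\Big(\frac{H_\lambda-\mathbb E H_\lambda}{\sqrt{\operatorname{Var}H_\lambda}},Z\Big)=O\big((\log\lambda)^{3d}\lambda^{-1.5\nu+1}\big).$$ (b) If $\xi$ satisfies polynomial $L^{p_3}$-stabilization with order $\beta$ for the given family $(\hat\xi^{[r]})_{r\in(0,\infty)}$ with $p_3\ge\underline p/(\underline p-2)$, then $$d_W\Big(\frac{H_\lambda-\mathbb E H_\lambda}{\sqrt{\operatorname{Var}H_\lambda}},Z\Big)=O\big(\lambda^{-1.5\nu+1+\tau(2d,\beta)}\big),\qquad \tau(2d,\beta):=\frac{3d}{2}\Big(\frac{2\nu+4}{3d+\beta}\vee\frac{\nu+4}{d+\beta}\Big).$$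
   Context: Notation: $a\vee b=\max$, $a\wedge b=\min$, $\|X\|_p=(\mathbb E|X|^p)^{1/p}$. Asymptotics are as $\lambda\to\infty$; $f(\lambda)=\Omega(g(\lambda))$ means $f\ge c\,g$ for some $c>0$ and all large $\lambda$. $d$ is Euclidean distance, also $d(A,B)=\inf\{d(x,y):x\in A,y\in B\}$; $\operatorname{diam}(A)=\sup\{d(x,y):x,y\in A\}$; $B(x,r)$ is the open ball. $d_W(X_1,X_2)=\sup_h|\mathbb E h(X_1)-\mathbb E h(X_2)|$ over all $h:\mathbb R\to\mathbb R$ with $|h(x)-h(y)|\le|x-y|$; $d_{TV}$ is total variation distance. Setting. $\mathcal P$ is a simple stationary point process on $\mathbb R^d$, $d\ge1$, with intensity $\mu\in(0,\infty)$. $\mathbb M$ is a measurable (mark) space and $\hat{\mathcal P}=\sum_{x\in\mathcal P}\delta_{(x,M_x)}$ is a simple marked point process on $\mathbb R^d\times\mathbb M$ with ground process $\mathcal P$ (each $x\in\mathcal P$ carries exactly one mark $M_x$; marks may depend on each other and on $\mathcal P$). $\mathcal N_{\mathbb R^d\times\mathbb M}$ is the space of locally finite subsets of $\mathbb R^d\times\mathbb M$ with the evaluation $\sigma$-algebra; $\mathcal B(\cdot)$ denotes Borel sets; $\Gamma_\lambda=[-\tfrac12\lambda^{1/d},\tfrac12\lambda^{1/d}]^d$, $\lambda\in(0,\infty)$. A score is a measurable function $\xi:(\mathbb R^d\times\mathbb M)\times\mathcal N_{\mathbb R^d\times\mathbb M}\times\mathcal B(\mathbb R^d)\to\mathbb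 R$, with $\xi((x,m_x),\hat{\mathcal X},A)=0$ when $(x,m_x)\notin\hat{\mathcal X}\cap(A\times\mathbb M)$. $H_\lambda=\sum_{x\in\mathcal P\cap\Gamma_\lambda}\xi((x,M_x),\hat{\mathcal P},\Gamma_\lambda)$. $\mathbb P_x,\mathbb E_x$ denote Palm probability and expectation given a point of $\mathcal P$ at $x$. $\mathcal P$ has a $p_1$-moment if $b_1:=\|\operatorname{card}(\mathcal P\cap\Gamma_1)\|_{p_1}<\infty$. $\xi$ has a $p_2$-moment if $b_2:=\sup_{\lambda\in(0,\infty)}\sup_{x\in\Gamma_\lambda}(\mathbb E_x|\xi((x,M_x),\hat{\mathcal P},\Gamma_\lambda)|^{p_2})^{1/p_2}<\infty$. EDD. $\hat{\mathcal P}$ exhibits exponential decay of dependence if there are constants $\theta_0\in[0,\infty)$, $\theta_1,\theta_2,\theta_3\in(0,\infty)$ such that for all $A,B\in\mathcal B(\mathbb R^d)$ with $d(A,B)\ge\theta_3[\log(\operatorname{diam}(A)\vee\operatorname{diam}(B))\vee1]$, $$d_{TV}\big(\mathcal L(\hat{\mathcal P}|_{A\cup B}),\mathcal L(\hat{\mathcal P}|_A\cup\tilde{\hat{\mathcal P}}|_B)\big)\le\theta_1(\operatorname{diam}(A)^{\theta_0}\vee1)(\operatorname{diam}(B)^{\theta_0}\vee1)e^{-\theta_2d(A,B)},$$ where $\tilde{\hat{\mathcal P}}$ is an independent copy of $\hat{\mathcal P}$, and $\hat{\mathcal P}|_A$ is the restriction to points with ground location in $A$. Short-range scores. For $r\in(0,\infty)$,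 a short-range score (estimator) $\hat\xi^{[r]}$ is a measurable function with the same domain and range as $\xi$ such that for almost all realizations $\hat{\mathcal X}$ of $\hat{\mathcal P}$, all locally finite $\hat{\mathcal Y}\subset(\mathbb R^d\setminus B(x,r))\times\mathbb M$ and all $(x,m_x)\in\hat{\mathcal X}$: $\hat\xi^{[r]}((x,m_x),[\hat{\mathcal X}\cap(B(x,r)\times\mathbb M)]\cup\hat{\mathcal Y},\Gamma_\lambda)=\hat\xi^{[r]}((x,m_x),\hat{\mathcal X}\cap(B(x,r)\times\mathbb M),\Gamma_\lambda)$. The family $(\hat\xi^{[r]})$ satisfies the moment condition of order $p_2'$ if $\sup_{\lambda\in(0,\infty)}\sup_{x\in\Gamma_\lambda}\sup_{r\in(0,\infty)}(\mathbb E_x|\hat\xi^{[r]}((x,M_x),\hat{\mathcal P},\Gamma_\lambda)|^{p_2'})^{1/p_2'}<\infty$. $L^{p_3}$-stabilization, $p_3\in(0,\infty)$. Put $\varphi^{(L^{p_3})}(r)=\sup_{\lambda\in(0,\infty)}\sup_{x\in\Gamma_\lambda}\big(\mathbb E_x|\xi((x,M_x),\hat{\mathcal P},\Gamma_\lambda)-\hat\xi^{[r]}((x,M_x),\hat{\mathcal P},\Gamma_\lambda)|^{p_3}\big)^{1/p_3}$. $\xi$ satisfies exponential $L^{p_3}$-stabilization for the family if there are positive $C_1,C_2$ with $\varphi^{(L^{p_3})}(r)\le C_1e^{-C_2r}$ for all $r\in(0,\infty)$; it satisfies polynomial $L^{p_3}$-stabilization with order $\beta>0$ if there is $C>0$ with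 $\varphi^{(L^{p_3})}(r)\le Cr^{-\beta}$ for all $r\in(0,\infty)$. *)

(* Defs.v *)
From HB Require Import structures.
From mathcomp Require Import all_boot all_order all_algebra.
From mathcomp Require Import all_classical all_reals all_analysis.
From mathcomp Require Import measurable_realfun.

Set Implicit Arguments.
Unset Strict Implicit.
Unset Printing Implicit Defensive.

Import Order.TTheory GRing.Theory Num.Theory.
Import numFieldNormedType.Exports.

Local Open Scope classical_set_scope.
Local Open Scope ring_scope.

(* R^n is n.-tuple R: its library sigma-algebra, generated by the coordinate
   projections, is the Borel sigma-algebra. *)
Notation Rvec R n := (n.-tuple R).

Section euclidean.
Context {R : realType} {n : nat}.
Implicit Types (x z : Rvec R n) (A B : set (Rvec R n)).

Definition dist x z : R := Num.sqrt (\sum_(i < n) (tnth x i - tnth z i) ^+ 2).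

Definition eball x (r : R) : set (Rvec R n) := [set z | dist x z < r].

Definition vadd x z : Rvec R n := [tuple (tnth x i + tnth z i : R) | i < n].

Definition ebounded A := exists x r, A `<=` eball x r.

(* Supremum taken in [0, +oo], so that the empty set has diameter 0. *)
Definition diam A : \bar R :=
  maxe 0%E (ereal_sup [set (dist p.1 p.2)%:E | p in A `*` A]).

Definition set_dist A B : \bar R :=
  ereal_inf [set (dist p.1 p.2)%:E | p in A `*` B].

Definition window (lam : R) : set (Rvec R n) :=
  [set x | forall i, `|tnth x i| <= 2^-1 * lam `^ n%:R^-1].

End euclidean.

Section lebesgue_cons.
Context {R : realType} {n : nat}.
Variable m : {sigma_finite_measure set (Rvec R n) -> \bar R}.

Definition vcons (z : measurableTypeR R * Rvec R n) : Rvec R n.+1 :=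
  [the Rvec R n.+1 of z.1 :: z.2].

Lemma measurable_vcons : measurable_fun [set: measurableTypeR R * Rvec R n] vcons.
Proof. exact: (measurable_cons measurable_fst measurable_snd). Qed.

Definition leb_cons : set (Rvec R n.+1) -> \bar R :=
  pushforward (@lebesgue_measure R \x m)%E vcons.

Let leb_cons0 : leb_cons set0 = 0%E.
Proof. by rewrite /leb_cons /pushforward preimage_set0 measure0. Qed.

Let leb_cons_ge0 A : (0 <= leb_cons A)%E.
Proof. by rewrite /leb_cons /pushforward measure_ge0. Qed.

Let leb_cons_sigma_additive : semi_sigma_additive leb_cons.
Proof.
move=> F mF tF mUF; rewrite /leb_cons /pushforward preimage_bigcup.
apply: measure_semi_sigma_additive.
- by move=> k; rewrite -[X in measurable X]setTI; exact: measurable_vcons.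
- apply/trivIsetP => /= i j _ _ ij; rewrite -preimage_setI.
  by move/trivIsetP : tF => /(_ _ _ _ _ ij) ->//; rewrite preimage_set0.
- by rewrite -preimage_bigcup -[X in measurable X]setTI; exact: measurable_vcons.
Qed.

HB.instance Definition _ := isMeasure.Build _ _ _ leb_cons
  leb_cons0 leb_cons_ge0 leb_cons_sigma_additive.

Let uncons (t : Rvec R n.+1) : measurableTypeR R * Rvec R n :=
  (thead t, [tuple of behead t]).

Let vconsK : cancel vcons uncons.
Proof.
move=> [x t]; rewrite /uncons /vcons; congr pair => //.
exact/val_inj.
Qed.

Let unconsK : cancel uncons vcons.
Proof. by move=> t; rewrite /uncons /vcons [RHS]tuple_eta; exact/val_inj. Qed.

Let measurable_uncons : measurable_fun [set: Rvec R n.+1] uncons.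
Proof.
apply/measurable_fun_pair; first exact: measurable_tnth.
exact: measurable_behead.
Qed.

Let leb_cons_sigma_finite : sigma_finite setT leb_cons.
Proof.
have /sigma_finiteP[F [TF ndF Foo]] := sigma_finiteT (@lebesgue_measure R).
have /sigma_finiteP[G [TG ndG Goo]] := sigma_finiteT m.
exists (fun k => uncons @^-1` (F k `*` G k)) => [|k].
  apply/esym/seteqP; split=> // t _; case txy : (uncons t) => [x y].
  have [i _ Fix] : (\bigcup_i F i) x by rewrite -TF.
  have [j _ Gjy] : (\bigcup_i G i) y by rewrite -TG.
  exists (maxn i j) => //; rewrite /preimage /mkset txy; split => /=.
    by move: (x) Fix; exact/subsetPset/ndF/leq_maxl.
  by move: (y) Gjy; exact/subsetPset/ndG/leq_maxr.
have [[mF Fk] [mG Gk]] := (Foo k, Goo k); split.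
  rewrite -[X in measurable X]setTI; apply: measurable_uncons => //.
  exact: measurableX.
rewrite /leb_cons /pushforward.
rewrite (_ : _ @^-1` _ = F k `*` G k); last first.
  by apply/seteqP; split=> z; rewrite /preimage /mkset vconsK.
by rewrite product_measure1E// lte_mul_pinfty// ge0_fin_numE.
Qed.

HB.instance Definition _ := Measure_isSigmaFinite.Build _ _ _ leb_cons
  leb_cons_sigma_finite.

End lebesgue_cons.

Fixpoint leb {R : realType} (n : nat) :
    {sigma_finite_measure set (Rvec R n) -> \bar R} :=
  match n with
  | 0 => [the {sigma_finite_measure set (Rvec R 0) -> \bar R} of
           @dirac _ _ [tuple] R]
  | n'.+1 => [the {sigma_finite_measure set (Rvec R n'.+1) -> \bar R} of
           leb_cons (leb n')]
  end.

Lemma leb_box (R : realType) (n : nat) (a b : 'I_n -> R) :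
  (forall i, a i <= b i) ->
  leb n [set x : Rvec R n | forall i, tnth x i \in `[a i, b i]] =
  (\prod_(i < n) (b i - a i))%:E.
Proof.
elim: n a b => [|n IHn] a b ab.
  by rewrite big_ord0 /= diracE mem_set//= => -[].
rewrite big_ord_recl /= /leb_cons /pushforward.
pose box := [set x : Rvec R n | forall i,
  tnth x i \in `[a (lift ord0 i), b (lift ord0 i)]].
have -> : vcons @^-1` [set x | forall i, tnth x i \in `[a i, b i]] =
    [set` `[a ord0, b ord0]] `*` box.
  apply/seteqP; split=> -[x t] /=.
    move=> H; split; first by have := H ord0.
    by move=> i; have := H (lift ord0 i); rewrite tnthS.
  move=> [xab H] i; have [j ->|->//] := unliftP ord0 i.
  by rewrite tnthS; exact: H.
have mbox : measurable box.
  rewrite (_ : box = \bigcap_(i in [set: 'I_n])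
     (fun x : Rvec R n => tnth x i) @^-1`
       [set` `[a (lift ord0 i), b (lift ord0 i)]]).
    apply: fin_bigcap_measurable => // i _.
    rewrite -[X in measurable X]setTI.
    exact: measurable_tnth.
  by apply/seteqP; split=> [x H i _|x H i]; have := H i; [|exact].
rewrite product_measure1E//= IHn// EFinM lebesgue_measure_itv/= lte_fin.
have := ab ord0; rewrite le_eqVlt => /predU1P[->|->]; last by rewrite EFinB.
by rewrite ltxx subrr.
Qed.

(* Locally finite subsets of T with respect to a family K of sets (which plays
   the role of the bounded sets), with the evaluation sigma-algebra. *)
Definition lfset_display : measure_display -> measure_display.
Proof. exact. Qed.

Section locally_finite.
Context {dT : measure_display} {T : measurableType dT}.

Record lfset (K : set (set T)) := LFSet {
  points :> set T;
  points_lf : forall C, K C -> finite_set (points `&` C) }.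

Variable K : set (set T).

Lemma lfset_eq (X Y : lfset K) : points X = points Y -> X = Y.
Proof.
case: X Y => [X hX] [Y hY] /= XY; rewrite XY in hX *.
by congr LFSet; exact: Prop_irrelevance.
Qed.

Lemma lfset0_lf C : K C -> finite_set (set0 `&` C : set T).
Proof. by rewrite set0I. Qed.

HB.instance Definition _ := gen_eqMixin (lfset K).
HB.instance Definition _ := gen_choiceMixin (lfset K).
HB.instance Definition _ := isPointed.Build (lfset K) (LFSet lfset0_lf).

(* The maps X |-> card (X `&` C) take values in {0, 1, ..., +oo}, so the
   events card (X `&` C) = k, k finite, generate the same sigma-algebra. *)
Definition evaluation_events : set (set (lfset K)) :=
  [set [set X | (points X `&` C #= `I_k)%card] | C in measurable & k in [set: nat]].

Definition lfset_measurable := <<s evaluation_events >>.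

HB.instance Definition _ := @isMeasurable.Build (lfset_display dT) (lfset K)
  lfset_measurable (@sigma_algebra0 _ setT _)
  (@sigma_algebraC (lfset K) _) (@sigma_algebra_bigcup _ setT _).

End locally_finite.

Section configurations.
Context {R : realType} {n : nat}.

Definition gconf := lfset (@ebounded R n).

Lemma gconf_shift_lf (z : Rvec R n) (X : gconf) C : ebounded C ->
  finite_set ([set vadd z x | x in points X] `&` C).
Proof.
move=> [c [r Cr]].
have bC : ebounded (vadd z @^-1` C).
  exists [tuple (tnth c i - tnth z i : R) | i < n], r => x /= /Cr.
  rewrite /eball /= /dist; congr (Num.sqrt _ < _).
  by apply: eq_bigr => i _; rewrite !tnth_mktuple opprD addrA.
apply: sub_finite_set (finite_image (vadd z) (points_lf X bC)).
by move=> _ [[x Xx <-] Cx]; exists x.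
Qed.

Definition gconf_shift (z : Rvec R n) (X : gconf) : gconf :=
  LFSet (gconf_shift_lf z X).

Context {dM : measure_display} {M : measurableType dM}.

Definition mconf := lfset [set B `*` [set: M] | B in @ebounded R n].

Implicit Types (X Y : mconf) (A : set (Rvec R n)).

Lemma ground_lf X C : ebounded C ->
  finite_set ([set p.1 | p in points X] `&` C).
Proof.
move=> bC; have XC : finite_set (points X `&` (C `*` setT)).
  by apply: points_lf; exists C.
apply: sub_finite_set (finite_image fst XC).
by move=> _ [[p Xp <-] Cp]; exists p.
Qed.

Definition ground X : gconf := LFSet (ground_lf X).

Lemma restr_lf A X C : [set B `*` [set: M] | B in @ebounded R n] C ->
  finite_set ((points X `&` (A `*` setT)) `&` C).
Proof.
move=> KC; apply: sub_finite_set (points_lf X KC).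
by apply: setSI; exact: subIsetl.
Qed.

Definition restr A X : mconf := LFSet (restr_lf A X).

Lemma cunion_lf X Y C : [set B `*` [set: M] | B in @ebounded R n] C ->
  finite_set ((points X `|` points Y) `&` C).
Proof.
by move=> KC; rewrite setIUl finite_setU; split; exact: points_lf.
Qed.

Definition cunion X Y : mconf := LFSet (cunion_lf X Y).

Definition unique_marks X := forall x m m',
  points X (x, m) -> points X (x, m') -> m = m'.

End configurations.

Arguments gconf : clear implicits.
Arguments mconf R n {dM} M.

Section distances.
Context {R : realType}.
Local Open Scope ereal_scope.

Definition dTV {d} {T : measurableType d} (mu nu : set T -> \bar R) : \bar R :=
  ereal_sup [set `|mu E - nu E| | E in measurable].

Definition dW {d1 d2} {T1 : measurableType d1} {T2 : measurableType d2}
    (P1 : probability T1 R) (X1 : T1 -> R)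
    (P2 : probability T2 R) (X2 : T2 -> R) : \bar R :=
  ereal_sup [set `|'E_P1[h \o X1] - 'E_P2[h \o X2]| |
    h in [set h : R -> R | forall s t, (`|h s - h t| <= `|s - t|)%R]].

End distances.

Section marked_point_processes.
Context {R : realType} {n : nat} {dO dM : measure_display}
  {Omega : measurableType dO} {M : measurableType dM}
  (P : probability Omega R).
Local Open Scope ereal_scope.

Definition stationary (X : Omega -> gconf R n) :=
  forall z E, measurable E ->
    pushforward P (gconf_shift z \o X) E = pushforward P X E.

Definition has_intensity (X : Omega -> gconf R n) (mu : R) :=
  forall A, measurable A ->
    \int[P]_w counting (points (X w) `&` A) = mu%:E * leb n A.

(* palm x is the joint law of (M_x, X) under the Palm probability P_x; the
   Palm probabilities form a disintegration of the Campbell measure. *)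
Definition is_palm (X : Omega -> mconf R n M) (mu : R)
    (palm : R.-pker (Rvec R n) ~> (M * mconf R n M)%type) :=
  forall f : (Rvec R n * M) * mconf R n M -> \bar R,
    measurable_fun [set: (Rvec R n * M) * mconf R n M] f ->
    (forall z, 0 <= f z) ->
    \int[P]_w (\esum_(p in points (X w)) f (p, X w)) =
    mu%:E * \int[leb n]_x \int[palm x]_y f ((x, y.1), y.2).

(* The law of X|_A together with an independent copy of X restricted to B is
   realized on Omega * Omega with the product probability. *)
Definition EDD (X : Omega -> mconf R n M) :=
  exists theta0 theta1 theta2 theta3 : R,
    [/\ (0 <= theta0)%R, (0 < theta1)%R, (0 < theta2)%R, (0 < theta3)%R &
    forall A B : set (Rvec R n), measurable A -> measurable B ->
      theta3%:E * maxe (lne (maxe (diam A) (diam B))) 1 <= set_dist A B ->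
      dTV (pushforward P (restr (A `|` B) \o X))
          (pushforward (P \x P)
             (fun w => cunion (restr A (X w.1)) (restr B (X w.2)))) <=
      theta1%:E * maxe (poweR (diam A) theta0) 1
        * maxe (poweR (diam B) theta0) 1
        * expeR (- (theta2%:E * set_dist A B))].

Definition point_moment (X : Omega -> gconf R n) (p : R) :=
  Lnorm P p%:E (fun w => counting (points (X w) `&` window 1)) < +oo.

Definition score_fun :=
  (Rvec R n * M)%type -> mconf R n M -> set (Rvec R n) -> R.

Definition measurable_score (xi : score_fun) :=
  forall A, measurable A ->
    measurable_fun [set: (Rvec R n * M) * mconf R n M]
      (fun z => xi z.1 z.2 A).

Definition is_score (xi : score_fun) :=
  measurable_score xi /\
  forall A p X, measurable A ->
    ~ (points X `&` (A `*` setT)) p -> xi p X A = 0%R.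

Definition short_range (X : Omega -> mconf R n M) (r : R) (xi : score_fun) :=
  measurable_score xi /\
  forall lam : R, (0 < lam)%R ->
    {ae P, forall w, forall (p : Rvec R n * M) (Y : mconf R n M),
      points (X w) p -> points Y `<=` ~` eball p.1 r `*` setT ->
      xi p (cunion (restr (eball p.1 r) (X w)) Y) (window lam) =
      xi p (restr (eball p.1 r) (X w)) (window lam)}.

Definition Hsum (X : Omega -> mconf R n M) (xi : score_fun) (lam : R) :
    Omega -> R :=
  fun w => (\sum_(p \in points (X w) `&` (window lam `*` setT))
    xi p (X w) (window lam))%R.

Variable palm : R.-pker (Rvec R n) ~> (M * mconf R n M)%type.

(* sup over lam > 0 and x in the window of the L^p-norm, under the Palm
   probability at x, of f ((x, M_x), X, window). *)
Definition palm_sup_norm (p : R) (f : score_fun) : \bar R :=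
  ereal_sup [set ereal_sup [set
      Lnorm (palm x) p%:E (fun y => (f (x, y.1) y.2 (window lam))%:E)
    | x in window lam] | lam in [set lam : R | (0 < lam)%R]].

Definition score_moment (xi : score_fun) (p : R) := palm_sup_norm p xi < +oo.

Definition family_moment (xih : R -> score_fun) (p : R) :=
  ereal_sup [set palm_sup_norm p (xih r) | r in [set r : R | (0 < r)%R]] < +oo.

Definition phi (xi : score_fun) (xih : R -> score_fun) (p r : R) : \bar R :=
  palm_sup_norm p (fun q X A => xi q X A - xih r q X A)%R.

Definition exp_stabilizing (xi : score_fun) (xih : R -> score_fun) (p : R) :=
  exists C1 C2 : R, [/\ (0 < C1)%R, (0 < C2)%R &
    forall r : R, (0 < r)%R -> phi xi xih p r <= (C1 * expR (- (C2 * r)))%:E].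

Definition poly_stabilizing (xi : score_fun) (xih : R -> score_fun)
    (p beta : R) :=
  exists C : R, (0 < C)%R /\
    forall r : R, (0 < r)%R -> phi xi xih p r <= (C * r `^ (- beta))%:E.

End marked_point_processes.

Arguments score_fun R n {dM} M.

Definition standardize {R : realType} {d} {T : measurableType d}
    (P : probability T R) (X : T -> R) : T -> R :=
  fun w => (X w - fine 'E_P[X]) / Num.sqrt (fine 'V_P[X]).

Definition pbar {R : realType} (p1 p2 p2' : R) : R :=
  p1 * Num.min p2' p2 / (p1 + Num.min p2' p2 - 1).

(* tau nu n beta is tau(2n, beta) *)
Definition tau {R : realType} (nu : R) (n : nat) (beta : R) : R :=
  3 * n%:R / 2 *
    Num.max ((2 * nu + 4) / (3 * n%:R + beta)) ((nu + 4) / (n%:R + beta)).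

(* Main.v *)
(** The window is cut into unit blocks and H_lambda into block sums.  By the
    Campbell formula and Young's inequality, the block sums have uniformly
    bounded moments of order pbar >= 3, and replacing xi by its short-range
    estimator of radius r changes the mean and the variance of H_lambda by
    O(lambda Phi(r)) and O(lambda^2 Phi(r)), where Phi bounds the L^p3 error.

    The new block sums only depend on the points within distance r of their
    blocks.  EDD at distance r gives a total variation bound delta^3, hence
    covariances O(delta) between functions with third moments of the sums over
    two families of blocks at distance of order r.  Stein's equation
    f' (x) - x f (x) = h (x) - E h (Z), expanded around the sum without the
    blocks near a given one, then bounds the Wasserstein distance by
    O(lambda r^(2d) / sigma^3) plus the above errors.  The rates follow with
    r = k log lambda in (a) and r = lambda^(tau / (3d)) in (b). *)

(* EDD controls probabilities of events, while Stein's method needs expectations of unbounded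
   products. Truncation bridges the two at the price of third moments, which [pbar >= 3] grants to a
   block sum. The lower bound on [p3] is what allows the error of one block to be multiplied by
   another block sum: the conjugate exponent of [p3] must not exceed [pbar / 2], the rest of the
   integrability being spent on the number of points.

   The linear term of Stein's expansion couples a block with all its neighbours, so two ranges
   occur: a block is separated from the rest at range [rho], a block together with its neighbours at
   range [2 * rho].

   Everything is normalised by the standard deviation of the original H_lambda; the variance of the
   sum of estimators enters only as an error.

   The decorrelation bounds are crude in the number of blocks and lose a factor [lam ^ 4]. A large
   constant [k] in [r >= k log lam] lets the exponential decay absorb any fixed power of [lam]. The
   factor [r ^ (2 d)] comes from the Taylor remainder alone, which sums twice over a
   neighbourhood. *)
Require Import Defs.
From HB Require Import structures.
From mathcomp Require Import all_boot all_order all_algebra.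
From mathcomp Require Import all_classical all_reals all_analysis.
From mathcomp Require Import measurable_realfun finmap ring lra zify.

Set Implicit Arguments.
Unset Strict Implicit.
Unset Printing Implicit Defensive.

Import Order.TTheory GRing.Theory Num.Theory.
Import numFieldNormedType.Exports.

Local Open Scope classical_set_scope.
Local Open Scope ring_scope.

(** * Gaussian tail bounds *)

Section mills.
Context {R : realType}.
Implicit Types (x y t : R).

(** All tail inequalities below go through this lemma: the two sides vanish at infinity, so
    comparing derivatives is enough. Convergence along the integers suffices, since [U] is
    nonincreasing. *)
Lemma antitone_cvg0_ge0 (U dU : R -> R) (a : R) :
  (forall x, a <= x -> is_derive x 1 U (dU x)) ->
  (forall x, a <= x -> dU x <= 0) ->
  U n%:R @[n --> \oo] --> 0 -> 0 <= U a.
Proof.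
move=> dUE dU0 U0.
rewrite -(cvg_lim (@Rhausdorff R) U0); apply: limr_le.
  by apply/cvg_ex; exists 0.
near=> n.
have an : a <= n%:R.
  by near: n; exact: nbhs_infty_ger.
have [| |c /itvP ca UE] := @MVT_segment R U dU a n%:R an.
- by move=> x /itvP xa; apply: dUE; rewrite ltW// xa.
- apply: derivable_within_continuous => x /itvP xa.
  by apply: ex_derive; apply: dUE; rewrite xa.
- rewrite -subr_le0 UE mulr_le0_ge0 ?subr_ge0// dU0//.
  by rewrite ca.
Unshelve. all: by end_near. Qed.

Lemma is_derive1_add (f g : R -> R) x a b : is_derive x 1 f a -> is_derive x 1 g b ->
  is_derive x 1 (fun y => f y + g y) (a + b).
Proof. exact: is_deriveD. Qed.

Lemma is_derive1_sub (f g : R -> R) x a b : is_derive x 1 f a -> is_derive x 1 g b ->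
  is_derive x 1 (fun y => f y - g y) (a - b).
Proof. exact: is_deriveB. Qed.

Lemma is_derive1_mul (f g : R -> R) x a b : is_derive x 1 f a -> is_derive x 1 g b ->
  is_derive x 1 (fun y => f y * g y) (a * g x + f x * b).
Proof.
move=> fa gb; rewrite addrC [a * _]mulrC.
exact: (@is_deriveM R R^o f g x 1 a b).
Qed.

Lemma is_derive1_scale (f : R -> R) c x a : is_derive x 1 f a ->
  is_derive x 1 (fun y => c * f y) (c * a).
Proof. by move=> fa; exact: (@is_deriveZ R R^o _ f c x 1 a). Qed.

Lemma is_derive1_const (c x : R) : is_derive x 1 (fun=> c) 0.
Proof. exact: is_derive_cst. Qed.

Lemma is_derive1_var (x : R) : is_derive x 1 (fun y => y) 1.
Proof. exact: is_derive_id. Qed.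

Lemma is_derive1_inv (f : R -> R) x a : f x != 0 -> is_derive x 1 f a ->
  is_derive x 1 (fun y => (f y)^-1) (- (f x) ^- 2 * a).
Proof. by move=> fx0 fa; exact: is_deriveV. Qed.

(** The standard normal density without its normalising factor, which cancels in the solution
    [G / gphi] of Stein's equation. *)
Definition gphi x : R := expR (- (x ^+ 2 / 2)).

Lemma gphi_gt0 x : 0 < gphi x. Proof. exact: expR_gt0. Qed.

Lemma is_derive_gphi x : is_derive x 1 gphi (- x * gphi x).
Proof.
have -> : gphi = expR \o (fun y => - 2^-1 * (y * y)).
  by apply/funext => y; rewrite /gphi /=; congr expR; field.
apply: (is_derive_eq (is_derive1_comp (is_derive_expR _)
  (is_derive1_scale (- 2^-1) (is_derive1_mul (is_derive1_var x) (is_derive1_var x))))).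
by rewrite /=; field.
Qed.

Lemma mul_gphi_cvg0 (u : R -> R) (B : R) : (forall n : nat, `|u n%:R| <= B) ->
  u n%:R * gphi n%:R @[n --> \oo] --> 0.
Proof.
move=> uB; have B0 : 0 <= B by exact: le_trans (uB 0%N).
apply: norm_cvg0.
(* The bound comes from N + 1 <= 2 (1 + N^2 / 2) <= 2 exp (N^2 / 2). *)
apply: (@squeeze_cvgr _ _ _ _ (cst 0) (fun n : nat => B * 2 * (n.+1%:R^-1 : R))).
- near=> n; rewrite normr_ge0/= normrM (gtr0_norm (gphi_gt0 _)) -mulrA.
  rewrite ler_pM ?(ltW (gphi_gt0 _))// /gphi expRN.
  rewrite -natr1; set N : R := n%:R.
  rewrite ler_pdivlMr ?ltr_pwDr// mulrC ler_pdivrMr ?expR_gt0//.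
  apply: le_trans (_ : 2 * (1 + N ^+ 2 / 2) <= _); last first.
    by rewrite ler_pM2l// expR_ge1Dx.
  have : 0 <= (N - 1) ^+ 2 by rewrite sqr_ge0.
  have : 0 <= N by []. 
  nra.
- exact: cvg_cst.
- rewrite -[X in _ --> X](mulr0 (B * 2)).
  by apply: cvgMl_tmp; exact: cvg_harmonic.
Unshelve. all: by end_near. Qed.

Section half_line.
(** [k] plays the centred test function, [G] a primitive of [k * gphi], and [Q] the upper tail
    integral of [gphi]. Only decay at plus infinity is assumed, so that the section also applies
    after the reflection x |-> - x. *)
Variables (k G Q : R -> R).
Hypothesis k_lip : forall x y, `|k x - k y| <= `|x - y|.
Hypothesis dG : forall x, is_derive x 1 G (k x * gphi x).
Hypothesis dQ : forall x, is_derive x 1 Q (- gphi x).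
Hypothesis G0 : G n%:R @[n --> \oo] --> 0.
Hypothesis Q0 : Q n%:R @[n --> \oo] --> 0.

(** For frozen [x] the derivative in [t] is [gphi t * (s * (k t - k x) - (t - x))], nonpositive
    because [k] is 1-Lipschitz. The factor [s] stands for the two signs of the absolute value in
    [tail_bound]. *)
Lemma tail_bound_signed (s x : R) : `|s| <= 1 ->
  0 <= gphi x - x * Q x + s * (G x + k x * Q x).
Proof.
move=> s1.
apply: (@antitone_cvg0_ge0 (fun t => gphi t - x * Q t + s * (G t + k x * Q t))
  (fun t => (- t * gphi t - x * (- gphi t)) +
    s * (k t * gphi t + k x * (- gphi t)))).
- move=> t _.
  exact: (is_derive1_add (is_derive1_sub (is_derive_gphi t) (is_derive1_scale x (dQ t)))
    (is_derive1_scale s (is_derive1_add (dG t) (is_derive1_scale (k x) (dQ t))))).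
- move=> t xt.
  rewrite [leLHS](_ : _ = gphi t * (s * (k t - k x) - (t - x))); last by ring.
  rewrite pmulr_rle0 ?gphi_gt0// subr_le0 (le_trans (ler_norm _))// normrM.
  rewrite -[leRHS]mul1r ler_pM// (le_trans (k_lip _ _))//.
  by rewrite ger0_norm// subr_ge0.
- rewrite -[X in _ --> X](_ : 0 - x * 0 + s * (0 + k x * 0) = 0); last by ring.
  apply: cvgD; first apply: cvgB; last first.
  - apply: cvgMl_tmp; apply: cvgD; first exact: G0.
    by apply: cvgMl_tmp; exact: Q0.
  - by apply: cvgMl_tmp; exact: Q0.
  - have := @mul_gphi_cvg0 (cst 1) 1.
    under eq_fun do rewrite /= mul1r.
    by apply=> n; rewrite normr1.
Qed.

(** In integral form: the integral of (k t - k x) gphi t over t > x is dominated by that of (t - x)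
    gphi t. *)
Lemma tail_bound x : `|G x + k x * Q x| <= gphi x - x * Q x.
Proof.
have := @tail_bound_signed 1 x; have := @tail_bound_signed (-1) x.
rewrite normrN normr1 lexx => /(_ isT) h1 /(_ isT) h2.
rewrite ler_norml; apply/andP; split; lra.
Qed.

(** The classical lower bound for the Mills ratio; the correction x / (1 + x^2) is chosen so that
    the derivative of the difference is -2 gphi / (1 + x^2)^2. *)
Lemma mills_lower x : 0 <= Q x - x / (1 + x ^+ 2) * gphi x.
Proof.
have p (y : R) : 0 < 1 + y ^+ 2 by rewrite ltr_pwDl// sqr_ge0.
have pn (y : R) : 1 + y * y != 0 by rewrite gt_eqF// -expr2.
apply: (@antitone_cvg0_ge0 (fun t => Q t - t / (1 + t ^+ 2) * gphi t)
  (fun t => - (2 / (1 + t ^+ 2) ^+ 2 * gphi t))).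
- move=> t _.
  have -> : (fun t => Q t - t / (1 + t ^+ 2) * gphi t) =
     (fun t => Q t - t / (1 + t * t) * gphi t) by apply/funext.
  have d2 := is_derive1_add (is_derive1_const 1 t)
    (is_derive1_mul (is_derive1_var t) (is_derive1_var t)).
  have dr := is_derive1_mul (is_derive1_var t) (@is_derive1_inv _ t _ (pn t) d2).
  apply: (is_derive_eq (is_derive1_sub (dQ t) (is_derive1_mul dr (is_derive_gphi t)))).
  by field; exact: pn.
- move=> t _; rewrite oppr_le0 mulr_ge0 ?(ltW (gphi_gt0 _))//.
  by rewrite divr_ge0// exprn_ge0// ltW.
- rewrite -[X in _ --> X]subr0; apply: cvgB => //.
  apply: (@mul_gphi_cvg0 (fun t => t / (1 + t ^+ 2)) 1) => n.
  rewrite ger0_norm ?divr_ge0 ?(ltW (p _))// ler_pdivrMr// mul1r.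
  set N : R := n%:R; have : 0 <= (N - 1) ^+ 2 by rewrite sqr_ge0.
  have : 0 <= N by [].
  nra.
Qed.

(* The correction 8/3 (1 + t)^-3 makes the derivative of the bound exceed
   gphi, because (1 + t)^4 <= 4 (1 + t^2)^2 and 8/3 (t^2 + t + 3) >= 8. *)
Lemma mills_upper x : 0 <= x ->
  0 <= (x / (1 + x ^+ 2) + 8 / 3 / (1 + x) ^+ 3) * gphi x - Q x.
Proof.
move=> x0.
have p (y : R) : 0 < 1 + y ^+ 2 by rewrite ltr_pwDl// sqr_ge0.
have pn (y : R) : 1 + y * y != 0 by rewrite gt_eqF// -expr2.
have q (y : R) : x <= y -> 0 < 1 + y by lra.
have qn (y : R) : x <= y -> (1 + y) * (1 + y) * (1 + y) != 0.
  by move=> /q y0; rewrite gt_eqF// !mulr_gt0.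
apply: (@antitone_cvg0_ge0
  (fun t => (t / (1 + t ^+ 2) + 8 / 3 / (1 + t) ^+ 3) * gphi t - Q t)
  (fun t => gphi t * (2 / (1 + t ^+ 2) ^+ 2 -
     8 / 3 * (t ^+ 2 + t + 3) / (1 + t) ^+ 4))).
- move=> t xt.
  have -> : (fun t => (t / (1 + t ^+ 2) + 8 / 3 / (1 + t) ^+ 3) * gphi t - Q t)
   = (fun t => (t / (1 + t * t) + 8 / 3 * ((1 + t) * (1 + t) * (1 + t))^-1)
     * gphi t - Q t).
    by apply/funext => y; rewrite !exprS expr0 !mulr1 !mulrA.
  have d1 := is_derive1_add (is_derive1_const 1 t) (is_derive1_var t).
  have d2 := is_derive1_add (is_derive1_const 1 t)
    (is_derive1_mul (is_derive1_var t) (is_derive1_var t)).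
  have d3 := is_derive1_mul (is_derive1_mul d1 d1) d1.
  have dr := is_derive1_add
    (is_derive1_mul (is_derive1_var t) (@is_derive1_inv _ t _ (pn t) d2))
    (is_derive1_scale (8 / 3) (@is_derive1_inv _ t _ (qn t xt) d3)).
  apply: (is_derive_eq (is_derive1_sub (is_derive1_mul dr (is_derive_gphi t)) (dQ t))).
  have := pn t; have := gt_eqF (q _ xt) => q0 p0.
  by field; rewrite q0 p0.
- move=> t xt; rewrite pmulr_rle0 ?gphi_gt0// subr_le0.
  rewrite ler_pdivrMr ?exprn_gt0// mulrAC ler_pdivlMr ?exprn_gt0 ?q//.
  have t0 : 0 <= t by lra.
  have h1 : (1 + t) ^+ 2 <= 2 * (1 + t ^+ 2).
    have := sqr_ge0 (t - 1); nra.
  have h2 : (1 + t) ^+ 4 <= 4 * (1 + t ^+ 2) ^+ 2.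
    rewrite (_ : 4 = 2 * 2)%N// exprM.
    rewrite (_ : 4 * _ = (2 * (1 + t ^+ 2)) ^+ 2); last by ring.
    by rewrite lerXn2r// nnegrE ?sqr_ge0// mulr_ge0// ltW.
  have h3 : 0 <= (1 + t ^+ 2) ^+ 2 by rewrite sqr_ge0.
  have h4 : 0 <= (1 + t ^+ 2) ^+ 2 * (t ^+ 2 + t) by rewrite mulr_ge0// addr_ge0// sqr_ge0.
  set a := (1 + t) ^+ 4 in h2 *. set b := (1 + t ^+ 2) ^+ 2 in h2 h3 h4 *.
  nra.
- rewrite -[X in _ --> X]subr0; apply: cvgB => //.
  apply: (@mul_gphi_cvg0 (fun t => t / (1 + t ^+ 2) + 8 / 3 / (1 + t) ^+ 3) (1 + 8 / 3)) => n.
  set N : R := n%:R.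
  have N0 : 0 <= N by [].
  rewrite ger0_norm; last first.
    by rewrite addr_ge0// divr_ge0 ?(ltW (p _))// exprn_ge0// addr_ge0.
  rewrite lerD//.
    rewrite ler_pdivrMr// mul1r.
    have : 0 <= (N - 1) ^+ 2 by rewrite sqr_ge0.
    nra.
  by rewrite ler_pdivrMr ?exprn_gt0 ?ltr_pwDl// ler_peMr// exprn_ege1// lerDl.
Qed.

(** With f = G / gphi, the second quantity is f' and the third is the derivative of x f, from which
    the Lipschitz constant of f' will follow. The test function may grow linearly, so each bound has
    to gain a factor of order 1 / x from the Mills ratio. *)
Lemma half_line_bounds (C0 x : R) : 0 <= x -> `|k 0| <= C0 ->
  let f := G x / gphi x in
  [/\ `|f| <= 4 * (1 + C0), `|x * f + k x| <= 4 * (1 + C0) &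
      `|f + x * (x * f + k x)| <= 4 * (1 + C0)].
Proof.
move=> x0 kC0 f.
have C00 : 0 <= C0 by exact: le_trans kC0.
have kx : `|k x| <= x + C0.
  rewrite -(subrK (k 0) (k x)) (le_trans (ler_normD _ _))// lerD//.
  by rewrite (le_trans (k_lip _ _))// subr0 ger0_norm.
have g0 := gphi_gt0 x.
(* [m] is the Mills ratio, and f = e - k m splits f into an error controlled by [tail_bound] and a
   term in which [m] compensates the growth of [k]. *)
pose m := Q x / gphi x.
pose e := f + k x * m.
have he : `|e| <= 1 - x * m.
  rewrite /e /f /m mulrA -mulrDl normrM normfV (gtr0_norm g0).
  rewrite ler_pdivrMr// mulrBl mul1r (mulrA x) divfK ?gt_eqF//.
  exact: tail_bound.
have p : 0 < 1 + x ^+ 2 by rewrite ltr_pwDl// sqr_ge0.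
have hl : x <= m * (1 + x ^+ 2).
  rewrite -ler_pdivrMr// ler_pdivlMr//.
  by have := mills_lower x; rewrite subr_ge0.
have hu : m * (1 + x ^+ 2) - x <= 8 / 3 / (1 + x).
  have : m <= x / (1 + x ^+ 2) + 8 / 3 / (1 + x) ^+ 3.
    by rewrite ler_pdivrMr// -subr_ge0; exact: mills_upper.
  rewrite -(ler_pM2r p) mulrDl divfK ?gt_eqF// -lerBlDl => /le_trans; apply.
  rewrite ler_pdivlMr; last by rewrite ltr_pwDl.
  rewrite [leLHS](_ : _ = 8 / 3 * ((1 + x) * (1 + x ^+ 2) / (1 + x) ^+ 3)); last by ring.
  rewrite ler_piMr// ler_pdivrMr; last by rewrite exprn_gt0// ltr_pwDl.
  by rewrite mul1r [in leRHS]exprS ler_wpM2l//; [rewrite addr_ge0|nra].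
have m0 : 0 <= m.
  rewrite -(pmulr_lge0 _ p).
  by apply: le_trans hl.
have xm : x * m <= 1 by rewrite -subr_ge0; exact: le_trans he.
have q : 0 < 1 + x by rewrite ltr_pwDl.
have m4 : m <= 4.
  have : 8 / 3 / (1 + x) <= 8 / 3.
    by rewrite ler_pdivrMr// ler_peMr// lerDl.
  move=> h; have h2 : m * (1 + x ^+ 2) <= 4 * (1 + x ^+ 2).
    have := sqr_ge0 (x - 1); nra.
  by rewrite ler_pM2r in h2.
have fE : f = e - k x * m by rewrite /e addrK.
have z0 : 0 <= 1 - x * m by rewrite subr_ge0.
(* This is [hl] multiplied by [x]: the bound 1 - x m on e decays like 1 / (1 + x^2). *)
have zp : (1 + x ^+ 2) * (1 - x * m) <= 1 by nra.
have kz : `|k x| * (1 - x * m) <= (x + C0) * (1 - x * m).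
  by rewrite ler_wpM2r.
split.
- rewrite fE (le_trans (ler_normB _ _))// normrM (ger0_norm m0).
  have : `|k x| * m <= (x + C0) * m by rewrite ler_wpM2r.
  have : C0 * m <= C0 * 4 by rewrite ler_wpM2l.
  nra.
- rewrite (_ : _ + _ = x * e + k x * (1 - x * m)); last by rewrite fE; ring.
  rewrite (le_trans (ler_normD _ _))// !normrM (ger0_norm x0) (ger0_norm z0).
  have : x * `|e| <= x * (1 - x * m) by rewrite ler_wpM2l.
  have : C0 * (1 - x * m) <= C0 * 1.
    by rewrite ler_wpM2l// lerBlDr lerDl mulr_ge0.
  have : 2 * x * (1 - x * m) <= 1.
    apply: le_trans zp; rewrite ler_wpM2r//.
    have := sqr_ge0 (x - 1); nra.
  nra.
(* Here [k] is multiplied by the gap of the lower Mills bound, and the upper bound [hu], of order 1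
   / (1 + x), is what keeps the product bounded. *)
- rewrite (_ : _ + _ = (1 + x ^+ 2) * e - k x * (m * (1 + x ^+ 2) - x)); last first.
    by rewrite fE; ring.
  have hz : 0 <= m * (1 + x ^+ 2) - x by rewrite subr_ge0.
  rewrite (le_trans (ler_normB _ _))// !normrM (gtr0_norm p) (ger0_norm hz).
  have h1 : (1 + x ^+ 2) * `|e| <= 1.
    by apply: le_trans zp; rewrite ler_pM2l.
  have h2 : `|k x| * (m * (1 + x ^+ 2) - x) <= (x + C0) * (8 / 3 / (1 + x)).
    by rewrite ler_pM// subr_ge0.
  have h3 : (x + C0) * (8 / 3 / (1 + x)) <= 8 / 3 * (1 + C0).
    rewrite mulrA ler_pdivrMr//; nra.
  lra.
Qed.

End half_line.

End mills.

(** * Integrals against the normal density *)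

Section gaussian_integrals.
Context {R : realType}.
Notation mu := (@lebesgue_measure R).
Implicit Types (x y t : R).

Lemma normal_pdf_gphi x : normal_pdf 0 1 x = normal_peak 1 * gphi x.
Proof.
rewrite normal_pdfE ?oner_neq0// /normal_fun /gphi subr0 expr1n mulr2n.
by rewrite mulNr.
Qed.

Lemma continuous_gphi : continuous (@gphi R).
Proof.
move=> x; apply/differentiable_continuous/derivable1_diffP.
by apply: ex_derive; exact: is_derive_gphi.
Qed.

Lemma measurable_gphi : measurable_fun setT (@gphi R).
Proof. exact: continuous_measurable_fun continuous_gphi. Qed.

(** The Radon-Nikodym derivative agrees almost everywhere with [normal_pdf], since both have the
    same integral over every measurable set. *)
Lemma normal_change_of_variables (f : R -> \bar R) :
  measurable_fun setT f -> (forall x, 0 <= f x)%E ->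
  (\int[normal_prob 0 1]_x f x = \int[mu]_x (f x * (normal_pdf 0 1 x)%:E))%E.
Proof.
move=> mf f0.
have dom := normal_prob_dominates (0 : R) 1.
rewrite -(Radon_Nikodym_SigmaFinite.change_of_variables dom f0 measurableT mf).
have mg : measurable_fun setT (Radon_Nikodym_SigmaFinite.f (normal_prob 0 1) mu).
  exact: (measurable_int mu (Radon_Nikodym_SigmaFinite.f_integrable dom)).
have mp : measurable_fun setT (fun x => (normal_pdf 0 1 x)%:E : \bar R).
  by apply/measurable_EFinP; exact: measurable_normal_pdf.
apply: ae_eq_integral => //; [exact: emeasurable_funM..|].
apply: ae_eqe_mul2l; apply: integral_ae_eq => //.
  exact: Radon_Nikodym_SigmaFinite.f_integrable.
move=> A _ mA.
by rewrite -Radon_Nikodym_SigmaFinite.f_integral.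
Qed.

(** [gphi] is the square of exp (- x^2 / 4): one factor absorbs the linear growth of [k], the other
    is a multiple of the normal density of variance 2. *)
Lemma integrable_affine_gphi (k : R -> R) (c : R) : measurable_fun setT k ->
  (forall x, `|k x| <= `|x| + c) ->
  mu.-integrable setT (fun x => (k x * gphi x)%:E).
Proof.
move=> mk kc.
have s2 : Num.sqrt 2 != 0 :> R by rewrite gt_eqF// sqrtr_gt0.
have p := normal_peak_gt0 s2.
pose g x := (1 + `|c|) / normal_peak (Num.sqrt 2) * normal_pdf 0 (Num.sqrt 2) x.
have gE x : g x = (1 + `|c|) * expR (- (x ^+ 2 / 4)).
  rewrite /g normal_pdfE// mulrA divfK ?gt_eqF//; congr (_ * expR _).
  by rewrite subr0 sqr_sqrtr// -mulr_natr -natrM mulNr.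
have ig : mu.-integrable setT (EFin \o g).
  rewrite (_ : EFin \o g = (fun x => ((1 + `|c|) / normal_peak (Num.sqrt 2))%:E *
      (normal_pdf 0 (Num.sqrt 2) x)%:E)%E); last first.
    by apply/funext => x; rewrite /= EFinM.
  by apply: integrableZl => //; exact: integrable_normal_pdf.
apply: le_integrable ig => //.
  apply/measurable_EFinP; apply: measurable_funM => //; exact: measurable_gphi.
move=> x _; rewrite /= lee_fin normrM (gtr0_norm (gphi_gt0 _)).
rewrite gE [leRHS]ger0_norm ?mulr_ge0 ?addr_ge0 ?expR_ge0//.
have -> : gphi x = expR (- (x ^+ 2 / 4)) * expR (- (x ^+ 2 / 4)).
  by rewrite -expRD /gphi; congr expR; field.
rewrite mulrA ler_pM2r ?expR_gt0// expRN ler_pdivrMr ?expR_gt0//.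
apply: le_trans (kc x) _.
have h1 : 1 + x ^+ 2 / 4 <= expR (x ^+ 2 / 4) by exact: expR_ge1Dx.
have h2 : `|x| <= 1 + x ^+ 2 / 4.
  have := sqr_ge0 (`|x| / 2 - 1); rewrite -(real_normK (num_real x)); nra.
have h3 : 1 <= expR (x ^+ 2 / 4).
  by apply: le_trans h1; rewrite lerDl divr_ge0// sqr_ge0.
have h4 : c <= `|c| by exact: ler_norm.
have h5 : `|c| <= `|c| * expR (x ^+ 2 / 4) by rewrite ler_peMr.
lra.
Qed.

Section primitive.
Variable g : R -> R.
Hypothesis cg : continuous g.
Hypothesis ig : mu.-integrable setT (EFin \o g).

Let A x : R := (\int[mu]_(t in `]-oo, x]) g t)%R.

Lemma is_derive_primitive x : is_derive x 1 A (g x).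
Proof.
have [] := @continuous_FTC1 R g -oo%O x (x + 1).
- by rewrite ltrDl.
- by apply: integrableS ig.
- by rewrite ltNyr.
- exact: cg.
- by move=> dA A'; split => //; rewrite -derive1E.
Qed.

Lemma primitive_cvgy : A n%:R @[n --> \oo] --> (\int[mu]_t g t)%R.
Proof.
have mg : measurable_fun setT (fun t => (g t)%:E) by exact: (measurable_int mu ig).
apply: fine_cvg; rewrite fineK; last exact: integrable_fin_num ig.
under eq_fun do rewrite integral_mkcond.
apply: (@dominated_cvg _ _ _ mu setT measurableT
  (fun n => (fun t => (g t)%:E) \_ `]-oo, n%:R]) _ (fun t => `|g t|%:E)) => //.
- move=> n; apply: (iffLR (measurable_restrictT _ _)) => //.
  exact: measurable_funTS.
- move=> t _; apply: cvg_near_cst; near=> n.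
  have tn : t <= n%:R by near: n; exact: nbhs_infty_ger.
  by rewrite patchE mem_set//= in_itv/=.
- exact: integrable_norm ig.
- move=> n t _; rewrite patchE; case: ifP => //.
  by rewrite abse0 lee_fin.
Unshelve. all: by end_near. Qed.

Lemma primitive_cvgNy : A (- n%:R) @[n --> \oo] --> 0.
Proof.
have mg : measurable_fun setT (fun t => (g t)%:E) by exact: (measurable_int mu ig).
apply: fine_cvg.
under eq_fun do rewrite integral_mkcond.
have -> : 0%:E = (\int[mu]_t (cst 0%E t))%E.
  by rewrite integral_cst// mul0e.
apply: (@dominated_cvg _ _ _ mu setT measurableT
  (fun n => (fun t => (g t)%:E) \_ `]-oo, - n%:R]) _ (fun t => `|g t|%:E)) => //.
- move=> n; apply: (iffLR (measurable_restrictT _ _)) => //.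
  exact: measurable_funTS.
- move=> t _; apply: cvg_near_cst; near=> n.
  have tn : - t < n%:R by near: n; exact: nbhs_infty_gtr.
  by rewrite patchE memNset//= in_itv/=; apply/negP; rewrite -ltNge ltrNl.
- exact: integrable_norm ig.
- move=> n t _; rewrite patchE; case: ifP => //.
  by rewrite abse0 lee_fin.
Unshelve. all: by end_near. Qed.

End primitive.

End gaussian_integrals.

(** * Stein's equation *)

Section stein_equation.
Context {R : realType}.
Notation mu := (@lebesgue_measure R).

Definition lipschitz1 (h : R -> R) := forall x y, `|h x - h y| <= `|x - y|.

(** All that the later parts know about the normal law. The constant [C] is uniform over the test
    functions, as the supremum in [dW] requires. *)
Definition stein_bounded {dZ} {OmegaZ : measurableType dZ} (PZ : probability OmegaZ R)
    (Z : OmegaZ -> R) (C : R) :=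
  forall h, lipschitz1 h ->
  PZ.-integrable setT (EFin \o (h \o Z)) /\
  exists f f' : R -> R, [/\ (forall x : R, is_derive x 1 f (f' x)),
    (forall x, f' x = x * f x + (h x - fine 'E_PZ[h \o Z])),
    (forall x, `|f x| <= C), (forall x, `|f' x| <= C) &
    (forall x y, `|f' x - f' y| <= C * `|x - y|)].

Lemma lipschitz1_continuous h : lipschitz1 h -> continuous h.
Proof.
move=> hl x; apply/cvgrPdist_lt => e e0; near=> y.
apply: le_lt_trans (hl _ _) _.
by near: y; exact: cvgr_dist_lt.
Unshelve. all: by end_near. Qed.

Lemma integrable_gphi : mu.-integrable setT (EFin \o (@gphi R)).
Proof.
rewrite (_ : _ \o _ = (fun x => (cst 1 x * gphi x)%:E)); last first.
  by apply/funext => y; rewrite /= mul1r.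
by apply: (@integrable_affine_gphi _ _ 1) => // y; rewrite /= normr1 lerDr.
Qed.

Lemma integral_gphi : (normal_peak 1 * \int[mu]_x gphi x)%R = 1 :> R.
Proof.
rewrite -RintegralZl//; last exact: integrable_gphi.
rewrite /Rintegral; under eq_integral do rewrite -normal_pdf_gphi.
by rewrite integral_normal_pdf.
Qed.

(* The two expressions for G / gphi on the half-lines are exchanged by
   x |-> - x, which preserves the Stein equation up to k |-> - k (- .). *)
Lemma stein_bounds (k G : R -> R) (C0 : R) : lipschitz1 k ->
  (forall x : R, is_derive x 1 G (k x * gphi x)) ->
  G n%:R @[n --> \oo] --> 0 -> G (- n%:R) @[n --> \oo] --> 0 ->
  `|k 0| <= C0 -> forall x,
  let f := G x / gphi x in
  [/\ `|f| <= 4 * (1 + C0), `|x * f + k x| <= 4 * (1 + C0) &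
      `|f + x * (x * f + k x)| <= 4 * (1 + C0)].
Proof.
move=> kl dG Gy GNy kC0 x f.
have ig := integrable_gphi.
pose I : R := \int[mu]_t gphi t.
pose Q (y : R) : R := I - \int[mu]_(t in `]-oo, y]) gphi t.
have dQ (y : R) : is_derive y 1 Q (- gphi y).
  rewrite -[X in is_derive _ _ _ X]sub0r.
  exact: (is_derive1_sub (is_derive1_const I y) (is_derive_primitive (@continuous_gphi R) ig y)).
have Q0 : Q n%:R @[n --> \oo] --> 0.
  rewrite -(subrr I); apply: cvgB; first exact: cvg_cst.
  exact: primitive_cvgy.
have [x0|x0] := leP 0 x.
  exact: (half_line_bounds kl dG dQ Gy Q0 x0 kC0).
have gN y : gphi (- y) = gphi y :> R by rewrite /gphi sqrrN.
have kl' : lipschitz1 (fun y => - k (- y)).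
  by move=> y z; rewrite -opprD normrN (le_trans (kl _ _))// -opprD normrN.
have dG' (y : R) : is_derive y 1 (fun y => G (- y)) (- k (- y) * gphi y).
  have -> : - k (- y) * gphi y = k (- y) * gphi (- y) * -1.
    by rewrite gN mulrN1 mulNr.
  exact: is_derive1_comp.
have Nx0 : 0 <= - x by rewrite oppr_ge0 ltW.
have kC0' : `|- k (- 0)| <= C0 by rewrite oppr0 normrN.
have /= := half_line_bounds kl' dG' dQ GNy Q0 Nx0 kC0'.
rewrite opprK gN -/f => -[h1 h2 h3]; split => //.
  by rewrite -normrN opprD -mulNr.
by move: h3; congr (`|_| <= _); ring.
Qed.

Context {dZ : measure_display} {OmegaZ : measurableType dZ}
  {PZ : probability OmegaZ R} (Z : {RV PZ >-> R}).
Hypothesis Z_normal : forall V, measurable V ->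
  distribution PZ Z V = normal_prob 0 1 V.

Lemma ge0_normal_expectation (f : R -> \bar R) :
  measurable_fun setT f -> (forall x, 0 <= f x)%E ->
  (\int[PZ]_w (f (Z w)) = \int[mu]_x (f x * (normal_pdf 0 1 x)%:E))%E.
Proof.
move=> mf f0; rewrite -normal_change_of_variables//.
have mZ : measurable_fun setT (Z : OmegaZ -> measurableTypeR R).
  exact: (measurable_funPT Z).
pose Z' : {RV PZ >-> measurableTypeR R} :=
  HB.pack (Z : OmegaZ -> measurableTypeR R) (isMeasurableFun.Build _ _ _ _ _ mZ).
transitivity (\int[distribution PZ Z']_y f y)%E.
  by rewrite ge0_integral_distribution.
by apply: eq_measure_integral => V mV _; exact: Z_normal.
Qed.

(** Positive and negative parts are transported separately, as the change of variables is for
    nonnegative functions. The second conclusion says that h - E h(Z) integrates to 0 against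
    [gphi], which makes the solution of Stein's equation decay on both sides. *)
Lemma normal_expectation_lipschitz (h : R -> R) : lipschitz1 h ->
  PZ.-integrable setT (EFin \o (h \o Z)) /\
  (\int[mu]_x (h x * gphi x) = fine 'E_PZ[h \o Z] * \int[mu]_x gphi x)%R.
Proof.
move=> hl.
have mh : measurable_fun setT h.
  exact: continuous_measurable_fun (lipschitz1_continuous hl).
have igh : mu.-integrable setT (EFin \o (fun x => h x * gphi x)).
  apply: (@integrable_affine_gphi _ _ `|h 0|) => // x.
  by rewrite -[h x](subrK (h 0)) (le_trans (ler_normD _ _))// lerD2r -[X in _ <= `|X|]subr0.
have p0 : 0 < normal_peak 1 :> R by rewrite normal_peak_gt0// oner_eq0.
pose hp x := h x * normal_pdf 0 1 x.
have hpE x : hp x = normal_peak 1 * (h x * gphi x).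
  by rewrite /hp normal_pdf_gphi; ring.
have ihp : mu.-integrable setT (EFin \o hp).
  rewrite (_ : EFin \o hp = (fun x => (normal_peak 1)%:E * (h x * gphi x)%:E)%E); last first.
    by apply/funext => x; rewrite /= hpE EFinM.
  exact: integrableZl.
have posE : ((EFin \o h)^\+ \* (fun x => (normal_pdf 0 1 x)%:E))%E = (EFin \o hp)^\+%E.
  apply/funext => x; rewrite !funeposE/= muleC maxe_pMr ?lee_fin ?normal_pdf_ge0//.
  by rewrite mule0 -EFinM mulrC.
have negE : ((EFin \o h)^\- \* (fun x => (normal_pdf 0 1 x)%:E))%E = (EFin \o hp)^\-%E.
  apply/funext => x; rewrite !funenegE/= muleC maxe_pMr ?lee_fin ?normal_pdf_ge0//.
  by rewrite mule0 -EFinM mulrN [X in - X]mulrC.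
have mEh : measurable_fun setT (EFin \o h) by exact/measurable_EFinP.
have posI : (\int[PZ]_w ((EFin \o h)^\+ (Z w)) = \int[mu]_x ((EFin \o hp)^\+ x))%E.
  by rewrite -posE ge0_normal_expectation//; exact: measurable_funepos.
have negI : (\int[PZ]_w ((EFin \o h)^\- (Z w)) = \int[mu]_x ((EFin \o hp)^\- x))%E.
  by rewrite -negE ge0_normal_expectation//; exact: measurable_funeneg.
have ihZ : PZ.-integrable setT (EFin \o (h \o Z)).
  apply/integrableP; split.
    by apply/measurable_EFinP; exact: measurableT_comp.
  have /integrableP[_] := ihp; apply: le_lt_trans.
  rewrite (ge0_normal_expectation (f := fun x => `|h x|%:E))//; last first.
    by apply/measurable_EFinP; exact: measurableT_comp.
  apply: ge0_le_integral => //.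
  - by move=> x _; rewrite mule_ge0 ?lee_fin ?normal_pdf_ge0.
  - apply: emeasurable_funM; apply/measurable_EFinP.
      exact: measurableT_comp.
    exact: measurable_normal_pdf.
  - by apply: measurableT_comp => //; exact: (measurable_int mu ihp).
  - by move=> x _; rewrite -EFinM lee_fin normrM (ger0_norm (normal_pdf_ge0 _ _ _)).
split => //.
have EE : ('E_PZ[h \o Z])%E = (\int[mu]_x (hp x)%:E)%E.
  rewrite unlock integralE [RHS]integralE -posI -negI.
  by congr (_ - _)%E; apply: eq_integral => w _; rewrite ?funeposE ?funenegE.
have pI := integral_gphi.
have -> : fine 'E_PZ[h \o Z] = normal_peak 1 * \int[mu]_x (h x * gphi x).
  by rewrite EE -RintegralZl//; congr fine; apply: eq_integral => x _; rewrite hpE.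
by rewrite mulrAC pI mul1r.
Qed.

Lemma stein_solution : exists2 C : R, 0 < C & stein_bounded PZ Z C.
Proof.
pose I : R := \int[mu]_t gphi t.
(* [C0] is E|Z|. It bounds the centred test function at 0, uniformly in [h]. *)
pose C0 : R := (\int[mu]_t (`|t| * gphi t)) / I.
have ig := integrable_gphi.
have ign : mu.-integrable setT (EFin \o (fun t : R => `|t| * gphi t)).
  apply: (@integrable_affine_gphi _ _ 0) => [|y]; last by rewrite normr_id addr0.
  exact: normr_measurable.
have I0 : 0 < I.
  have p0 : 0 < normal_peak 1 :> R by rewrite normal_peak_gt0// oner_eq0.
  by rewrite -(pmulr_rgt0 _ p0) integral_gphi.
have C00 : 0 <= C0.
  rewrite divr_ge0 ?(ltW I0)// Rintegral_ge0// => t _.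
  by rewrite mulr_ge0// ltW// gphi_gt0.
(* 4 (1 + C0) bounds f, f' and the derivative of x f; the extra 1 is the Lipschitz constant of [h],
   which enters that of f'. *)
exists (4 * (1 + C0) + 1); first by rewrite ltr_pwDr// mulr_ge0// addr_ge0.
move=> h hl; have [ih hE] := normal_expectation_lipschitz hl; split => //.
pose k x := h x - fine 'E_PZ[h \o Z].
have kl : lipschitz1 k by move=> x y; rewrite /k opprB addrA subrK.
have ck : continuous k by exact: lipschitz1_continuous.
pose g x := k x * gphi x.
have cg : continuous g.
  by move=> x; apply: cvgM; [exact: ck|exact: continuous_gphi].
have igk : mu.-integrable setT (EFin \o g).
  apply: (@integrable_affine_gphi _ _ `|k 0|) => [|x].
    exact: continuous_measurable_fun.
  by rewrite -[k x](subrK (k 0)) (le_trans (ler_normD _ _))// lerD2r -[X in _ <= `|X|]subr0.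
have igh : mu.-integrable setT (EFin \o (fun x => h x * gphi x)).
  apply: (@integrable_affine_gphi _ _ `|h 0|) => [|x].
    exact: continuous_measurable_fun (lipschitz1_continuous hl).
  by rewrite -[h x](subrK (h 0)) (le_trans (ler_normD _ _))// lerD2r -[X in _ <= `|X|]subr0.
have g0 : (\int[mu]_t g t)%R = 0.
  rewrite /g /k; under eq_Rintegral do rewrite mulrBl.
  rewrite RintegralB// ?RintegralZl// ?hE ?subrr//.
  rewrite (_ : EFin \o _ = (fun x => (fine 'E_PZ[h \o Z])%:E * (gphi x)%:E)%E); last first.
    by apply/funext => x; rewrite /= EFinM.
  exact: integrableZl.
(* As [g] integrates to 0, k 0 times the mass of [gphi] is the integral of (k 0 - k t) gphi t, and
   |k 0 - k t| <= |t|. *)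
have k0 : `|k 0| <= C0.
  rewrite ler_pdivlMr// -(ger0_norm (ltW I0)) -normrM /I -RintegralZl//.
  rewrite -[X in `|X|]subr0 -[X in _ - X]g0 -RintegralB//; last first.
    rewrite (_ : EFin \o _ = (fun x => (k 0)%:E * (gphi x)%:E)%E); last first.
      by apply/funext => x; rewrite /= EFinM.
    exact: integrableZl.
  have ikk : mu.-integrable setT (EFin \o (fun x => k 0 * gphi x - g x)).
    rewrite (_ : EFin \o _ = (fun x => (k 0)%:E * (gphi x)%:E - (g x)%:E)%E); last first.
      by apply/funext => x; rewrite /= EFinB EFinM.
    by apply: integrableB => //; exact: integrableZl.
  apply: le_trans (le_normr_Rintegral _ ikk) _ => //.
  apply: le_Rintegral => //; first exact: integrable_norm ikk.
  move=> x _; rewrite /g -mulrBl normrM (gtr0_norm (gphi_gt0 _)).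
  by rewrite ler_pM2r ?gphi_gt0// (le_trans (kl _ _))// sub0r normrN.
pose G (x : R) : R := \int[mu]_(t in `]-oo, x]) g t.
have dG (x : R) : is_derive x 1 G (k x * gphi x) by exact: (is_derive_primitive cg igk).
have Gy : G n%:R @[n --> \oo] --> 0 by rewrite -g0; exact: primitive_cvgy.
have GNy : G (- n%:R) @[n --> \oo] --> 0 by exact: primitive_cvgNy.
have B := stein_bounds kl dG Gy GNy k0.
pose f x := G x / gphi x.
have df (x : R) : is_derive x 1 f (x * f x + k x).
  have gn0 : gphi x != 0 by rewrite gt_eqF ?gphi_gt0.
  apply: (is_derive_eq (is_derive1_mul (dG x) (is_derive1_inv gn0 (is_derive_gphi x)))).
  by rewrite /f; field.
exists f, (fun x => x * f x + k x); split => //.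
- by move=> x; have [h1 _ _] := B x; rewrite (le_trans h1)// lerDl.
- by move=> x; have [_ h1 _] := B x; rewrite (le_trans h1)// lerDl.
move=> x y; rewrite (_ : _ - _ = (x * f x - y * f y) + (k x - k y)); last by ring.
rewrite (le_trans (ler_normD _ _))// mulrDl mul1r lerD//.
wlog xy : x y / y <= x => [hw|].
  have [|/ltW] := leP y x; first exact: hw.
  by rewrite distrC (distrC x y); exact: hw.
have dxf (z : R) : is_derive z 1 (fun z => z * f z) (f z + z * (z * f z + k z)).
  apply: (is_derive_eq (is_derive1_mul (is_derive1_var z) (df z))).
  by rewrite mul1r.
have [|c _ ->] := @MVT_segment R _ _ y x xy (fun z _ => dxf z).
  apply: derivable_within_continuous => z _.
  by apply: ex_derive; exact: dxf.
by rewrite normrM ler_wpM2r//; have [_ _] := B c.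
Qed.

End stein_equation.

(** * Integrable real functions and their expectations *)

Section expectation_calculus.
Context {R : realType} {d} {T : measurableType d} (P : probability T R).
Implicit Types (f g : T -> R).

Definition L1 f := P.-integrable setT (EFin \o f).
Definition Ex f : R := \int[P]_w f w.

Lemma L1_measurable f : L1 f -> measurable_fun setT f.
Proof. by move=> /(measurable_int P)/measurable_EFinP. Qed.

Lemma L1_dom f g : measurable_fun setT f -> L1 g ->
  (forall w, `|f w| <= g w) -> L1 f.
Proof.
move=> mf ig fg; apply: le_integrable ig => //; first exact/measurable_EFinP.
by move=> w _; rewrite /= lee_fin (le_trans (fg w))// ler_norm.
Qed.

Lemma L1_cst c : L1 (cst c).
Proof. exact: finite_measure_integrable_cst. Qed.

Lemma L1_norm f : L1 f -> L1 (fun w => `|f w|).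
Proof. exact: integrable_norm. Qed.

Lemma L1D f g : L1 f -> L1 g -> L1 (fun w => f w + g w).
Proof. by move=> fi gi; exact: (integrableD measurableT fi gi). Qed.

Lemma L1B f g : L1 f -> L1 g -> L1 (fun w => f w - g w).
Proof. by move=> fi gi; exact: (integrableB measurableT fi gi). Qed.

Lemma L1Z c f : L1 f -> L1 (fun w => c * f w).
Proof. by move=> fi; exact: (integrableZl measurableT c fi). Qed.

Lemma L1_sum (I : Type) (s : seq I) (Q : pred I) (F : I -> T -> R) :
  (forall i, Q i -> L1 (F i)) -> L1 (fun w => \sum_(j <- s | Q j) F j w).
Proof.
move=> iF; elim: s => [|i s ih].
  have -> : (fun w => \sum_(j <- [::] | Q j) F j w) = cst 0.
    by apply/funext => w; rewrite big_nil.
  exact: L1_cst.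
have -> : (fun w => \sum_(j <- i :: s | Q j) F j w) =
    fun w => (if Q i then F i w else 0) + \sum_(j <- s | Q j) F j w.
  by apply/funext => w; rewrite big_cons; case: ifP => // _; rewrite add0r.
by apply: L1D => //; case Qi : (Q i); [exact: iF|exact: L1_cst].
Qed.

Lemma L1_mul_bounded f g C : L1 f -> measurable_fun setT g ->
  (forall w, `|g w| <= C) -> L1 (fun w => f w * g w).
Proof.
move=> fi mg gC; apply: (@L1_dom _ (fun w => C * `|f w|)).
- by apply: measurable_funM => //; exact: L1_measurable.
- exact/L1Z/L1_norm.
- by move=> w; rewrite normrM mulrC ler_wpM2r.
Qed.

Lemma L1_bounded g C : measurable_fun setT g ->
  (forall w, `|g w| <= C) -> L1 g.
Proof. by move=> mg gC; apply: (@L1_dom _ (cst C)) => //; exact: L1_cst. Qed.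

Lemma ExD f g : L1 f -> L1 g -> Ex (fun w => f w + g w) = Ex f + Ex g.
Proof. by move=> fi gi; exact: RintegralD. Qed.

Lemma ExB f g : L1 f -> L1 g -> Ex (fun w => f w - g w) = Ex f - Ex g.
Proof. by move=> fi gi; exact: RintegralB. Qed.

Lemma ExZ c f : L1 f -> Ex (fun w => c * f w) = c * Ex f.
Proof. by move=> fi; exact: RintegralZl. Qed.

Lemma Ex_cst c : Ex (cst c) = c.
Proof.
rewrite /Ex (Rintegral_cst P measurableT c) -[RHS]mulr1; congr (_ * _).
exact: (congr1 fine (probability_setT P)).
Qed.

Lemma Ex_sum (I : Type) (s : seq I) (Q : pred I) (F : I -> T -> R) :
  (forall i, Q i -> L1 (F i)) ->
  Ex (fun w => \sum_(j <- s | Q j) F j w) = \sum_(j <- s | Q j) Ex (F j).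
Proof.
move=> iF; elim: s => [|i s ih].
  rewrite big_nil -[RHS](Ex_cst 0); congr Ex.
  by apply/funext => w; rewrite big_nil.
have -> : (fun w => \sum_(j <- i :: s | Q j) F j w) =
    fun w => (if Q i then F i w else 0) + \sum_(j <- s | Q j) F j w.
  by apply/funext => w; rewrite big_cons; case: ifP => // _; rewrite add0r.
rewrite ExD ?ih//; last 2 first.
  by case Qi : (Q i); [exact: iF|exact: L1_cst].
  exact: L1_sum.
by rewrite big_cons; case: (Q i) => //; rewrite (Ex_cst 0) add0r.
Qed.

Lemma Ex_le f g : L1 f -> L1 g -> (forall w, f w <= g w) -> Ex f <= Ex g.
Proof. by move=> fi gi fg; apply: le_Rintegral. Qed.

Lemma Ex_ge0 f : (forall w, 0 <= f w) -> 0 <= Ex f.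
Proof. by move=> f0; apply: Rintegral_ge0. Qed.

Lemma Ex_norm f : L1 f -> `|Ex f| <= Ex (fun w => `|f w|).
Proof. by move=> fi; apply: le_normr_Rintegral. Qed.

Lemma Ex_norm_le f g : L1 f -> L1 g -> (forall w, `|f w| <= g w) ->
  `|Ex f| <= Ex g.
Proof.
move=> fi gi fg; apply: le_trans (Ex_norm fi) _.
by apply: Ex_le => //; exact: L1_norm.
Qed.

Lemma Ex_norm_bound f C : L1 f -> (forall w, `|f w| <= C) -> `|Ex f| <= C.
Proof.
move=> fi fC; rewrite -[C in leRHS]Ex_cst; apply: Ex_norm_le => //.
exact: L1_cst.
Qed.

End expectation_calculus.

(** * Domination by third powers *)

Section cube_bounds.
Context {R : realType}.
Implicit Types a b c : R.

Lemma norm_le_cube a : `|a| <= 1 + `|a| ^+ 3.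
Proof.
have := normr_ge0 a; move: `|a| => x x0.
have [x1|/ltW x1] := leP x 1; first by rewrite ler_wpDr// exprn_ge0.
by rewrite ler_wpDl// exprS ler_peMr// exprn_ege1.
Qed.

(** The product is at most the cube of its largest factor. *)
Lemma normM3_le_cube a b c :
  `|a| * `|b| * `|c| <= `|a| ^+ 3 + `|b| ^+ 3 + `|c| ^+ 3.
Proof.
move: (normr_ge0 a) (normr_ge0 b) (normr_ge0 c).
move: `|a| `|b| `|c| => x y z x0 y0 z0.
have key m : x <= m -> y <= m -> z <= m -> x * y * z <= m ^+ 3.
  move=> xm ym zm; rewrite !exprS expr0 mulr1 mulrA.
  by rewrite !ler_pM// mulr_ge0.
have [xy|/ltW yx] := leP x y; have [yz|/ltW zy] := leP y z.
- by rewrite (le_trans (key z _ _ _))// ?(le_trans xy)// ler_wpDl// addr_ge0// exprn_ge0.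
- by rewrite (le_trans (key y _ _ _))// -addrA ler_wpDl ?exprn_ge0// lerDl exprn_ge0.
- have [xz|/ltW zx] := leP x z.
    by rewrite (le_trans (key z _ _ _))// ler_wpDl// addr_ge0// exprn_ge0.
  by rewrite (le_trans (key x _ _ _))// -addrA lerDl addr_ge0// exprn_ge0.
- by rewrite (le_trans (key x _ _ _))// ?(le_trans zy)// -addrA lerDl addr_ge0// exprn_ge0.
Qed.

Lemma normM_le_cube a b : `|a| * `|b| <= `|a| ^+ 3 + `|b| ^+ 3 + 1.
Proof. by have := normM3_le_cube a b 1; rewrite normr1 mulr1 expr1n. Qed.

End cube_bounds.

(** * Stein's method for dissociated sums *)

Section dissociated.
Context {R : realType} {d} {T : measurableType d} (P : probability T R).
Local Notation L1 := (L1 P).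
Local Notation E := (Ex P).

(** [N i] is meant for the blocks near [i] and [N' i] for those near [N i]. Independence is replaced
    by the three decorrelation hypotheses, and [sigma] need not be the standard deviation of [W]:
    the error [e'] measures the discrepancy. *)
Variables (I : finType) (V : I -> T -> R) (N N' : I -> {set I}).
Variables (M kappa sigma L e e' : R) (f f' : R -> R).
Hypothesis mV : forall i, measurable_fun setT (V i).
Hypothesis V3 : forall i, L1 (fun w => `|V i w| ^+ 3).
Hypothesis VM : forall i, E (fun w => `|V i w| ^+ 3) <= M.
Hypothesis M1 : 1 <= M.
Hypothesis N_le : forall i, #|N i|%:R <= kappa.
Hypothesis N'_le : forall i, #|N' i|%:R <= kappa.
Hypothesis sigma_gt0 : 0 < sigma.
Hypothesis L0 : 0 <= L.
Hypothesis df : forall x : R, is_derive x 1 f (f' x).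
Hypothesis fL : forall x, `|f x| <= L.
Hypothesis f'L : forall x, `|f' x| <= L.
Hypothesis f'_lip : forall x y, `|f' x - f' y| <= L * `|x - y|.

Let W w := \sum_i V i w.
Let eta i w := \sum_(j in N i) V j w.
Let zeta i w := \sum_(j in N' i) V j w.
Let kappa0 i : 0 <= kappa := le_trans (ler0n _ _) (N_le i).
Let M0 : 0 <= M. Proof. exact: le_trans M1. Qed.

Hypothesis decor1 : forall i,
  `|E (fun w => V i w * f ((W w - eta i w) / sigma))| <= e.
Hypothesis decor2 : forall i,
  `|E (fun w => V i w * eta i w * f' ((W w - zeta i w) / sigma)) -
    E (fun w => V i w * eta i w) * E (fun w => f' ((W w - zeta i w) / sigma))|
  <= e.
Hypothesis decor3 : forall i, `|E (fun w => V i w * (W w - eta i w))| <= e.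
Hypothesis varW : `|E (fun w => W w ^+ 2) - sigma ^+ 2| <= e'.

Lemma L1_prod2 i j : L1 (fun w => V i w * V j w).
Proof.
apply: (@L1_dom _ _ _ _ _ (fun w => `|V i w| ^+ 3 + `|V j w| ^+ 3 + 1)).
- exact: measurable_funM.
- by apply: L1D; [exact: L1D|exact: L1_cst].
- by move=> w; rewrite normrM; exact: normM_le_cube.
Qed.

Lemma L1_single i : L1 (V i).
Proof.
apply: (@L1_dom _ _ _ _ _ (fun w => 1 + `|V i w| ^+ 3)) => //.
- by apply: L1D => //; exact: L1_cst.
- by move=> w; exact: norm_le_cube.
Qed.

Let L1_prod3 i j k : L1 (fun w => `|V i w| * `|V j w| * `|V k w|).
Proof.
apply: (@L1_dom _ _ _ _ _ (fun w => `|V i w| ^+ 3 + `|V j w| ^+ 3 + `|V k w| ^+ 3)).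
- by apply: measurable_funM; [apply: measurable_funM|]; exact: measurableT_comp.
- by apply: L1D => //; exact: L1D.
- by move=> w; rewrite !normrM !normr_id; exact: normM3_le_cube.
Qed.

Let E_prod3 i j k : E (fun w => `|V i w| * `|V j w| * `|V k w|) <= 3 * M.
Proof.
apply: le_trans (_ : E (fun w => `|V i w| ^+ 3 + `|V j w| ^+ 3 + `|V k w| ^+ 3) <= _).
  apply: Ex_le => //; last by move=> w; exact: normM3_le_cube.
  by apply: L1D => //; exact: L1D.
rewrite !ExD//; last exact: L1D.
by have := VM i; have := VM j; have := VM k; lra.
Qed.

Lemma E_prod2 i j : `|E (fun w => V i w * V j w)| <= 3 * M.
Proof.
apply: le_trans (_ : E (fun w => `|V i w| ^+ 3 + `|V j w| ^+ 3 + 1) <= _).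
  apply: Ex_norm_le; [exact: L1_prod2| |].
    by apply: L1D; [exact: L1D|exact: L1_cst].
  by move=> w; rewrite normrM; exact: normM_le_cube.
rewrite ExD ?ExD//; [|exact: L1D|exact: L1_cst].
rewrite (Ex_cst P 1).
by move: (VM i) (VM j) M1; set a := Ex _ _; set b := Ex _ _; lra.
Qed.

Let E_single i : E (fun w => `|V i w|) <= 2 * M.
Proof.
apply: le_trans (_ : E (fun w => 1 + `|V i w| ^+ 3) <= _).
  apply: Ex_le; [exact/L1_norm/L1_single| |].
    by apply: L1D => //; exact: L1_cst.
  by move=> w; exact: norm_le_cube.
rewrite ExD//; last exact: L1_cst.
rewrite (Ex_cst P 1).
by move: (VM i) M1; set a := Ex _ _; lra.
Qed.

Let cf : continuous f.
Proof.
move=> x; apply/differentiable_continuous/derivable1_diffP.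
by apply: ex_derive; exact: df.
Qed.

Let mf : measurable_fun setT f.
Proof. exact: continuous_measurable_fun. Qed.

Let mf' : measurable_fun setT f'.
Proof.
apply: continuous_measurable_fun => x.
apply/cvgrPdist_lt => a a0.
have L10 : 0 < L + 1 by rewrite ltr_wpDl.
have aL0 : 0 < a / (L + 1) by exact: divr_gt0.
near=> y; apply: le_lt_trans (f'_lip _ _) _.
have xy : `|x - y| < a / (L + 1) by near: y; exact: cvgr_dist_lt.
rewrite ltr_pdivlMr// in xy; apply: le_lt_trans xy.
by rewrite mulrDr mulr1 mulrC lerDl.
Unshelve. all: by end_near. Qed.

Let mW : measurable_fun setT W.
Proof. by apply: measurable_sum => i; exact: mV. Qed.

Let msum (A : {set I}) : measurable_fun setT (fun w => \sum_(j in A) V j w).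
Proof.
under eq_fun do rewrite big_mkcond.
by apply: measurable_sum => j; case: (j \in A).
Qed.

Let mdiff (A : {set I}) :
  measurable_fun setT (fun w => (W w - \sum_(j in A) V j w) / sigma).
Proof. by apply: measurable_funM => //; exact: measurable_funB. Qed.

(* The Taylor remainder of f (W / sigma) around the sum without the
   neighbourhood N i; in the linear term the base point is moved further, to
   the sum without N' i, so that it decouples from V i * eta i. *)
Let rho i w := V i w * f (W w / sigma) -
  (V i w * f ((W w - eta i w) / sigma) +
   sigma^-1 * (V i w * eta i w * f' ((W w - zeta i w) / sigma))).

Let rho_le i w : `|rho i w| <= L / sigma ^+ 2 *
  \sum_(j in N i) (\sum_(k in N i) (`|V i w| * `|V j w| * `|V k w|) +
                 \sum_(k in N' i) (`|V i w| * `|V j w| * `|V k w|)).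
Proof.
set x := W w / sigma; set y := (W w - eta i w) / sigma.
set z := (W w - zeta i w) / sigma.
have xyE : x - y = eta i w / sigma by rewrite /x /y; ring.
(* Mean value theorem for both orders of [x] and [y]; only the closeness of [c] to [x] is
   retained. *)
have [c hc fxy] : exists2 c, `|c - x| <= `|x - y| & f x - f y = f' c * (x - y).
  have dwc (a b : R) : {within `[a, b], continuous f}.
    exact: continuous_subspaceT.
  have [yx|/ltW xy] := leP y x.
    have [c /itvP cP ->] := @MVT_segment R f f' y x yx (fun z _ => df z) (dwc _ _).
    by exists c => //; rewrite distrC !ger0_norm ?subr_ge0 ?cP ?lerB ?cP.
  have [c /itvP cP fE] := @MVT_segment R f f' x y xy (fun z _ => df z) (dwc _ _).
  exists c; last by rewrite -opprB fE -mulrN opprB.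
  by rewrite [leRHS]distrC !ger0_norm ?subr_ge0 ?cP ?lerB ?cP.
have zxE : x - z = zeta i w / sigma by rewrite /x /z; ring.
(* The Lipschitz bound on [f'] turns this into a sum of products of three variables, hence the third
   moments. *)
have -> : rho i w = V i w * (eta i w / sigma) * (f' c - f' z).
  transitivity (V i w * (f x - f y - eta i w / sigma * f' z)).
    by rewrite /rho -/x -/y -/z; ring.
  by rewrite fxy xyE; ring.
have s0 := ltW sigma_gt0.
rewrite !normrM normfV (ger0_norm s0).
apply: le_trans (_ : `|V i w| * (`|eta i w| / sigma) *
    (L * (`|eta i w| / sigma + `|zeta i w| / sigma)) <= _).
  rewrite ler_wpM2l//; first by rewrite !mulr_ge0// invr_ge0.
  apply: le_trans (f'_lip _ _) _; rewrite ler_wpM2l//.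
  rewrite -(subrKA x) (le_trans (ler_normD _ _))//.
  rewrite lerD//; first by rewrite (le_trans hc)// xyE normrM normfV (ger0_norm s0).
  by rewrite zxE normrM normfV (ger0_norm s0).
rewrite [leLHS](_ : _ = L / sigma ^+ 2 *
    (`|V i w| * `|eta i w| * (`|eta i w| + `|zeta i w|))); last first.
  by field; rewrite gt_eqF.
rewrite ler_wpM2l ?divr_ge0 ?sqr_ge0//.
apply: le_trans (_ : `|V i w| * (\sum_(j in N i) `|V j w|) *
   (\sum_(k in N i) `|V k w| + \sum_(k in N' i) `|V k w|) <= _).
  rewrite ler_pM// ?mulr_ge0// ?addr_ge0//.
    by rewrite ler_wpM2l// ler_norm_sum.
  by rewrite lerD// ler_norm_sum.
rewrite mulr_sumr mulr_suml ler_sum// => j _.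
by rewrite mulrDr !mulr_sumr.
Qed.

Let L1_eta i : L1 (fun w => V i w * eta i w).
Proof.
rewrite (_ : (fun w => _) = fun w => \sum_(j in N i) V i w * V j w).
  by apply: L1_sum => j _; exact: L1_prod2.
by apply/funext => w; rewrite mulr_sumr.
Qed.

Let L1_W : L1 W. Proof. by apply: L1_sum => j _; exact: L1_single. Qed.

Let L1_iW i : L1 (fun w => V i w * W w).
Proof.
rewrite (_ : (fun w => _) = fun w => \sum_j V i w * V j w).
  by apply: L1_sum => j _; exact: L1_prod2.
by apply/funext => w; rewrite mulr_sumr.
Qed.

Let L1_f i : L1 (fun w => V i w * f (W w / sigma)).
Proof.
apply: (@L1_mul_bounded _ _ _ _ _ _ L) => //; first exact: L1_single.
by apply: measurableT_comp => //; exact: measurable_funM.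
Qed.

Let L1_fd i : L1 (fun w => V i w * f ((W w - eta i w) / sigma)).
Proof.
apply: (@L1_mul_bounded _ _ _ _ _ _ L) => //; first exact: L1_single.
by apply: measurableT_comp => //; exact: mdiff.
Qed.

Let L1_f'z i : L1 (fun w => f' ((W w - zeta i w) / sigma)).
Proof.
apply: (@L1_bounded _ _ _ _ _ L) => //.
by apply: measurableT_comp => //; exact: mdiff.
Qed.

Let L1_f'W : L1 (fun w => f' (W w / sigma)).
Proof.
apply: (@L1_bounded _ _ _ _ _ L) => //.
by apply: measurableT_comp => //; exact: measurable_funM.
Qed.

Let L1_f'd i : L1 (fun w => V i w * eta i w * f' ((W w - zeta i w) / sigma)).
Proof.
apply: (@L1_mul_bounded _ _ _ _ _ _ L) => //.
by apply: measurableT_comp => //; exact: mdiff.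
Qed.

Let L1_rho i : L1 (rho i).
Proof. by apply: L1B => //; apply: L1D => //; exact: L1Z. Qed.

Let E_rho i : `|E (rho i)| <= 6 * L * kappa ^+ 2 * M / sigma ^+ 2.
Proof.
have k0 := kappa0 i.
apply: le_trans (Ex_norm_le (L1_rho i) _ (rho_le i)) _.
  by apply/L1Z/L1_sum => j _; apply: L1D; apply: L1_sum => k _.
rewrite ExZ; last by apply: L1_sum => j _; apply: L1D; apply: L1_sum => k _.
rewrite Ex_sum; last by move=> j _; apply: L1D; apply: L1_sum => k _.
rewrite [leRHS](_ : _ = L / sigma ^+ 2 * (kappa * (kappa * (6 * M)))); last by ring.
rewrite ler_wpM2l ?divr_ge0 ?sqr_ge0//.
apply: le_trans (_ : \sum_(j in N i) (kappa * (6 * M)) <= _); last first.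
  by rewrite sumr_const -[leLHS]mulr_natl ler_wpM2r// !mulr_ge0.
apply: ler_sum => j _; rewrite ExD; [|by apply: L1_sum => k _..].
have h (A : {set I}) : #|A|%:R <= kappa ->
    E (fun w => \sum_(k in A) (`|V i w| * `|V j w| * `|V k w|)) <= kappa * (3 * M).
  move=> Ak; rewrite Ex_sum//.
  apply: le_trans (_ : \sum_(k in A) (3 * M) <= _); first exact: ler_sum.
  by rewrite sumr_const -[leLHS]mulr_natl ler_wpM2r// !mulr_ge0.
have := h _ (N_le i); have := h _ (N'_le i); lra.
Qed.

Let E_eta i : `|E (fun w => V i w * eta i w)| <= kappa * (3 * M).
Proof.
rewrite (_ : (fun w => _) = fun w => \sum_(j in N i) V i w * V j w); last first.
  by apply/funext => w; rewrite mulr_sumr.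
rewrite Ex_sum => [|j _]; last exact: L1_prod2.
rewrite (le_trans (ler_norm_sum _ _ _))//.
apply: le_trans (_ : \sum_(k in N i) (3 * M) <= _).
  by apply: ler_sum => k _; exact: E_prod2.
by rewrite sumr_const -[leLHS]mulr_natl ler_wpM2r// mulr_ge0.
Qed.

Let E_f'_shift i :
  `|E (fun w => f' ((W w - zeta i w) / sigma)) - E (fun w => f' (W w / sigma))|
  <= L / sigma * (kappa * (2 * M)).
Proof.
have s0 := ltW sigma_gt0.
rewrite -ExB//.
have h1 : L1 (fun w => L / sigma * \sum_(j in N' i) `|V j w|).
  by apply/L1Z/L1_sum => j _; exact/L1_norm/L1_single.
apply: le_trans (Ex_norm_le _ h1 _) _; first exact: L1B.
  move=> w; apply: le_trans (f'_lip _ _) _.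
  rewrite -mulrBl addrAC subrr add0r normrM normrN normfV (ger0_norm s0).
  rewrite [leLHS](_ : _ = L / sigma * `|zeta i w|); last by ring.
  by rewrite ler_wpM2l ?divr_ge0// ler_norm_sum.
rewrite ExZ; last by apply/L1_sum => j _; exact/L1_norm/L1_single.
rewrite ler_wpM2l ?divr_ge0// Ex_sum => [|j _]; last exact/L1_norm/L1_single.
apply: le_trans (_ : \sum_(k in N' i) (2 * M) <= _); first exact: ler_sum.
by rewrite sumr_const -[leLHS]mulr_natl ler_wpM2r// mulr_ge0.
Qed.

(** Taylor expansion and decorrelation make E (V_i f(W/sigma)) close to E (V_i eta_i) E f'(W/sigma)
    / sigma. Summing over i, the E (V_i eta_i) add up to E W^2 up to far covariances, hence to
    sigma^2 up to errors, so E (W/sigma f(W/sigma)) is close to E f'(W/sigma). *)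
Lemma stein_dissociated :
  `|E (fun w => f' (W w / sigma) - W w / sigma * f (W w / sigma))| <=
  L * (e' + #|I|%:R * e) / sigma ^+ 2 +
  #|I|%:R * (e / sigma + e / sigma ^+ 2 + 12 * L * kappa ^+ 2 * M ^+ 2 / sigma ^+ 3).
Proof.
pose m := E (fun w => f' (W w / sigma)).
pose D i := E (fun w => V i w * eta i w).
have mL : `|m| <= L by apply: Ex_norm_bound.
have s0 := ltW sigma_gt0.
have si0 : 0 <= sigma^-1 by rewrite invr_ge0.
have EfE i : E (fun w => V i w * f (W w / sigma)) =
   E (fun w => V i w * f ((W w - eta i w) / sigma)) +
   sigma^-1 * E (fun w => V i w * eta i w * f' ((W w - zeta i w) / sigma)) +
   E (rho i).
  rewrite /rho ExB//; last by apply: L1D => //; exact: L1Z.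
  by rewrite ExD ?ExZ//; [ring|exact: L1Z].
have step i : `|E (fun w => V i w * f (W w / sigma)) - sigma^-1 * D i * m| <=
    e + e / sigma + 12 * L * kappa ^+ 2 * M ^+ 2 / sigma ^+ 2.
  have k0 := kappa0 i.
  rewrite EfE; set a := E _; set b := E _.
  pose c := E (fun w => f' ((W w - zeta i w) / sigma)).
  rewrite (_ : _ - _ = a + sigma^-1 * (b - D i * c) + sigma^-1 * D i * (c - m) + E (rho i));
    last by ring.
  have h1 : `|a| <= e := decor1 i.
  have h2 : `|sigma^-1 * (b - D i * c)| <= e / sigma.
    by rewrite normrM (ger0_norm si0) mulrC ler_wpM2r//; exact: decor2.
  have h3 : `|sigma^-1 * D i * (c - m)| <= 6 * L * kappa ^+ 2 * M ^+ 2 / sigma ^+ 2.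
    rewrite !normrM (ger0_norm si0) -mulrA.
    apply: le_trans (_ : sigma^-1 * ((kappa * (3 * M)) * (L / sigma * (kappa * (2 * M)))) <= _).
      rewrite ler_wpM2l// ler_pM//; [exact: E_eta|exact: E_f'_shift].
    by rewrite le_eqVlt; apply/orP; left; apply/eqP; field; rewrite gt_eqF.
  (* Since 1 <= M, replacing [M] by [M ^+ 2] lets this merge with [h3]; 6 + 6 is the 12 of the
     statement. *)
  have h4 : `|E (rho i)| <= 6 * L * kappa ^+ 2 * M ^+ 2 / sigma ^+ 2.
    apply: le_trans (E_rho i) _; rewrite ler_wpM2r ?invr_ge0 ?sqr_ge0//.
    rewrite ler_wpM2l ?mulr_ge0 ?sqr_ge0// expr2 ler_peMl//.
  have t1 := ler_normD (a + sigma^-1 * (b - D i * c) + sigma^-1 * D i * (c - m)) (E (rho i)).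
  have t2 := ler_normD (a + sigma^-1 * (b - D i * c)) (sigma^-1 * D i * (c - m)).
  have t3 := ler_normD a (sigma^-1 * (b - D i * c)).
  set q := _ / sigma ^+ 2 in h3 h4.
  have -> : 12 * L * kappa ^+ 2 * M ^+ 2 / sigma ^+ 2 = q + q by rewrite /q; ring.
  lra.
have L1WfE : L1 (fun w => W w / sigma * f (W w / sigma)).
  apply: (@L1_mul_bounded _ _ _ _ _ _ L) => //.
    by under eq_fun do rewrite mulrC; exact: L1Z.
  by apply: measurableT_comp => //; exact: measurable_funM.
rewrite ExB// -/m.
have -> : E (fun w => W w / sigma * f (W w / sigma)) =
   sigma^-1 * \sum_i E (fun w => V i w * f (W w / sigma)).
  rewrite -Ex_sum// -ExZ; last exact: L1_sum.
  by congr Ex; apply/funext => w; rewrite /W mulrC [in LHS]mulrC -mulr_suml; ring.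
(* From V_i eta_i = V_i W - V_i (W - eta_i), the last product being small in mean by [decor3]. *)
have DE : \sum_i D i = E (fun w => W w ^+ 2) - \sum_i E (fun w => V i w * (W w - eta i w)).
  have -> : E (fun w => W w ^+ 2) = \sum_i E (fun w => V i w * W w).
    rewrite -Ex_sum//; congr Ex; apply/funext => w.
    by rewrite expr2 {1}/W mulr_suml.
  rewrite -sumrB; apply: eq_bigr => i _.
  rewrite -ExB//; last first.
    by under eq_fun do rewrite mulrBr; exact: L1B.
  by congr Ex; apply/funext => w; ring.
have DV : `|sigma ^+ 2 - \sum_i D i| <= e' + #|I|%:R * e.
  rewrite DE opprB addrCA addrC.
  rewrite (le_trans (ler_normD _ _))// lerD//; first by rewrite distrC.
  rewrite (le_trans (ler_norm_sum _ _ _))//.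
  apply: le_trans (_ : \sum_(i : I) e <= _); first by apply: ler_sum => i _; exact: decor3.
  by rewrite sumr_const -[leLHS]mulr_natl.
rewrite (_ : _ - _ = m * ((sigma ^+ 2 - \sum_i D i) / sigma ^+ 2) -
   sigma^-1 * \sum_i (E (fun w => V i w * f (W w / sigma)) - sigma^-1 * D i * m)); last first.
  rewrite sumrB -mulr_suml -mulr_sumr.
  by field; rewrite gt_eqF.
rewrite (le_trans (ler_normB _ _))// lerD//.
  rewrite !normrM normfV (ger0_norm (sqr_ge0 _)) mulrA ler_wpM2r ?invr_ge0 ?sqr_ge0//.
  by rewrite ler_pM.
rewrite normrM (ger0_norm si0) (le_trans (ler_wpM2l si0 (ler_norm_sum _ _ _)))//.
apply: le_trans (ler_wpM2l si0 (ler_sum _ (fun i _ => step i))) _.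
rewrite sumr_const -[X in _ * X]mulr_natl mulrCA ler_wpM2l//.
by rewrite le_eqVlt; apply/orP; left; apply/eqP; field; rewrite gt_eqF.
Qed.

End dissociated.

(** * Decorrelation from total variation *)

Section comparison.
Context {R : realType}.
Notation mu := (@lebesgue_measure R).

Lemma expectation_tail {d} {T : measurableType d} (P : probability T R)
    (Y : T -> R) : measurable_fun setT Y -> (forall w, 0 <= Y w) ->
  (\int[P]_w (Y w)%:E = \int[mu]_(r in `[0%R, +oo[) P [set w | (r < Y w)%R])%E.
Proof.
move=> mY Y0.
pose X : {RV P >-> R} := HB.pack Y (isMeasurableFun.Build _ _ _ _ _ mY).
have := @ge0_expectation_ccdf _ _ _ P X Y0; rewrite unlock => ->.
apply: eq_integral => r _; rewrite /ccdf /distribution /pushforward.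
by congr (P _); apply/seteqP; split => w /=; rewrite in_itv/= andbT.
Qed.

Lemma measurable_tail {d} {T : measurableType d} (P : probability T R)
    (Y : T -> R) : measurable_fun setT Y ->
  measurable_fun setT (fun r : R => P [set w | r < Y w]).
Proof.
move=> mY.
pose X : {RV P >-> R} := HB.pack Y (isMeasurableFun.Build _ _ _ _ _ mY).
rewrite (_ : (fun r => _) = ccdf X); first exact: ccdf_measurable.
apply/funext => r; rewrite /ccdf /distribution /pushforward.
by congr (P _); apply/seteqP; split => w /=; rewrite in_itv/= andbT.
Qed.

Context {d1 d2} {T1 : measurableType d1} {T2 : measurableType d2}.
Variables (P1 : probability T1 R) (P2 : probability T2 R).

(** Layer-cake formula: [eps] is paid only at levels in [0, K], above which the tail of [Y1]
    vanishes. *)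
Lemma tail_le_expectation (Y1 : T1 -> R) (Y2 : T2 -> R) (K eps : R) :
  measurable_fun setT Y1 -> measurable_fun setT Y2 ->
  0 <= K -> 0 <= eps ->
  (forall w, 0 <= Y1 w <= K) -> (forall w, 0 <= Y2 w <= K) ->
  (forall t : R, P1 [set w | (t < Y1 w)%R] <= P2 [set w | (t < Y2 w)%R] + eps%:E)%E ->
  Ex P1 Y1 <= Ex P2 Y2 + K * eps.
Proof.
move=> m1 m2 K0 e0 b1 b2 tl.
have Y10 w : 0 <= Y1 w by have /andP[] := b1 w.
have Y20 w : 0 <= Y2 w by have /andP[] := b2 w.
have i1 : L1 P1 Y1.
  by apply: (@L1_bounded _ _ _ _ _ K) => // w; rewrite ger0_norm//; have /andP[] := b1 w.
have i2 : L1 P2 Y2.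
  by apply: (@L1_bounded _ _ _ _ _ K) => // w; rewrite ger0_norm//; have /andP[] := b2 w.
rewrite -lee_fin EFinD /Ex /Rintegral !fineK; [|exact: integrable_fin_num..].
rewrite !expectation_tail//.
have mI : measurable_fun setT (fun r => (\1_(`[0%R, K] : set R) r)%:E : \bar R).
  by apply/measurable_EFinP; exact: measurable_indic.
have iK : (\int[mu]_(r in `[0%R, +oo[) (eps%:E * (\1_(`[0%R, K] : set R) r)%:E) = (K * eps)%:E)%E.
  rewrite ge0_integralZl//; last exact: measurable_funTS.
  rewrite integral_indic//= setIidl; last first.
    by apply: subset_itvl; rewrite bnd_simp.
  rewrite lebesgue_measure_itv/= lte_fin; case: ltP => K1.
    by rewrite sube0 -EFinM mulrC.
  have -> : K = 0 by apply/eqP; rewrite eq_le K1.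
  by rewrite mul0r mule0.
rewrite -iK -ge0_integralD//; last 3 first.
- by apply: measurable_funTS; exact: measurable_tail.
- by move=> r _; rewrite mule_ge0// lee_fin.
- by apply: emeasurable_funM => //; exact: measurable_funTS.
apply: ge0_le_integral => //.
- by apply: measurable_funTS; exact: measurable_tail.
- apply: emeasurable_funD; first by apply: measurable_funTS; exact: measurable_tail.
  by apply: emeasurable_funM => //; exact: measurable_funTS.
move=> r; rewrite /= in_itv/= andbT => r0.
have [rK|rK] := leP r K.
  by rewrite indicE mem_set ?mule1//= in_itv/= r0.
rewrite (_ : [set w | r < Y1 w] = set0).
  by rewrite measure0 adde_ge0// mule_ge0// lee_fin.
apply/seteqP; split => // w /=; have /andP[_ h] := b1 w.
by move=> /(lt_trans rK); rewrite ltNge h.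
Qed.

Definition clamp (K y : R) := Num.max (- K) (Num.min y K).

Lemma clamp_bound K y : 0 <= K -> - K <= clamp K y <= K.
Proof.
move=> K0; rewrite /clamp le_max lexx/= ge_max ge_min lexx orbT andbT.
by rewrite (le_trans _ K0)// oppr_le0.
Qed.

(** An error occurs only if |y| > k^2, which forces s > k and hence |y| <= s^2 <= s^3 / k. A third
    moment of [s] thus buys a factor 1 / k. *)
Lemma clamp_err (k y s : R) : 0 < k -> 0 <= s -> `|y| <= s ^+ 2 ->
  `|y - clamp (k ^+ 2) y| <= s ^+ 3 / k.
Proof.
move=> k0 s0 ys.
have K0 : 0 <= k ^+ 2 by exact: sqr_ge0.
have [yk|yk] := leP `|y| (k ^+ 2).
  have -> : clamp (k ^+ 2) y = y.
    move: yk; rewrite ler_norml => /andP[h1 h2].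
    by rewrite /clamp (min_idPl h2) (max_idPr h1).
  by rewrite subrr normr0 divr_ge0 ?exprn_ge0// ltW.
have ks : k <= s.
  rewrite -(@ler_pXn2r _ 2)// ?nnegrE ?(ltW k0)//.
  by rewrite (le_trans (ltW yk)).
apply: (@le_trans _ _ `|y|).
  rewrite /clamp; have [y0|y0] := leP 0 y.
    rewrite ger0_norm// in yk.
    rewrite (min_idPr (ltW yk)) (max_idPr _); last by rewrite (le_trans _ K0)// oppr_le0.
    by rewrite !ger0_norm ?subr_ge0 ?(ltW yk)// lerBlDr lerDl.
  rewrite ltr0_norm// in yk.
  rewrite (min_idPl _); last by rewrite (le_trans (ltW y0)).
  rewrite (max_idPl _); last by rewrite lerNr ltW.
  rewrite opprK ler0_norm ?ltr0_norm//; first by rewrite opprD lerBlDr lerDl.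
  by rewrite -lerBrDr sub0r lerNr ltW.
by rewrite (le_trans ys)// ler_pdivlMr// (exprSr s 2) ler_wpM2l// sqr_ge0.
Qed.

Lemma measurable_clamp {d} {T : measurableType d} K (Y : T -> R) :
  measurable_fun setT Y -> measurable_fun setT (fun w => clamp K (Y w)).
Proof.
move=> mY; apply: measurable_maxr => //.
exact: measurable_minr.
Qed.

Lemma lt_clamp K t y : (t < clamp K y) = (t < - K) || ((t < y) && (t < K)).
Proof. by rewrite /clamp lt_max lt_min. Qed.

Lemma tail_le_expectation_cube (Y1 S1 : T1 -> R) (Y2 S2 : T2 -> R) (k eps : R) :
  L1 P1 Y1 -> L1 P2 Y2 -> 0 < k -> 0 <= eps ->
  (forall w, 0 <= S1 w) -> (forall w, 0 <= S2 w) ->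
  L1 P1 (fun w => S1 w ^+ 3) -> L1 P2 (fun w => S2 w ^+ 3) ->
  (forall w, `|Y1 w| <= S1 w ^+ 2) -> (forall w, `|Y2 w| <= S2 w ^+ 2) ->
  (forall t : R, P1 [set w | (t < Y1 w)%R] <= P2 [set w | (t < Y2 w)%R] + eps%:E)%E ->
  Ex P1 Y1 <= Ex P2 Y2 + 2 * k ^+ 2 * eps +
    (Ex P1 (fun w => S1 w ^+ 3) + Ex P2 (fun w => S2 w ^+ 3)) / k.
Proof.
move=> i1 i2 k0 e0 S10 S20 iS1 iS2 YS1 YS2 tl.
have K0 : 0 <= k ^+ 2 by exact: sqr_ge0.
pose c1 w := clamp (k ^+ 2) (Y1 w); pose c2 w := clamp (k ^+ 2) (Y2 w).
have mc1 : measurable_fun setT c1 by apply: measurable_clamp; exact: L1_measurable i1.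
have mc2 : measurable_fun setT c2 by apply: measurable_clamp; exact: L1_measurable i2.
have ic d (T : measurableType d) (P : probability T R) Y :
    measurable_fun setT (fun w : T => clamp (k ^+ 2) (Y w)) ->
    L1 P (fun w => clamp (k ^+ 2) (Y w)).
  move=> mY; apply: (@L1_bounded _ _ _ _ _ (k ^+ 2)) => // w.
  by rewrite ler_norml clamp_bound.
have err d (T : measurableType d) (P : probability T R) (Y S : T -> R) :
    L1 P Y -> (forall w, 0 <= S w) -> L1 P (fun w => S w ^+ 3) ->
    (forall w, `|Y w| <= S w ^+ 2) ->
    `|Ex P Y - Ex P (fun w => clamp (k ^+ 2) (Y w))| <= Ex P (fun w => S w ^+ 3) / k.
  move=> iY S0 iS YS.
  have iC := ic _ _ P Y (measurable_clamp (k ^+ 2) (L1_measurable iY)).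
  rewrite -ExB// mulrC -ExZ//; apply: Ex_norm_le; [exact: L1B|exact: L1Z|].
  by move=> w; rewrite mulrC clamp_err.
have h1 := err _ _ P1 _ _ i1 S10 iS1 YS1.
have h2 := err _ _ P2 _ _ i2 S20 iS2 YS2.
(* Shifted by k^2, the truncated variables lie in [0, 2 k^2], as the layer-cake comparison
   demands. *)
have h3 : Ex P1 (fun w => c1 w + k ^+ 2) <= Ex P2 (fun w => c2 w + k ^+ 2) + (2 * k ^+ 2) * eps.
  apply: tail_le_expectation => //.
  - exact: measurable_funD.
  - exact: measurable_funD.
  - by rewrite mulr_ge0.
  - move=> w; have /andP[a1 a2] := clamp_bound (Y1 w) K0.
    by rewrite /c1; apply/andP; split; lra.
  - move=> w; have /andP[a1 a2] := clamp_bound (Y2 w) K0.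
    by rewrite /c2; apply/andP; split; lra.
  move=> t.
  (* Below the truncation range the second tail has probability 1, inside it the tails are those of
     [Y1] and [Y2], above it the first tail is empty. *)
  have [tK|tK] := ltP (t - k ^+ 2) (- k ^+ 2).
    rewrite (_ : [set w | t < c2 w + k ^+ 2] = setT); last first.
      by apply/seteqP; split => // w _ /=; rewrite -ltrBlDr lt_clamp tK.
    rewrite [X in (X + _)%E]probability_setT.
    apply: le_trans (_ : 1 <= _)%E; last by rewrite leeDl// lee_fin.
    apply: probability_le1.
    rewrite -[X in measurable X]setTI.
    have mcc : measurable_fun setT (fun w => c1 w + k ^+ 2) by exact: measurable_funD.
    rewrite (_ : [set w | _] = (fun w => c1 w + k ^+ 2) @^-1` `]t, +oo[); last first.
      by apply/seteqP; split => w /=; rewrite in_itv/= andbT.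
    exact: mcc.
  have [tK2|tK2] := ltP (t - k ^+ 2) (k ^+ 2).
    have hc y : (t < clamp (k ^+ 2) y + k ^+ 2) = (t - k ^+ 2 < y).
      by rewrite -ltrBlDr lt_clamp (ltNge _ (- _)) tK tK2 andbT.
    rewrite (_ : [set w | t < c1 w + k ^+ 2] = [set w | t - k ^+ 2 < Y1 w]); last first.
      by apply/seteqP; split => w /=; rewrite hc.
    rewrite (_ : [set w | t < c2 w + k ^+ 2] = [set w | t - k ^+ 2 < Y2 w]); last first.
      by apply/seteqP; split => w /=; rewrite hc.
    exact: tl.
  rewrite (_ : [set w | t < c1 w + k ^+ 2] = set0) ?measure0 ?adde_ge0 ?lee_fin//.
  apply/seteqP; split => // w /=; rewrite -ltrBlDr lt_clamp.
  by rewrite (ltNge _ (- _)) tK (ltNge _ (k ^+ 2)) tK2 andbF.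
have icc1 : L1 P1 c1 by exact: ic.
have icc2 : L1 P2 c2 by exact: ic.
rewrite !ExD// in h3; [|exact: L1_cst..].
rewrite !(Ex_cst _ (k ^+ 2)) in h3.
move: h1 h2; rewrite !ler_norml -/c1 -/c2 => /andP[_ h1] /andP[h2 _].
rewrite mulrDl; lra.
Qed.

End comparison.

Section decoupling.
Context {R : realType} {d} {T : measurableType d} (P : probability T R).
Local Notation PP := (P \x P)%E.

Lemma L1_prod (U V : T -> R) : L1 P U -> L1 P V ->
  L1 PP (fun z => U z.1 * V z.2).
Proof.
move=> iU iV.
have mU := L1_measurable iU; have mV := L1_measurable iV.
have mUV : measurable_fun setT (fun z : T * T => (U z.1 * V z.2)%:E).
  apply/measurable_EFinP; apply: measurable_funM.
    by apply: measurableT_comp => //.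
  by apply: measurableT_comp => //.
apply/(integrable12ltyP _ _ mUV).
rewrite (_ : (fun x : T => _) = fun x => (`|U x|%:E * \int[P]_y `|V y|%:E)%E); last first.
  apply/funext => x; rewrite -ge0_integralZl//.
    by apply: eq_integral => y _; rewrite /= normrM EFinM.
  by apply/measurable_EFinP; exact: measurableT_comp.
have /integrableP[_ hV] := iV; have /integrableP[_ hU] := iU.
rewrite ge0_integralZr//.
- have U0 : (0 <= \int[P]_x `|U x|%:E)%E by apply: integral_ge0 => y _; rewrite lee_fin.
  by rewrite lte_mul_pinfty// ge0_fin_numE.
- by apply/measurable_EFinP; exact: measurableT_comp.
- by apply: integral_ge0 => y _; rewrite lee_fin.
Qed.

Lemma Ex_prod (U V : T -> R) : L1 P U -> L1 P V ->
  Ex PP (fun z => U z.1 * V z.2) = Ex P U * Ex P V.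
Proof.
move=> iU iV; have iUV := L1_prod iU iV.
rewrite /Ex /Rintegral -(integral12_prod_meas1 iUV) /fubini_F/=.
have fV : (\int[P]_y (V y)%:E)%E = (Ex P V)%:E.
  by rewrite /Ex /Rintegral fineK//; exact: integrable_fin_num iV.
rewrite (_ : (fun x : T => _) = fun x => ((Ex P V)%:E * (U x)%:E)%E); last first.
  apply/funext => x; rewrite muleC -fV -integralZl//.
rewrite integralZl// fineM//; last exact: integrable_fin_num iU.
by rewrite mulrC.
Qed.

Lemma L1_fst (U : T -> R) : L1 P U -> L1 PP (fun z => U z.1).
Proof.
move=> iU; have := L1_prod iU (L1_cst P 1).
by under eq_fun do rewrite /= mulr1.
Qed.

Lemma L1_snd (U : T -> R) : L1 P U -> L1 PP (fun z => U z.2).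
Proof.
move=> iU; have := L1_prod (L1_cst P 1) iU.
by under eq_fun do rewrite /= mul1r.
Qed.

Lemma Ex_fst (U : T -> R) : L1 P U -> Ex PP (fun z => U z.1) = Ex P U.
Proof.
move=> iU; have := Ex_prod iU (L1_cst P 1).
by rewrite (Ex_cst P 1) mulr1 => <-; congr Ex; apply/funext => z; rewrite /= mulr1.
Qed.

Lemma Ex_snd (U : T -> R) : L1 P U -> Ex PP (fun z => U z.2) = Ex P U.
Proof.
move=> iU; have := Ex_prod (L1_cst P 1) iU.
by rewrite (Ex_cst P 1) mul1r => <-; congr Ex; apply/funext => z; rewrite /= mul1r.
Qed.

Lemma cubeD_le (x y : R) : 0 <= x -> 0 <= y -> (x + y) ^+ 3 <= 4 * (x ^+ 3 + y ^+ 3).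
Proof.
move=> x0 y0; rewrite -subr_ge0.
rewrite (_ : _ - _ = 3 * (x + y) * (x - y) ^+ 2); last by ring.
by rewrite mulr_ge0 ?sqr_ge0// mulr_ge0// addr_ge0.
Qed.

(** [U] and [V] will be functionals of two distant regions. A quadratic majorant [(a + b) ^ 2]
    leaves room for products of several block sums, and third moments of [a] and [b] then give the
    integrability beyond order one that truncation needs. *)
Variables (U V a b : T -> R) (delta : R).
Hypothesis iU : L1 P U.
Hypothesis iV : L1 P V.
Hypothesis ma : measurable_fun setT a.
Hypothesis mb : measurable_fun setT b.
Hypothesis a0 : forall w, 0 <= a w.
Hypothesis b0 : forall w, 0 <= b w.
Hypothesis ia : L1 P (fun w => a w ^+ 3).
Hypothesis ib : L1 P (fun w => b w ^+ 3).
Hypothesis UVab : forall w w', `|U w * V w'| <= (a w + b w') ^+ 2.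
Hypothesis delta_gt0 : 0 < delta.
Hypothesis tail : forall t : R,
  (`|P [set w | (t < U w * V w)%R] - PP [set z | (t < U z.1 * V z.2)%R]|
     <= (delta ^+ 3)%:E)%E.

Let cube1 : L1 P (fun w => (a w + b w) ^+ 3) /\
  Ex P (fun w => (a w + b w) ^+ 3) <= 4 * (Ex P (fun w => a w ^+ 3) + Ex P (fun w => b w ^+ 3)).
Proof.
have i4 : L1 P (fun w => 4 * (a w ^+ 3 + b w ^+ 3)) by apply: L1Z; exact: L1D.
have i3 : L1 P (fun w => (a w + b w) ^+ 3).
  apply: (L1_dom _ i4); first by apply: measurable_funX; exact: measurable_funD.
  by move=> w; rewrite ger0_norm ?cubeD_le// exprn_ge0// addr_ge0.
split => //; rewrite -ExD// -ExZ; last exact: L1D.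
by apply: Ex_le => // w; exact: cubeD_le.
Qed.

Let cube2 : L1 PP (fun z => (a z.1 + b z.2) ^+ 3) /\
  Ex PP (fun z => (a z.1 + b z.2) ^+ 3) <= 4 * (Ex P (fun w => a w ^+ 3) + Ex P (fun w => b w ^+ 3)).
Proof.
have ia' := L1_fst ia; have ib' := L1_snd ib.
have i4 : L1 PP (fun z => 4 * (a z.1 ^+ 3 + b z.2 ^+ 3)) by apply: L1Z; exact: L1D.
have i3 : L1 PP (fun z => (a z.1 + b z.2) ^+ 3).
  apply: (L1_dom _ i4); last first.
    by move=> w; rewrite ger0_norm ?cubeD_le// exprn_ge0// addr_ge0.
  apply: measurable_funX; apply: measurable_funD.
    by apply: measurableT_comp.
  by apply: measurableT_comp.
split => //; rewrite -(Ex_fst ia) -(Ex_snd ib) -ExD// -ExZ; last exact: L1D.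
by apply: Ex_le => // w; exact: cubeD_le.
Qed.

Lemma measurable_set_lt {d'} {T' : measurableType d'} (f : T' -> R) (t : R) :
  measurable_fun setT f -> measurable [set w | t < f w].
Proof.
move=> mf; rewrite -[X in measurable X]setTI.
rewrite (_ : [set w | _] = f @^-1` `]t, +oo[); first exact: mf.
by apply/seteqP; split => w /=; rewrite in_itv/= andbT.
Qed.

(* Truncating U V at k^2 costs O(k^2 delta^3) for the tail bound and O(1/k) for
   the third moments, which balance at k = 1 / delta. *)
Lemma decoupling : `|Ex P (fun w => U w * V w) - Ex P U * Ex P V| <=
  delta * (2 + 8 * (Ex P (fun w => a w ^+ 3) + Ex P (fun w => b w ^+ 3))).
Proof.
have [c1i c1E] := cube1; have [c2i c2E] := cube2.
have iUV : L1 P (fun w => U w * V w).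
  apply: (@L1_dom _ _ _ _ _ (fun w => 1 + (a w + b w) ^+ 3)).
  - by apply: measurable_funM; [exact: L1_measurable iU|exact: L1_measurable iV].
  - by apply: L1D => //; exact: L1_cst.
  move=> w; apply: le_trans (UVab w w) _.
  have := @addr_ge0 _ _ _ (a0 w) (b0 w); move: (a w + b w) => x x0.
  have [x1|/ltW x1] := leP x 1; first by rewrite ler_wpDr ?exprn_ge0// exprn_ile1.
  by rewrite ler_wpDl// (exprSr x 2) ler_peMr// sqr_ge0.
have iUV2 := L1_prod iU iV.
have mUV t := measurable_set_lt t (L1_measurable iUV).
have mUV2 t := measurable_set_lt t (L1_measurable iUV2).
have d3 : 0 <= delta ^+ 3 by rewrite exprn_ge0// ltW.
have k0 : 0 < delta^-1 by rewrite invr_gt0.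
have fin1 t : P [set w | (t < U w * V w)%R] \is a fin_num.
  by rewrite ge0_fin_numE// (le_lt_trans (probability_le1 P (mUV t)))// ltry.
have fin2 t : PP [set z | (t < U z.1 * V z.2)%R] \is a fin_num.
  by rewrite ge0_fin_numE// (le_lt_trans (probability_le1 _ (mUV2 t)))// ltry.
have t1 t : (P [set w | (t < U w * V w)%R] <=
    PP [set z | (t < U z.1 * V z.2)%R] + (delta ^+ 3)%:E)%E.
  rewrite addeC -leeBlDr//; apply: le_trans (tail t); exact: lee_abs.
have t2 t : (PP [set z | (t < U z.1 * V z.2)%R] <=
    P [set w | (t < U w * V w)%R] + (delta ^+ 3)%:E)%E.
  rewrite addeC -leeBlDr//; apply: le_trans (tail t).
  by rewrite -abseN fin_num_oppeB// addeC; exact: lee_abs.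
have ab0 w : 0 <= a w + b w by rewrite addr_ge0.
have ab0' (z : T * T) : 0 <= a z.1 + b z.2 by rewrite addr_ge0.
have h1 := tail_le_expectation_cube iUV iUV2 k0 d3 ab0 ab0' c1i c2i
  (fun w => UVab w w) (fun z => UVab z.1 z.2) t1.
have h2 := tail_le_expectation_cube iUV2 iUV k0 d3 ab0' ab0 c2i c1i
  (fun z => UVab z.1 z.2) (fun w => UVab w w) t2.
rewrite invrK Ex_prod// in h1 h2.
have dE : 2 * delta^-1 ^+ 2 * delta ^+ 3 = 2 * delta.
  by field; rewrite gt_eqF.
rewrite dE in h1 h2.
set A := Ex P (fun w => a w ^+ 3) in c1E c2E *.
set B := Ex P (fun w => b w ^+ 3) in c1E c2E *.
have h3 : (Ex P (fun w => (a w + b w) ^+ 3) +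
  Ex PP (fun z => (a z.1 + b z.2) ^+ 3)) * delta <= (8 * (A + B)) * delta.
  by rewrite ler_wpM2r ?(ltW delta_gt0)//; lra.
rewrite ler_norml; apply/andP; split; lra.
Qed.

End decoupling.

(** * Sums over the points of a configuration *)

Section finite_cardinals.
Context {T : choiceType}.
Implicit Types S : set T.

(** Infinite sets get the default value 0; the sets counted below are traces of configurations on
    bounded regions, hence finite. *)
Definition ncard S : nat := #|` fset_set S|%fset.

Lemma ncardP S k : finite_set S -> (S #= `I_k)%card <-> ncard S = k.
Proof.
move=> finS; rewrite -{1}(fset_setK finS).
by split => [/card_eq_fsetP|/card_eq_fsetP].
Qed.

Lemma ncard_fsum {R : realType} S :
  finite_set S -> (ncard S)%:R = \sum_(p \in S) (1 : R).
Proof.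
by move=> finS; rewrite fsbig_finite// big_const_seq iter_addr addr0 count_predT.
Qed.

End finite_cardinals.

Section point_sums.
Context {R : realType} {n : nat} {dM : measure_display} {M : measurableType dM}.
Local Notation point_type := (Rvec R n * M)%type.
Local Notation conf := (mconf R n M).
Implicit Types (B : set (Rvec R n)) (Y : conf).

Definition pts B Y : set point_type := points Y `&` (B `*` setT).

Definition psum B (g : point_type * conf -> R) Y : R :=
  \sum_(p \in pts B Y) g (p, Y).

Lemma pts_finite B Y : ebounded B -> finite_set (pts B Y).
Proof. by move=> bB; apply: points_lf; exists B. Qed.

Lemma measurable_pts_card B (U : set point_type) k : measurable B ->
  measurable U -> measurable [set Y | (pts B Y `&` U #= `I_k)%card].
Proof.
move=> mB mU; apply: sub_sigma_algebra; exists ((B `*` setT) `&` U).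
  by apply: measurableI => //; exact: measurableX.
by exists k => //; apply/seteqP; split => Y /=; rewrite /pts setIA.
Qed.

Section counting_kernel.
Variable B : set (Rvec R n).
Hypotheses (mB : measurable B) (bB : ebounded B).

Let S Y : seq point_type := fset_set (pts B Y).

(* The summands of psum may depend on the whole configuration; seeing the
   counting measure as a kernel gives the measurability of such sums. *)
Definition point_measure Y : {measure set point_type -> \bar R} :=
  msum (fun i => \d_(nth point (S Y) i)) (size (S Y)).

Lemma point_measureE Y U : point_measure Y U = (ncard (pts B Y `&` U))%:R%:E.
Proof.
have fin : finite_set (pts B Y `&` U) by exact: finite_setIl (pts_finite _ bB).
rewrite ncard_fsum// fsbig_mkcondr fsbig_finite; last exact: pts_finite.
rewrite -sumEFin -/(S Y) (big_nth point) big_mkord.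
rewrite /point_measure /= /msum.
by apply: eq_bigr => i _; rewrite [LHS]diracE; case: (_ \in U).
Qed.

Lemma point_measure_integral Y (g : point_type -> R) :
  measurable_fun setT g -> (forall p, 0 <= g p) ->
  (\int[point_measure Y]_p (g p)%:E = (\sum_(p \in pts B Y) g p)%:E)%E.
Proof.
move=> mg g0.
have mEg : measurable_fun setT (EFin \o g) by exact/measurable_EFinP.
rewrite ge0_integral_measure_sum//; last by move=> p _; rewrite lee_fin.
rewrite fsbig_finite; last exact: pts_finite.
rewrite -sumEFin -/(S Y) (big_nth point) big_mkord.
by apply: eq_bigr => i _; rewrite integral_dirac// diracT mul1e.
Qed.

Lemma measurable_point_measure U : measurable U ->
  measurable_fun setT (fun Y => point_measure Y U).
Proof.
move=> mU _ V mV; rewrite setTI.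
rewrite (_ : _ @^-1` V = \bigcup_(k in [set k : nat | V k%:R%:E])
    [set Y | (pts B Y `&` U #= `I_k)%card]).
  by apply: bigcup_measurable => k _; exact: measurable_pts_card.
have fin Y : finite_set (pts B Y `&` U) by exact: finite_setIl (pts_finite _ bB).
apply/seteqP; split => Y /=; rewrite point_measureE.
  by move=> VY; exists (ncard (pts B Y `&` U)) => //; exact/ncardP.
by move=> [k Vk] /ncardP -/(_ (fin Y)) ->.
Qed.

HB.instance Definition _ := isKernel.Build _ _ _ _ R point_measure
  measurable_point_measure.

Import HBNNSimple.

(** The number of points has no uniform bound over configurations, so measurability of the kernel
    integral is obtained through simple approximations, with finiteness checked for each
    configuration. *)
Lemma measurable_psum_ge0 (g : point_type * conf -> R) :
  measurable_fun setT g -> (forall z, 0 <= g z) ->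
  measurable_fun setT (psum B g).
Proof.
move=> mg g0; apply/measurable_EFinP.
pose k (z : conf * point_type) := (g (z.2, z.1))%:E.
have mk : measurable_fun setT k.
  apply/measurable_EFinP; apply: measurableT_comp => //.
  exact: measurable_fun_pair.
rewrite (_ : EFin \o psum B g = fun Y => (\int[point_measure Y]_p k (Y, p))%E); last first.
  apply/funext => Y; rewrite point_measure_integral//.
  by apply: (measurableT_comp mg); exact: pair2_measurable.
pose k_ := nnsfun_approx measurableT mk.
apply: (measurable_fun_xsection_integral k point_measure k_).
- by move=> a b ab; exact/nd_nnsfun_approx.
- by move=> z; apply: cvg_nnsfun_approx => // t _; rewrite lee_fin.
- move=> m r.
  have := @measurable_prod_subset_xsection_kernel _ _ conf point_type R
    [the R.-ker _ ~> _ of point_measure] setT measurableT.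
  move=> /(_ _ (k_ m @^-1` [set r]))[].
  (* The successor is taken because the bound on the mass must be strict. *)
  - move=> Y; exists (ncard (pts B Y `&` setT)).+1%:R => U mU.
    rewrite /mrestr setIT point_measureE lte_fin ltr_nat ltnS setIT.
    apply/fsubset_leq_card; rewrite -fset_set_sub//.
      exact: finite_setIl (pts_finite _ bB).
      exact: pts_finite.
  - by rewrite -[X in measurable X]setTI; exact: measurable_funPT.
  - move=> _; congr measurable_fun; apply/funext => Y.
    by rewrite /mrestr setIT.
Qed.

Lemma psumB (g h : point_type * conf -> R) Y :
  psum B (fun z => g z - h z) Y = psum B g Y - psum B h Y.
Proof.
have fin := pts_finite Y bB.
by rewrite /psum !(fsbig_finite _ _ fin)/= -sumrB.
Qed.

Lemma measurable_psum (g : point_type * conf -> R) :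
  measurable_fun setT g -> measurable_fun setT (psum B g).
Proof.
move=> mg.
rewrite (_ : psum B g = fun Y => psum B (fun z => Num.max (g z) 0) Y -
   psum B (fun z => Num.max (- g z) 0) Y).
  apply: measurable_funB; apply: measurable_psum_ge0.
  - exact: measurable_maxr.
  - by move=> z; rewrite le_max lexx orbT.
  - apply: measurable_maxr => //; exact: measurableT_comp.
  - by move=> z; rewrite le_max lexx orbT.
apply/funext => Y; rewrite -psumB; congr psum; apply/funext => z.
have [g0|g0] := leP 0 (g z).
  by rewrite (max_idPr _) ?oppr_le0// subr0.
by rewrite (max_idPl _) ?oppr_ge0 ?(ltW g0)// sub0r opprK.
Qed.

End counting_kernel.

End point_sums.

(** * The Campbell formula and Palm moments *)

Section palm_moments.
Context {R : realType}.

Lemma Lnorm_le_integral {d} {T : measurableType d}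
    (P : {measure set T -> \bar R}) (p b : R) (h : T -> R) :
  0 < p -> 0 <= b -> (Lnorm P p%:E (fun y => (h y)%:E) <= b%:E)%E ->
  (\int[P]_y (`|h y| `^ p)%:E <= (b `^ p)%:E)%E.
Proof.
move=> p0 b0 hb.
have := poweR_Lnorm P (fun y => (h y)%:E) (lt0r_neq0 p0).
rewrite (_ : (\int[P]_y (`|(h y)%:E| `^ p))%E = (\int[P]_y (`|h y| `^ p)%:E)%E); last first.
    by apply: eq_integral => y _.
move=> <-; rewrite -poweR_EFin.
apply: gt0_ler_poweR => //; first exact: ltW.
  by rewrite in_itv/= leey Lnorm_ge0.
by rewrite in_itv/= leey lee_fin b0.
Qed.

Context {n : nat} {dO dM : measure_display}
  {Omega : measurableType dO} {M : measurableType dM} {P : probability Omega R}.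
Context (X : {RV P >-> mconf R n M}) (mu : R) (mu_gt0 : 0 < mu).
Context (palm : R.-pker (Rvec R n) ~> (M * mconf R n M)%type).
Hypothesis palmP : is_palm P X mu palm.
Local Notation pt := ((Rvec R n * M) * mconf R n M)%type.

Variable B : set (Rvec R n).
Hypotheses (mB : measurable B) (bB : ebounded B).

Lemma campbell (g : pt -> R) :
  measurable_fun setT g -> (forall z, 0 <= g z) ->
  (\int[P]_w (psum B g (X w))%:E = mu%:E *
    \int[leb n]_x \int[palm x]_y ((\1_B x : R) * g ((x, y.1), y.2))%:E)%E.
Proof.
move=> mg g0.
pose f (z : pt) := ((\1_B z.1.1 : R) * g z)%:E.
have mf : measurable_fun setT f.
  apply/measurable_EFinP; apply: measurable_funM => //.
  apply: measurableT_comp; first exact: measurable_indic.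
  by apply: measurableT_comp.
have f0 z : (0 <= f z)%E by rewrite lee_fin mulr_ge0.
rewrite -(palmP mf f0); apply: eq_integral => w _.
rewrite /psum -fsumEFin; last exact: pts_finite.
rewrite -esum_fset; last 2 first.
- exact: pts_finite.
- by move=> p _; rewrite lee_fin.
rewrite esum_mkcond [RHS]esum_mkcond; apply: eq_esum => p _.
rewrite /f /= indicE /pts.
have [pX|pX] := boolP (p \in points (X w)).
  have [pB|pB] := boolP (p.1 \in B).
    by rewrite mul1r mem_set//; split; [exact/set_mem|split; [exact/set_mem|]].
  rewrite mul0r memNset// => -[_ [pB' _]]; move/negP : pB; apply; exact/mem_set.
by rewrite memNset// => -[pX' _]; move/negP : pX; apply; exact/mem_set.
Qed.

Lemma palm_sum_bound (g : pt -> R) (c : R) :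
  measurable_fun setT g -> (forall z, 0 <= g z) -> 0 <= c ->
  (leb n B <= 1)%E ->
  (forall x, B x -> \int[palm x]_y (g ((x, y.1), y.2))%:E <= c%:E)%E ->
  L1 P (psum B g \o X) /\ Ex P (psum B g \o X) <= mu * c.
Proof.
move=> mg g0 c0 lB gc.
have mp : measurable_fun setT (psum B g \o X).
  by apply: measurableT_comp => //; exact: measurable_psum.
have p0 w : 0 <= psum B g (X w) by apply: fsumr_ge0 => p _.
have bnd : (\int[P]_w (psum B g (X w))%:E <= (mu * c)%:E)%E.
  rewrite campbell// EFinM lee_pmul2l ?lte_fin//.
  apply: le_trans (_ : \int[leb n]_x (c%:E * (\1_B x)%:E) <= _)%E; last first.
    rewrite ge0_integralZl//; last first.
      by apply/measurable_EFinP; exact: measurable_indic.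
    by rewrite integral_indic// setIT -[leRHS]mule1 lee_wpmul2l ?lee_fin.
  pose k (z : Rvec R n * (M * mconf R n M)) :=
    ((\1_B z.1 : R) * g ((z.1, z.2.1), z.2.2))%:E.
  have mk : measurable_fun setT k.
    apply/measurable_EFinP; apply: measurable_funM.
      by apply: measurableT_comp => //; exact: measurable_indic.
    apply: (measurableT_comp mg); apply: measurable_fun_pair.
      by apply: measurable_fun_pair => //; apply: measurableT_comp.
    by apply: measurableT_comp.
  have k0 z : (0 <= k z)%E by rewrite lee_fin mulr_ge0.
  apply: ge0_le_integral => //.
  - by move=> x _; apply: integral_ge0 => y _; exact: (k0 (x, y)).
  - exact: (measurable_fun_integral_finite_kernel k palm k0 mk).
  - apply: emeasurable_funM => //.
    by apply/measurable_EFinP; exact: measurable_indic.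
  move=> x _; rewrite indicE.
  have [xB|xB] := boolP (x \in B).
    by under eq_integral do rewrite mul1r; rewrite mule1; exact/gc/set_mem.
  by under eq_integral do rewrite mul0r; rewrite integral0 mule0.
split.
  apply/integrableP; split; first exact/measurable_EFinP.
  under eq_integral do rewrite /= ger0_norm//.
  by apply: le_lt_trans bnd _; rewrite ltry.
rewrite /Ex /Rintegral -lee_fin fineK//.
rewrite ge0_fin_numE; first by apply: le_lt_trans bnd _; rewrite ltry.
by apply: integral_ge0 => w _; rewrite lee_fin; exact: p0.
Qed.

End palm_moments.

(** * Counting locations instead of marked points *)

Section ground_counts.
Context {R : realType} {n : nat} {dM : measure_display} {M : measurableType dM}.
Local Notation conf := (mconf R n M).
Implicit Types (C : set (Rvec R n)) (Y : conf) (x y : Rvec R n).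

Definition gpts C Y : set (Rvec R n) := points (ground Y) `&` C.

Lemma gpts_finite C Y : ebounded C -> finite_set (gpts C Y).
Proof. by move=> bC; exact: points_lf. Qed.

(** Index of the half-open cell of side 1 / (m + 1) that contains [x]. Countably many such cells,
    over all [m], separate any finite set of locations. *)
Definition grid_cell (m : nat) x : n.-tuple int :=
  [tuple Num.floor (m.+1%:R * tnth x i) | i < n].

Lemma measurable_grid_cell m (z : n.-tuple int) :
  measurable [set x | grid_cell m x = z].
Proof.
rewrite (_ : [set x | _] = \bigcap_(i in [set: 'I_n])
    (fun x => tnth x i) @^-1`
      [set` `[(tnth z i)%:~R / m.+1%:R, (tnth z i + 1)%:~R / m.+1%:R[] ).
  apply: fin_bigcap_measurable => // i _.
  by rewrite -[X in measurable X]setTI; exact: measurable_tnth.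
have m0 : 0 < m.+1%:R :> R by [].
apply/seteqP; split => x /=.
  move=> <- i _; rewrite /= tnth_mktuple in_itv/=.
  by rewrite ler_pdivrMr// ltr_pdivlMr// mulrC floor_itv.
move=> h; apply: eq_from_tnth => i; rewrite tnth_mktuple.
have := h i I; rewrite /= in_itv/= ler_pdivrMr// ltr_pdivlMr// mulrC => h'.
exact: floor_def.
Qed.

Lemma grid_cell_separates x y : x != y -> \forall m \near \oo, grid_cell m x != grid_cell m y.
Proof.
move=> xy.
have [i xyi] : exists i, tnth x i != tnth y i.
  apply/existsP; rewrite -negb_forall; apply: contra xy => /forallP h.
  by apply/eqP; apply: eq_from_tnth => i; exact/eqP/h.
have d0 : 0 < `|tnth x i - tnth y i| by rewrite normr_gt0 subr_eq0.
near=> m.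
have hm : `|tnth x i - tnth y i|^-1 <= m%:R.
  by near: m; exact: nbhs_infty_ger.
apply/eqP => /(congr1 (fun t => tnth t i)); rewrite !tnth_mktuple => fxy.
have m0 : 0 < m.+1%:R :> R by [].
have hd : 1 <= m%:R * `|tnth x i - tnth y i| by rewrite -ler_pdivrMr// div1r.
have : `|m.+1%:R * tnth x i - m.+1%:R * tnth y i| < 1.
  have /andP[a1 a2] := floor_itv (m.+1%:R * tnth x i).
  have /andP[b1 b2] := floor_itv (m.+1%:R * tnth y i).
  rewrite fxy in a1 a2; move: a1 a2 b1 b2.
  rewrite intrD; set f := _%:~R; move=> a1 a2 b1 b2.
  by rewrite ltr_norml; apply/andP; split; lra.
rewrite -mulrBr normrM ger0_norm// ltNge -natr1 mulrDl mul1r => /negP; apply.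
by rewrite ler_wpDr.
Unshelve. all: by end_near. Qed.

Lemma grid_cell_uniq (s : seq (Rvec R n)) : uniq s ->
  \forall m \near \oo, uniq (map (grid_cell m) s).
Proof.
elim: s => [_|x s ih /= /andP[xs us]]; first by near=> m.
have : \forall m \near \oo, grid_cell m x \notin map (grid_cell m) s.
  elim: s xs {us ih} => [_|y s ih]; first by near=> m.
  rewrite inE negb_or => /andP[xy xs]; near=> m.
  rewrite /= inE negb_or; apply/andP; split.
    by near: m; exact: grid_cell_separates.
  by near: m; exact: ih.
move=> h; near=> m; apply/andP; split; first by near: m.
by near: m; exact: ih.
Unshelve. all: by end_near. Qed.

(* A configuration may carry several marks at one location, so the evaluation
   events do not count its locations directly.  There are at least k locations
   iff at least k cells of some grid are occupied. *)
Lemma measurable_gpts_ge C k : measurable C -> ebounded C ->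
  measurable [set Y | (k <= ncard (gpts C Y))%N].
Proof.
move=> mC bC.
pose cell m z := C `&` [set x | grid_cell m x = z].
have mcell m z : measurable (cell m z).
  by apply: measurableI => //; exact: measurable_grid_cell.
have bcell m z : ebounded (cell m z).
  by have [c [r Cr]] := bC; exists c, r => x [Cx _]; exact: Cr.
pose F (q : nat * seq (n.-tuple int)) : set conf :=
  if uniq q.2 && (k <= size q.2)%N then
    \bigcap_(z in [set` q.2]) ~` [set Y | (pts (cell q.1 z) Y `&` setT #= `I_0)%card]
  else set0.
rewrite (_ : [set Y | _] = \bigcup_q F q).
  apply: countable_bigcupT_measurable => [|q]; first exact: countableP.
  rewrite /F; case: ifP => // _.
  apply: fin_bigcap_measurable => // z _.
  by apply: measurableC; exact: measurable_pts_card.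
have occP m z Y : ~ (pts (cell m z) Y `&` setT #= `I_0)%card <->
    exists2 x, gpts C Y x & grid_cell m x = z.
  rewrite setIT; split.
    move=> h; have /set0P[[x a] [Yxa [[Cx xz] _]]] : pts (cell m z) Y != set0.
      by apply/negP => /eqP h0; apply: h; rewrite II0 card_eq0 h0 eqxx.
    by exists x => //; split => //; exists (x, a).
  move=> [x [[[x' a] Yp /= <-] Cx] xz]; rewrite II0 card_eq0 => /eqP h.
  suff: set0 (x', a) by [].
  by rewrite -h; split.
apply/seteqP; split => Y /=.
  move=> kY.
  have fin := gpts_finite Y bC.
  pose s : seq (Rvec R n) := fset_set (gpts C Y).
  have us : uniq s by exact: fset_uniq.
  have [m _ /(_ m (leqnn _)) hm] := grid_cell_uniq us.
  exists (m, map (grid_cell m) s) => //.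
  rewrite /F/= hm size_map/= kY => z /= /mapP[x xs ->].
  apply/occP; exists x => //.
  by apply/set_mem; rewrite -in_fset_set.
move=> [[m s] _]; rewrite /F/=; case: ifP => // /andP[us ks] h.
apply: leq_trans ks _.
have fin := gpts_finite Y bC.
rewrite /ncard -(size_map (grid_cell m)).
apply: uniq_leq_size => // z zs.
have /occP[x xC <-] := h z zs.
by apply: map_f; rewrite in_fset_set// mem_set.
Qed.

Lemma measurable_gpts_eq C k : measurable C -> ebounded C ->
  measurable [set Y | ncard (gpts C Y) = k].
Proof.
move=> mC bC.
rewrite (_ : [set Y | _] = [set Y | (k <= ncard (gpts C Y))%N] `\`
    [set Y | (k.+1 <= ncard (gpts C Y))%N]).
  by apply: measurableD; exact: measurable_gpts_ge.
apply/seteqP; split => Y /=; first by move=> ->; rewrite ltnn leqnn.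
by move=> [h /negP]; rewrite -leqNgt => h'; apply/eqP; rewrite eqn_leq h'.
Qed.

Lemma unique_marks_gpts C Y : unique_marks Y -> ebounded C ->
  ncard (gpts C Y) = ncard (pts C Y).
Proof.
move=> uY bC.
rewrite (_ : gpts C Y = fst @` pts C Y); last first.
  apply/seteqP; split => [x [[[x' a] Yp /= <-] Cx]|_ [[x a] [Yp [Cx _]] <-]].
    by exists (x', a).
  by split => //; exists (x, a).
have fin := pts_finite Y bC.
apply/ncardP; first exact: finite_image.
rewrite (card_eql (inj_card_eq _)); first exact/ncardP.
move=> [x a] [y b] /set_mem[Yx _] /set_mem[Yy _] /= xy.
by rewrite xy in Yx *; rewrite (uY _ _ _ Yx Yy).
Qed.

Lemma vadd_inj (c : Rvec R n) : injective (vadd c).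
Proof.
move=> x y /(congr1 (fun t => tnth t)) xy; apply: eq_from_tnth => i.
by have := congr1 (@^~ i) xy; rewrite !tnth_mktuple => /addrI.
Qed.

Lemma gpts_shift (c : Rvec R n) C Y :
  (points (gconf_shift c (ground Y)) `&` C #= gpts (vadd c @^-1` C) Y)%card.
Proof.
rewrite (_ : _ `&` C = vadd c @` gpts (vadd c @^-1` C) Y); last first.
  apply/seteqP; split => [_ [[x Yx <-] Cx]|_ [x [Yx Cx] <-]]; first by exists x.
  by split => //; exists x.
by apply: inj_card_eq => x y _ _; exact: vadd_inj.
Qed.

End ground_counts.

(** * Stationarity and counts in unit cubes *)

Section counting_moments.
Context {R : realType} {n : nat} {dO dM : measure_display}
  {Omega : measurableType dO} {M : measurableType dM} {P : probability Omega R}.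
Context (X : {RV P >-> mconf R n M}).
Hypothesis X_marks : {ae P, forall w, unique_marks (X w)}.
Hypothesis X_stationary : stationary P (fun w => ground (X w)).

Lemma measurable_nat_fun (N : Omega -> nat) (f : nat -> R) :
  (forall k, measurable [set w | N w = k]) ->
  measurable_fun setT (fun w => (f (N w))%:E).
Proof.
move=> mN _ V mV; rewrite setTI.
rewrite (_ : _ @^-1` V = \bigcup_(k in [set k | V (f k)%:E]) [set w | N w = k]).
  exact: bigcup_measurable.
by apply/seteqP; split => [w Vw|w [k Vk /= Nk]]; [exists (N w)|rewrite /= Nk].
Qed.

(** Both integrals are the same series over the values of the counts, whose laws agree. *)
Lemma nat_expectation_eq (N1 N2 : Omega -> nat) (f : nat -> R) :
  (forall k, measurable [set w | N1 w = k]) ->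
  (forall k, measurable [set w | N2 w = k]) ->
  (forall k, P [set w | N1 w = k] = P [set w | N2 w = k]) ->
  (forall k, 0 <= f k) ->
  (\int[P]_w (f (N1 w))%:E = \int[P]_w (f (N2 w))%:E)%E.
Proof.
move=> m1 m2 N12 f0.
have key (N : Omega -> nat) : (forall k, measurable [set w | N w = k]) ->
  (\int[P]_w (f (N w))%:E = \sum_(0 <= k <oo) (f k)%:E * P [set w | N w = k])%E.
  move=> mN.
  have -> : [set: Omega] = \bigcup_k [set w | N w = k].
    by apply/seteqP; split => // w _; exists (N w).
  have tN : trivIset setT (fun k => [set w | N w = k]).
    by apply/trivIsetP => i j _ _ ij; apply/seteqP; split => // w [/= -> /eqP]; exact/negP.
  have mfN : measurable_fun (\bigcup_k [set w | N w = k]) (fun w => (f (N w))%:E : \bar R).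
    by apply: measurable_funTS; exact: measurable_nat_fun.
  rewrite ge0_integral_bigcup//=; last by move=> w _; rewrite lee_fin.
  apply: eq_eseriesr => k _.
  rewrite (eq_integral (cst (f k)%:E)); last by move=> w /set_mem /= ->.
  by rewrite integral_cst.
by rewrite (key N1)// (key N2)//; apply: eq_eseriesr => k _; rewrite N12.
Qed.

Definition cube (c : Rvec R n) : set (Rvec R n) :=
  [set x | forall i, `|tnth x i - tnth c i| <= 2^-1].

Lemma cubeE c : cube c = [set x | forall i, tnth x i \in `[tnth c i - 2^-1, tnth c i + 2^-1]].
Proof.
by apply/seteqP; split => x /= h i; have := h i; rewrite in_itv/= ler_distl.
Qed.

Lemma measurable_cube c : measurable (cube c).
Proof.
rewrite cubeE (_ : [set x | _] = \bigcap_(i in [set: 'I_n])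
    (fun x => tnth x i) @^-1` [set` `[tnth c i - 2^-1, tnth c i + 2^-1]]).
  apply: fin_bigcap_measurable => // i _.
  by rewrite -[X in measurable X]setTI; exact: measurable_tnth.
by apply/seteqP; split => x h i; [move=> _|]; exact: h.
Qed.

Lemma leb_cube c : leb n (cube c) = 1%E.
Proof.
rewrite cubeE leb_box; last by move=> i; lra.
by rewrite big1// => i _; lra.
Qed.

Lemma dist_le (x y : Rvec R n) (r : R) : 0 <= r ->
  (forall i, `|tnth x i - tnth y i| <= r) -> dist x y <= r * n%:R.
Proof.
move=> r0 h; rewrite /dist.
apply: le_trans (_ : Num.sqrt ((r * n%:R) ^+ 2) <= _); last first.
  by rewrite sqrtr_sqr ger0_norm// mulr_ge0.
apply: ler_wsqrtr.
apply: le_trans (_ : \sum_(i < n) r ^+ 2 <= _).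
  by apply: ler_sum => i _; rewrite -real_normK ?num_real// lerXn2r// ?nnegrE.
rewrite sumr_const card_ord exprMn -[leLHS]mulr_natr ler_wpM2l ?sqr_ge0//.
by rewrite -natrX ler_nat -mulnn; case: (n) => // k; rewrite leq_pmull.
Qed.

Lemma ebounded_cube c : ebounded (cube c).
Proof.
exists c, (2^-1 * n%:R + 1) => x hx; rewrite /eball/=.
apply: le_lt_trans (_ : _ <= 2^-1 * n%:R) _; last by rewrite ltrDl.
by apply: dist_le => // i; rewrite distrC; exact: hx.
Qed.

Lemma window1E : window 1 = cube [tuple (0 : R) | i < n].
Proof.
by apply/seteqP; split => x /= h i; have := h i; rewrite tnth_mktuple subr0 powR1 mulr1.
Qed.

Lemma vadd_cube c : vadd [tuple (- tnth c i : R) | i < n] @^-1` window 1 = cube c.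
Proof.
rewrite window1E.
by apply/seteqP; split => x /= h i; have := h i; rewrite !tnth_mktuple subr0 addrC.
Qed.

(** Stationarity concerns the ground process. Marked points are therefore first replaced by their
    locations, almost surely equally many, and then the cube is shifted to the origin. *)
Lemma cube_count_expectation c (f : nat -> R) : (forall k, 0 <= f k) ->
  (\int[P]_w (f (ncard (pts (cube c) (X w))))%:E =
   \int[P]_w (f (ncard (gpts (window 1) (X w))))%:E)%E.
Proof.
move=> f0.
have bc := ebounded_cube c; have mc := measurable_cube c.
have bW : ebounded (@window R n 1) by rewrite window1E; exact: ebounded_cube.
have mW : measurable (@window R n 1) by rewrite window1E; exact: measurable_cube.
have mX (A : set (mconf R n M)) : measurable A -> measurable (X @^-1` A).
  by move=> mA; rewrite -[X in measurable X]setTI; exact: measurable_funPT.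
have mg C k : measurable C -> ebounded C -> measurable [set w | ncard (gpts C (X w)) = k].
  by move=> mC bC; apply: (mX [set Y | ncard (gpts C Y) = k]); exact: measurable_gpts_eq.
have mp k : measurable [set w | ncard (pts (cube c) (X w)) = k].
  rewrite (_ : [set w | _] = X @^-1` [set Y | (pts (cube c) Y `&` setT #= `I_k)%card]).
    by apply: mX; exact: measurable_pts_card.
  apply/seteqP; split => w /=; rewrite setIT.
    by move=> h; apply/ncardP => //; exact: pts_finite.
  by move/ncardP; apply; exact: pts_finite.
transitivity (\int[P]_w (f (ncard (gpts (cube c) (X w))))%:E)%E.
  apply: ae_eq_integral => //.
  - exact: measurable_nat_fun mp.
  - by apply: measurable_nat_fun => k; exact: mg.
  - have [N [mN N0 hN]] := X_marks.
    exists N; split => // w hw; apply: hN => /= uw; apply: hw => _.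
    by rewrite unique_marks_gpts.
apply: nat_expectation_eq => // [k|k|k]; [exact: mg|exact: mg|].
have := @X_stationary [tuple (- tnth c i : R) | i < n]
  [set Y | (points Y `&` window 1 #= `I_k)%card] _.
rewrite /pushforward (_ : _ @^-1` _ = [set w | ncard (gpts (cube c) (X w)) = k]).
  rewrite (_ : _ @^-1` _ = [set w | ncard (gpts (window 1) (X w)) = k]).
    apply; apply: sub_sigma_algebra; exists (window 1) => //.
    by exists k.
  apply/seteqP; split => w /=.
    by move/ncardP; apply; exact: gpts_finite.
  by move=> h; apply/ncardP => //; exact: gpts_finite.
apply/seteqP; split => w /=; rewrite (card_eql (gpts_shift _ _ _)) vadd_cube.
  by move/ncardP; apply; exact: gpts_finite.
by move=> h; apply/ncardP => //; exact: gpts_finite.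
Qed.

End counting_moments.

(** * Moments of block sums *)

Section power_sums.
Context {R : realType}.
Implicit Types (p q x y : R).

Lemma powR_le_mono x y p : 0 <= p -> 0 <= x -> x <= y -> x `^ p <= y `^ p.
Proof.
move=> p0 x0 xy; apply: ge0_ler_powR => //; rewrite nnegrE//.
exact: le_trans xy.
Qed.

Lemma powR_le1D x p q : 0 <= x -> 0 <= p -> p <= q -> x `^ p <= 1 + x `^ q.
Proof.
move=> x0 p0 pq; have [x1|/ltW x1] := leP x 1.
  rewrite ler_wpDr ?powR_ge0//.
  by rewrite -[leRHS](congr1 (@^~ p) (powR1 R)) powR_le_mono.
by rewrite ler_wpDl// ler_powR.
Qed.

(** Above the threshold [a], the factor (x / a)^(p - 1) is at least 1. *)
Lemma le_threshold x a p : 0 <= x -> 0 < a -> 1 <= p ->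
  x <= a + x `^ p * a `^ (1 - p).
Proof.
move=> x0 a0 p1; have [xa|/ltW ax] := leP x a.
  by rewrite ler_wpDr// mulr_ge0 ?powR_ge0.
have xgt0 : 0 < x by exact: lt_le_trans ax.
rewrite ler_wpDl ?(ltW a0)//.
have xE : x `^ p = x * x `^ (p - 1) by rewrite mulr_powRB1// (lt_le_trans _ p1).
rewrite xE -mulrA ler_peMr// -(opprB p 1) powRN ler_pdivlMr ?powR_gt0// mul1r.
by rewrite powR_le_mono ?subr_ge0 ?(ltW a0).
Qed.

(* Splitting the terms at the threshold a = m^(1/q - 1/p1), where
   m = (size s)^p1 + \sum f^p, makes both parts at most m^(1/q). *)
Lemma sum_powR_le (T : Type) (s : seq T) (f : T -> R) (p1 p : R) :
  1 <= p1 -> 1 <= p -> (forall z, 0 <= f z) ->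
  let q := p1 * p / (p1 + p - 1) in
  (\sum_(z <- s) f z) `^ q <=
  2 `^ q * ((size s)%:R `^ p1 + \sum_(z <- s) f z `^ p).
Proof.
move=> p11 pge1 f0; set q := _ / _.
have p10 : 0 < p1 by lra.
have p0 : 0 < p by lra.
have pp0 : 0 < p1 + p - 1 by lra.
have q0 : 0 < q by rewrite divr_gt0 ?mulr_gt0.
set S := \sum_(z <- s) f z; set T1 := \sum_(z <- s) f z `^ p.
have S0 : 0 <= S by apply: sumr_ge0.
have T0 : 0 <= T1 by apply: sumr_ge0 => z _; exact: powR_ge0.
set m := (size s)%:R `^ p1 + T1.
have m0 : 0 <= m by rewrite addr_ge0// powR_ge0.
case: (posnP (size s)) => [s0|sgt0].
  by rewrite /S (size0nil s0) big_nil powR0 ?gt_eqF// mulr_ge0// powR_ge0.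
have m1 : 0 < m by rewrite ltr_pwDl// powR_gt0// ltr0n.
have mnz : m != 0 by rewrite gt_eqF.
pose a := m `^ (q^-1 - p1^-1).
have a0 : 0 < a by rewrite powR_gt0.
have Na : (size s)%:R * a <= m `^ q^-1.
  have h : (size s)%:R <= m `^ p1^-1.
    rewrite -[leLHS]powRr1// -[X in _ `^ X](@divff _ p1) ?gt_eqF// powRrM.
    by rewrite powR_le_mono ?invr_ge0 ?(ltW p10) ?powR_ge0// lerDl.
  apply: le_trans (ler_wpM2r (ltW a0) h) _.
  by rewrite /a -powRD ?mnz ?implybT// addrC subrK.
have Ta : T1 * a `^ (1 - p) <= m `^ q^-1.
  apply: le_trans (_ : m * a `^ (1 - p) <= _).
    by rewrite ler_wpM2r ?powR_ge0// lerDr powR_ge0.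
  rewrite -[X in X * _]powRr1// /a -powRrM -powRD ?mnz ?implybT//.
  (* This identity between exponents determines [q]: the same threshold must balance both parts. *)
  rewrite (_ : 1 + _ = q^-1)//.
  by rewrite /q; field; rewrite !gt_eqF.
have SN : S <= 2 * m `^ q^-1.
  apply: le_trans (_ : \sum_(z <- s) (a + f z `^ p * a `^ (1 - p)) <= _).
    by apply: ler_sum => z _; exact: le_threshold.
  rewrite big_split/= -mulr_suml big_const_seq count_predT iter_addr addr0.
  rewrite -[a *+ _]mulr_natl (_ : 2 * m `^ q^-1 = m `^ q^-1 + m `^ q^-1); last by ring.
  exact: lerD.
apply: le_trans (powR_le_mono (ltW q0) S0 SN) _.
by rewrite powRM ?powR_ge0// -powRrM mulVf ?gt_eqF// powRr1.
Qed.

(** A form of Young's inequality, by comparing [y] with t^(s - 1). The summand 1 pays for raising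
    the conjugate exponent s / (s - 1) to [q]. *)
Lemma conjugate_le (t y s q : R) : 0 <= t -> 0 <= y -> 1 < s ->
  s / (s - 1) <= q -> t * y <= t `^ s + 1 + y `^ q.
Proof.
move=> t0 y0 s1 sq; have s10 : 0 < s - 1 by rewrite subr_gt0.
have [yt|/ltW ty] := leP y (t `^ (s - 1)).
  apply: le_trans (ler_wpM2l t0 yt) _.
  by rewrite mulr_powRB1 ?(lt_trans _ s1)// -addrA ler_wpDr// addr_ge0// powR_ge0.
have ty' : t <= y `^ (s - 1)^-1.
  rewrite -[leLHS]powRr1// -[X in _ `^ X](@divff _ (s - 1)) ?gt_eqF// powRrM.
  by rewrite powR_le_mono ?invr_ge0 ?(ltW s10)// powR_ge0.
apply: le_trans (ler_wpM2r y0 ty') _.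
rewrite mulrC (_ : y `^ _ = y `^ (s / (s - 1) - 1)); last first.
  by congr (_ `^ _); field; rewrite gt_eqF.
have s0 : 0 < s / (s - 1) by rewrite divr_gt0// (lt_trans _ s1).
rewrite mulr_powRB1// -addrA ler_wpDl ?powR_ge0// powR_le1D// ltW//.
Qed.

End power_sums.

Section block_moments.
Context {R : realType} {n : nat} {dO dM : measure_display}
  {Omega : measurableType dO} {M : measurableType dM} {P : probability Omega R}.
Context (X : {RV P >-> mconf R n M}).
Hypothesis X_marks : {ae P, forall w, unique_marks (X w)}.
Hypothesis X_stationary : stationary P (fun w => ground (X w)).
Context (mu : R) (mu_gt0 : 0 < mu).
Context (palm : R.-pker (Rvec R n) ~> (M * mconf R n M)%type).
Hypothesis palmP : is_palm P X mu palm.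
Context (p1 p : R) (p1_ge2 : 2 <= p1) (p_ge1 : 1 <= p).
Hypothesis X_moment : point_moment P (fun w => ground (X w)) p1.
Local Notation pt := ((Rvec R n * M) * mconf R n M)%type.
Local Notation q := (p1 * p / (p1 + p - 1)).

Definition npts (B : set (Rvec R n)) (w : Omega) : R := (ncard (pts B (X w)))%:R.

Definition count_moment : R :=
  fine (\int[P]_w ((ncard (gpts (window 1) (X w)))%:R `^ p1)%:E)%E.

Lemma npts_psum B : ebounded B -> npts B = psum B (fun=> 1) \o X.
Proof.
by move=> bB; apply/funext => w; rewrite /npts ncard_fsum//; exact: pts_finite.
Qed.

Lemma measurable_npts B : measurable B -> ebounded B -> measurable_fun setT (npts B).
Proof.
by move=> mB bB; rewrite npts_psum//; apply: measurableT_comp => //; exact: measurable_psum.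
Qed.

Lemma measurable_powR_fun d (T : measurableType d) (f : T -> R) a :
  measurable_fun setT f -> measurable_fun setT (fun w => f w `^ a).
Proof. by move=> mf; apply: (measurableT_comp (measurable_powR _)). Qed.

Let p10 : 0 < p1. Proof. exact: lt_le_trans p1_ge2. Qed.

Lemma cube_moment c : L1 P (fun w => npts (cube c) w `^ p1) /\
  Ex P (fun w => npts (cube c) w `^ p1) = count_moment.
Proof.
have bW : ebounded (@window R n 1) by rewrite window1E; exact: ebounded_cube.
have E := cube_count_expectation X_marks X_stationary c (fun k => powR_ge0 (k%:R : R) p1).
have fin : (\int[P]_w ((ncard (gpts (window 1) (X w)))%:R `^ p1)%:E < +oo)%E.
  have h := poweR_Lnorm P (fun w => counting (points (ground (X w)) `&` window 1)) (lt0r_neq0 p10).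
  have := poweR_lty p1 X_moment; rewrite h; apply: le_lt_trans.
  rewrite le_eqVlt; apply/orP; left; apply/eqP; apply: eq_integral => w _.
  rewrite /counting asboolT; last exact: gpts_finite.
  by rewrite /= ger0_norm.
split; last by rewrite /Ex /Rintegral /count_moment -E.
apply/integrableP; split.
  apply/measurable_EFinP/measurable_powR_fun/measurable_npts => //.
    exact: measurable_cube.
  exact: ebounded_cube.
under eq_integral do rewrite /= ger0_norm ?powR_ge0//.
by rewrite E.
Qed.

Section block.
Variables (B : set (Rvec R n)) (c : Rvec R n).
Hypotheses (mB : measurable B) (Bc : B `<=` cube c).

Let bB : ebounded B.
Proof. by have [a [r h]] := ebounded_cube c; exists a, r => x /Bc/h. Qed.

Let lB : (leb n B <= 1)%E.
Proof.
rewrite -(leb_cube c).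
have h := @le_measure _ _ _ (leb n) B (cube c).
by apply: h; [exact/mem_set|apply/mem_set; exact: measurable_cube|exact: Bc].
Qed.

Let npts_le w : npts B w <= npts (cube c) w.
Proof.
rewrite /npts ler_nat; apply: fsubset_leq_card; rewrite -fset_set_sub.
- by move=> z [Xz [Bz _]]; split => //; split => //; exact: Bc.
- exact: pts_finite.
- by apply: pts_finite; exact: ebounded_cube.
Qed.

Lemma block_count : L1 P (fun w => npts B w `^ p1) /\
  Ex P (fun w => npts B w `^ p1) <= count_moment.
Proof.
have [ic <-] := cube_moment c.
have le w : npts B w `^ p1 <= npts (cube c) w `^ p1.
  by rewrite powR_le_mono ?(ltW p10).
have iB : L1 P (fun w => npts B w `^ p1).
  apply: (L1_dom _ ic); first exact/measurable_powR_fun/measurable_npts.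
  by move=> w; rewrite ger0_norm ?powR_ge0.
by split; [exact: iB|exact: Ex_le iB ic le].
Qed.

(** [sum_powR_le], applied for each configuration, separates the number of points from the scores:
    the former is controlled by stationarity, the latter by Campbell's formula. Here [q] has the
    form of [pbar]. *)
Lemma block_moment (g : pt -> R) (C : R) : measurable_fun setT g -> 0 <= C ->
  (forall x, B x -> \int[palm x]_y (`|g ((x, y.1), y.2)| `^ p)%:E <= C%:E)%E ->
  L1 P (fun w => psum B (fun z => `|g z|) (X w) `^ q) /\
  Ex P (fun w => psum B (fun z => `|g z|) (X w) `^ q) <= 2 `^ q * (count_moment + mu * C).
Proof.
move=> mg C0 gC.
have mag : measurable_fun setT (fun z => `|g z|) by exact: measurableT_comp.
have mgp : measurable_fun setT (fun z => `|g z| `^ p) by exact: measurable_powR_fun.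
have [iT ET] := palm_sum_bound mu_gt0 palmP mB bB mgp
  (fun z => powR_ge0 _ _) C0 lB gC.
have [iN EN] := block_count.
have iNT : L1 P (fun w => 2 `^ q * (npts B w `^ p1 + psum B (fun z => `|g z| `^ p) (X w))).
  by apply: L1Z; apply: L1D.
have le w : psum B (fun z => `|g z|) (X w) `^ q <=
    2 `^ q * (npts B w `^ p1 + psum B (fun z => `|g z| `^ p) (X w)).
  have fin := pts_finite (X w) bB.
  rewrite /psum !fsbig_finite//= /npts /ncard.
  apply: (@sum_powR_le _ _ _ (fun x => `|g (x, X w)|)) => //.
  by apply: le_trans p1_ge2; rewrite ler1n.
have iS : L1 P (fun w => psum B (fun z => `|g z|) (X w) `^ q).
  apply: (L1_dom _ iNT).
    apply/measurable_powR_fun; apply: measurableT_comp => //.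
    exact: measurable_psum.
  by move=> w; rewrite ger0_norm ?powR_ge0.
split; [exact: iS|apply: le_trans (Ex_le iS iNT le) _].
rewrite ExZ; last exact: L1D.
by rewrite ler_wpM2l ?powR_ge0// ExD// lerD.
Qed.

(** Dividing [g] by [Phi] normalises its Palm moment of order [s]. Young's inequality at each point
    then leaves the number of points times Y^(q / 2), and a second one leaves the square of that
    number and Y^q. The condition on [s] is exactly that the first step may end at the exponent q /
    2. *)
Lemma block_error (g : pt -> R) (Phi s : R) (Y : Omega -> R) :
  measurable_fun setT g -> 0 < Phi -> 1 < s -> s / (s - 1) <= q / 2 ->
  (forall x, B x -> \int[palm x]_y (`|g ((x, y.1), y.2)| `^ s)%:E <= (Phi `^ s)%:E)%E ->
  measurable_fun setT Y -> (forall w, 0 <= Y w) -> L1 P (fun w => Y w `^ q) ->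
  L1 P (fun w => psum B (fun z => `|g z|) (X w) * Y w) /\
  Ex P (fun w => psum B (fun z => `|g z|) (X w) * Y w) <=
    Phi * (mu + 2 * count_moment + Ex P (fun w => Y w `^ q)).
Proof.
move=> mg Phi0 s1 sq gPhi mY Y0 iY.
have mag : measurable_fun setT (fun z => `|g z|) by exact: measurableT_comp.
pose gs z := (`|g z| / Phi) `^ s.
have mgs : measurable_fun setT gs.
  by apply: measurable_powR_fun; exact: measurable_funM.
have gs1 x : B x -> (\int[palm x]_y (gs ((x, y.1), y.2))%:E <= 1%:E)%E.
  move=> Bx; rewrite /gs.
  under eq_integral do rewrite powRM ?invr_ge0 ?(ltW Phi0)// mulrC EFinM.
  have mgx : measurable_fun setT (fun y => `|g ((x, y.1), y.2)| `^ s).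
    apply: measurable_powR_fun; apply: (measurableT_comp mag).
    apply: measurable_fun_pair => //; apply: (measurableT_comp (pair1_measurable x)).
    exact: measurable_fst.
  rewrite ge0_integralZl; last 4 first.
  - exact: measurableT.
  - exact/measurable_EFinP.
  - by move=> y _; rewrite lee_fin powR_ge0.
  - by rewrite lee_fin powR_ge0.
  apply: le_trans (lee_wpmul2l _ (gPhi x Bx)) _; first by rewrite lee_fin powR_ge0.
  rewrite -EFinM lee_fin -powRM ?invr_ge0 ?(ltW Phi0)// mulVf ?gt_eqF//.
  by rewrite powR1.
have [iG EG] := palm_sum_bound mu_gt0 palmP mB bB mgs
  (fun z => powR_ge0 _ _) ler01 lB gs1.
have [iN EN] := block_count.
pose bnd w := Phi * (psum B gs (X w) + 2 * npts B w `^ p1 + Y w `^ q).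
have ibnd : L1 P bnd.
  by apply: L1Z; apply: L1D => //; apply: L1D => //; exact: L1Z.
have q0 : 0 < q.
  have h : 0 < s / (s - 1) by rewrite divr_gt0 ?subr_gt0// (lt_trans _ s1).
  lra.
have le w : psum B (fun z => `|g z|) (X w) * Y w <= bnd w.
  have fin := pts_finite (X w) bB.
  have N0 : 0 <= npts B w by rewrite /npts.
  apply: le_trans (_ : Phi * (psum B gs (X w) + npts B w * (1 + Y w `^ (q / 2))) <= _).
    rewrite /psum !fsbig_finite//= /npts /ncard mulr_suml.
    have -> : (#|` fset_set (pts B (X w))|%fset)%:R * (1 + Y w `^ (q / 2)) =
       \sum_(z <- fset_set (pts B (X w))) (1 + Y w `^ (q / 2)).
      by rewrite big_const_seq count_predT iter_addr addr0 mulr_natl.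
    rewrite -big_split mulr_sumr; apply: ler_sum => z _ /=.
    have := conjugate_le (divr_ge0 (normr_ge0 (g (z, X w))) (ltW Phi0)) (Y0 w) s1 sq.
    move=> h; rewrite [leRHS](_ : _ = Phi * (gs (z, X w) + 1 + Y w `^ (q / 2))); last first.
      by rewrite addrA.
    apply: le_trans (ler_wpM2l (ltW Phi0) h).
    by rewrite mulrA mulrCA divff ?mulr1// gt_eqF.
  rewrite ler_pM2l// -(addrA (psum _ _ _)) lerD2l (mulrDr (npts B w)) mulr1.
  (* A count is 0 or at least 1, so its powers increase with the exponent and 2 <= p1 applies. *)
  have N2 : npts B w ^+ 2 <= npts B w `^ p1 /\ npts B w <= npts B w `^ p1.
    rewrite /npts; case: (ncard _) => [|k].
      by rewrite powR0 ?gt_eqF// expr0n.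
    have k1 : 1 <= k.+1%:R :> R by rewrite ler1n.
    split; first by rewrite -powR_mulrn ?ler_powR.
    by rewrite le1r_powR// (le_trans _ p1_ge2)// ler1n.
  have [N2a N2b] := N2.
  have : npts B w * Y w `^ (q / 2) <= npts B w ^+ 2 + Y w `^ q.
    have -> : Y w `^ q = (Y w `^ (q / 2)) ^+ 2.
      rewrite -powR_mulrn ?powR_ge0// -powRrM; congr (_ `^ _).
      by rewrite mulfVK.
    have := sqr_ge0 (npts B w - Y w `^ (q / 2)).
    have := powR_ge0 (Y w) (q / 2).
    move: (Y w `^ _) => a a0; nra.
  lra.
have iD : L1 P (fun w => psum B (fun z => `|g z|) (X w) * Y w).
  apply: (L1_dom _ ibnd).
    by apply: measurable_funM => //; apply: measurableT_comp => //; exact: measurable_psum.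
  move=> w; rewrite ger0_norm// mulr_ge0//.
  by apply: fsumr_ge0 => z _.
split; [exact: iD|apply: le_trans (Ex_le iD ibnd le) _].
have i2N : L1 P (fun w => 2 * npts B w `^ p1) by exact: L1Z.
have iGN : L1 P (fun w => psum B gs (X w) + 2 * npts B w `^ p1) by exact: L1D iG i2N.
rewrite /bnd (ExZ _ (L1D iGN iY)) ler_pM2l// (ExD iGN iY) (ExD iG i2N) (ExZ _ iN) lerD2r.
by rewrite mulr1 in EG; apply: lerD EG _; rewrite ler_pM2l.
Qed.

End block.

End block_moments.

(** * Local functionals *)

Section ae_expectation.
Context {R : realType} {d} {T : measurableType d} (P : probability T R).

Lemma ae_L1 (f g : T -> R) : measurable_fun setT f ->
  {ae P, forall w, f w = g w} -> L1 P g -> L1 P f.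
Proof.
move=> mf fg ig; have mg := L1_measurable ig.
have /integrableP[_ fin] := ig.
apply/integrableP; split; first exact/measurable_EFinP.
apply: le_lt_trans fin; rewrite le_eqVlt; apply/orP; left; apply/eqP.
apply: ae_eq_integral => //.
- by apply/measurable_EFinP; exact: measurableT_comp.
- by apply/measurable_EFinP; exact: measurableT_comp.
- by apply: filterS fg => w fgw _; rewrite /= fgw.
Qed.

Lemma ae_Ex (f g : T -> R) : measurable_fun setT f -> measurable_fun setT g ->
  {ae P, forall w, f w = g w} -> Ex P f = Ex P g.
Proof.
move=> mf mg fg; congr fine; apply: ae_eq_integral => //.
- exact/measurable_EFinP.
- exact/measurable_EFinP.
- by apply: filterS fg => w fgw _; rewrite /= fgw.
Qed.

End ae_expectation.

Section local_functionals.
Context {R : realType} {n : nat} {dO dM : measure_display}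
  {Omega : measurableType dO} {M : measurableType dM} {P : probability Omega R}.
Context (X : {RV P >-> mconf R n M}).
Local Notation conf := (mconf R n M).
Implicit Types (A B : set (Rvec R n)) (u v : conf -> R).

Lemma measurable_restr A : measurable A -> measurable_fun setT (@restr R n dM M A).
Proof.
move=> mA; apply: (measurability _ (erefl (<<s @evaluation_events _ _ _ >>))).
move=> _ [_ [C mC [k _ <-]] <-]; rewrite setTI.
apply: sub_sigma_algebra; exists ((A `*` setT) `&` C).
  by apply: measurableI => //; exact: measurableX.
by exists k => //; apply/seteqP; split => Y /=; rewrite setIA.
Qed.

Lemma restr_restr A B (Y : conf) : A `<=` B -> restr A (restr B Y) = restr A Y.
Proof.
move=> AB; apply: lfset_eq => /=; rewrite -setIA; congr (_ `&` _).
by apply/seteqP; split => p [] // Ap _; split => //; split => //; exact: AB.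
Qed.

Lemma restr_cunion A B (Y Y' : conf) : A `&` B = set0 ->
  restr A (cunion (restr A Y) (restr B Y')) = restr A Y.
Proof.
move=> AB0; apply: lfset_eq => /=; apply/seteqP; split => p /=.
  move=> [[[]//|[_ [Bp _]]] [Ap _]].
  by have : (A `&` B) p.1 by []; rewrite AB0.
by move=> [Yp Ap]; split => //; left.
Qed.

Lemma cunionC (Y Y' : conf) : cunion Y Y' = cunion Y' Y.
Proof. by apply: lfset_eq; rewrite /= setUC. Qed.

(* Almost surely only: short-range scores are local for almost all realizations. *)
Definition is_local A u := measurable_fun setT u /\
  {ae P, forall w, u (restr A (X w)) = u (X w)}.

Lemma is_local_comp A u (f : R -> R) : measurable_fun setT f ->
  is_local A u -> is_local A (f \o u).
Proof.
move=> mf [mu lu]; split; first exact: measurableT_comp.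
by apply: filterS lu => w /= ->.
Qed.

Lemma is_localM A u v : is_local A u -> is_local A v -> is_local A (fun Y => u Y * v Y).
Proof.
move=> [mu lu] [mv lv]; split; first exact: measurable_funM.
by apply: filterS2 lu lv => w -> ->.
Qed.

Lemma is_localD A u v : is_local A u -> is_local A v -> is_local A (fun Y => u Y + v Y).
Proof.
move=> [mu lu] [mv lv]; split; first exact: measurable_funD.
by apply: filterS2 lu lv => w -> ->.
Qed.

Lemma is_local_cst A c : is_local A (cst c).
Proof. by split => //; exact: aeW. Qed.

Lemma is_local_sum A (I : Type) (s : seq I) (Q : pred I) (u : I -> conf -> R) :
  (forall i, Q i -> is_local A (u i)) ->
  is_local A (fun Y => \sum_(i <- s | Q i) u i Y).
Proof.
move=> h; elim: s => [|i s ih].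
  rewrite (_ : (fun Y => _) = cst 0); first exact: is_local_cst.
  by apply/funext => Y; rewrite big_nil.
rewrite (_ : (fun Y => _) = fun Y => (if Q i then u i Y else 0) + \sum_(j <- s | Q j) u j Y).
  by apply: is_localD => //; case Qi : (Q i); [exact: h|exact: is_local_cst].
by apply/funext => Y; rewrite big_cons; case: (Q i) => //; rewrite add0r.
Qed.

Lemma is_local_measurable A u : is_local A u -> measurable_fun setT (u \o X).
Proof. by move=> [mu _]; exact: measurableT_comp. Qed.

Lemma is_local_measurable_restr A u : measurable A -> is_local A u ->
  measurable_fun setT (fun w => u (restr A (X w))).
Proof.
move=> mA [mu _]; apply: (measurableT_comp mu).
by apply: (measurableT_comp (measurable_restr mA)).
Qed.

Section decorrelation.
Variables (A B : set (Rvec R n)) (delta : R).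
Hypotheses (mA : measurable A) (mB : measurable B) (delta_gt0 : 0 < delta).
Hypothesis AB0 : A `&` B = set0.
Hypothesis tv : (dTV (pushforward P (restr (A `|` B) \o X))
          (pushforward (P \x P)
             (fun w => cunion (restr A (X w.1)) (restr B (X w.2)))) <= (delta ^+ 3)%:E)%E.
Variables (u v a b : conf -> R).
Hypotheses (lu : is_local A u) (lv : is_local B v).
Hypotheses (la : is_local A a) (lb : is_local B b).
Hypotheses (a0 : forall Y, 0 <= a Y) (b0 : forall Y, 0 <= b Y).
Hypothesis uv : forall Y Y', `|u Y * v Y'| <= (a Y + b Y') ^+ 2.
Hypotheses (iu : L1 P (u \o X)) (iv : L1 P (v \o X)).
Hypotheses (ia : L1 P (fun w => a (X w) ^+ 3)) (ib : L1 P (fun w => b (X w) ^+ 3)).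

(** For disjoint [A] and [B], both restricted functionals can be read off from either of the two
    configurations compared by [tv], so every level set of their product is an event that the total
    variation controls. The restrictions are removed at the end, almost surely. *)
Lemma decor_local : `|Ex P (fun w => u (X w) * v (X w)) - Ex P (u \o X) * Ex P (v \o X)| <=
  delta * (2 + 8 * (Ex P (fun w => a (X w) ^+ 3) + Ex P (fun w => b (X w) ^+ 3))).
Proof.
have mu' := is_local_measurable_restr mA lu.
have mv' := is_local_measurable_restr mB lv.
have ma' := is_local_measurable_restr mA la.
have mb' := is_local_measurable_restr mB lb.
have mu := is_local_measurable lu; have mv := is_local_measurable lv.
have ma := is_local_measurable la; have mb := is_local_measurable lb.
have la3 : {ae P, forall w, a (restr A (X w)) ^+ 3 = a (X w) ^+ 3}.
  by apply: filterS la.2 => w ->.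
have lb3 : {ae P, forall w, b (restr B (X w)) ^+ 3 = b (X w) ^+ 3}.
  by apply: filterS lb.2 => w ->.
have ma3 : measurable_fun setT (fun w => a (restr A (X w)) ^+ 3) by exact: measurable_funX.
have mb3 : measurable_fun setT (fun w => b (restr B (X w)) ^+ 3) by exact: measurable_funX.
have tail (t : R) :
  (`|P [set w | (t < u (restr A (X w)) * v (restr B (X w)))%R] -
     (P \x P) [set z | (t < u (restr A (X z.1)) * v (restr B (X z.2)))%R]|
     <= (delta ^+ 3)%:E)%E.
  apply: le_trans tv; apply: ereal_sup_ubound.
  exists [set Y | t < u (restr A Y) * v (restr B Y)].
    apply: measurable_set_lt; apply: measurable_funM.
      by apply: (measurableT_comp lu.1); exact: measurable_restr.
    by apply: (measurableT_comp lv.1); exact: measurable_restr.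
  rewrite /pushforward; congr (`|P _ - (P \x P) _|)%E.
    by apply/seteqP; split => w /=; rewrite !restr_restr.
  have BA0 : B `&` A = set0 by rewrite setIC.
  by apply/seteqP; split => z /=; rewrite restr_cunion// cunionC restr_cunion.
have := @decoupling _ _ _ P (fun w => u (restr A (X w))) (fun w => v (restr B (X w)))
  (fun w => a (restr A (X w))) (fun w => b (restr B (X w))) delta
  (ae_L1 mu' lu.2 iu) (ae_L1 mv' lv.2 iv) ma' mb' (fun w => a0 _) (fun w => b0 _)
  (ae_L1 ma3 la3 ia) (ae_L1 mb3 lb3 ib) (fun w w' => uv _ _) delta_gt0 tail.
rewrite (ae_Ex mu' mu lu.2) (ae_Ex mv' mv lv.2) (ae_Ex ma3 (L1_measurable ia) la3).
rewrite (ae_Ex mb3 (L1_measurable ib) lb3).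
rewrite (@ae_Ex _ _ _ P _ (fun w => u (X w) * v (X w)))//.
- exact: measurable_funM.
- exact: measurable_funM.
- by apply: filterS2 lu.2 lv.2 => w -> ->.
Qed.

End decorrelation.

End local_functionals.

(** * Blocks of the window *)

Section block_neighbourhoods.
Context {n m : nat}.
Local Notation index := {ffun 'I_n -> 'I_m}.
Implicit Types i j : index.

Definition block_nbhd (rho : nat) i : {set index} :=
  [set j : index | [forall k, (`|(i k)%:Z - (j k)%:Z|%N <= rho)%N]].

Lemma card_block_nbhd rho i : (#|block_nbhd rho i| <= (2 * rho + 1) ^ n)%N.
Proof.
pose F k : {set 'I_m} := finset (fun a : 'I_m => (`|(i k)%:Z - a%:Z|%N <= rho)%N).
have -> : #|block_nbhd rho i| = #|family F|.
  apply: eq_card => j; rewrite inE.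
  by apply/forallP/familyP => h k; have := h k; rewrite inE.
rewrite card_family foldrE big_map -[X in (_ <= _ ^ X)%N]card_ord -prod_nat_const.
rewrite big_enum/=; apply: leq_prod => k _.
rewrite -[leqRHS]card_ord addn1.
(* The offset from the lower end of the range. The truncated subtraction is exact, because a + rho
   >= i k on [F k]. *)
pose f (a : 'I_m) : 'I_(2 * rho).+1 := inord (a + rho - i k).
rewrite -(@card_in_imset _ _ f (F k)); first exact: max_card.
move=> a b; rewrite !inE => ha hb /(congr1 val).
rewrite /f /= !inordK; last 2 first.
- by move: hb; lia.
- by move: ha; lia.
by move=> ab; apply/val_inj => /=; move: ha hb; lia.
Qed.

Lemma block_nbhd_far rho i j (k : index) :
  j \in block_nbhd rho i -> k \notin block_nbhd (2 * rho) i -> k \notin block_nbhd rho j.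
Proof.
rewrite !inE => /forallP ij; rewrite !negb_forall => /existsP[l hl].
by apply/existsP; exists l; move: hl (ij l); lia.
Qed.

End block_neighbourhoods.

Section blocks.
Context {R : realType} {n : nat}.
Variables (m : nat) (L r : R).
Local Notation pos := (Rvec R n).
Local Notation index := {ffun 'I_n -> 'I_m}.
Implicit Types (i j : index) (x y : pos) (S T : {set index}).

Hypotheses (L_ge0 : 0 <= L) (L_lt : L < m%:R) (r_ge0 : 0 <= r).

Definition centered_cube : set pos := [set x | forall k, `|tnth x k| <= 2^-1 * L].

(** Half-open, so that the blocks partition the window; [L < m] being strict, the closed upper faces
    of the window still fall into some block. *)
Definition block i : set pos :=
  [set x | centered_cube x /\ forall k, (i k)%:R <= tnth x k + L / 2 < (i k)%:R + 1].

(** A box around the block, containing the ball of radius [r] about each of its points: the region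
    on which a short-range block sum depends. *)
Definition fattened i : set pos :=
  [set x | forall k, (i k)%:R - r <= tnth x k + L / 2 <= (i k)%:R + 1 + r].

Definition fattened_union S : set pos := \bigcup_(i in [set` S]) fattened i.

Lemma measurable_coord (k : 'I_n) (J : interval R) :
  measurable [set x : pos | tnth x k \in J].
Proof.
rewrite -[X in measurable X]setTI.
exact: (measurable_tnth k measurableT (measurable_itv J)).
Qed.

Lemma measurable_coords (J : 'I_n -> interval R) :
  measurable [set x : pos | forall k, tnth x k \in J k].
Proof.
rewrite (_ : [set x | _] = \bigcap_(k in [set: 'I_n]) [set x : pos | tnth x k \in J k]).
  by apply: fin_bigcap_measurable => // k _; exact: measurable_coord.
by apply/seteqP; split => x h k; [move=> _|]; exact: h.
Qed.

Lemma measurable_centered_cube : measurable centered_cube.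
Proof.
rewrite (_ : centered_cube = [set x : pos | forall k, tnth x k \in `[- (2^-1 * L), 2^-1 * L]]).
  exact: measurable_coords.
by apply/seteqP; split => x h k; have := h k; rewrite in_itv/= ler_norml.
Qed.

Lemma measurable_block i : measurable (block i).
Proof.
rewrite (_ : block i = centered_cube `&`
    [set x : pos | forall k, tnth x k \in `[(i k)%:R - L / 2, (i k)%:R + 1 - L / 2[]).
  apply: measurableI; first exact: measurable_centered_cube.
  exact: measurable_coords.
apply/seteqP; split => x [xL h]; split => // k.
  by have := h k; rewrite in_itv/= lerBlDr ltrBrDr.
by have := h k; rewrite in_itv/= lerBlDr ltrBrDr.
Qed.

Lemma measurable_fattened i : measurable (fattened i).
Proof.
rewrite (_ : fattened i = [set x : pos | forall k,
    tnth x k \in `[(i k)%:R - r - L / 2, (i k)%:R + 1 + r - L / 2]]).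
  exact: measurable_coords.
apply/seteqP; split => x h k; have := h k; rewrite in_itv/= => /andP[h1 h2].
  by apply/andP; split; lra.
by apply/andP; split; lra.
Qed.

Lemma measurable_fattened_union S : measurable (fattened_union S).
Proof. by apply: fin_bigcup_measurable => // i _; exact: measurable_fattened. Qed.

Definition block_center i : pos := [tuple ((i k)%:R + 2^-1 - L / 2 : R) | k < n].

Lemma block_sub_cube i : block i `<=` cube (block_center i).
Proof.
move=> x [_ h] k; rewrite tnth_mktuple ler_norml.
by have /andP[h1 h2] := h k; apply/andP; split; lra.
Qed.

Lemma block_sub_fattened i : block i `<=` fattened i.
Proof.
move=> x [_ h] k; have /andP[h1 h2] := h k.
by apply/andP; split; move: r_ge0; lra.
Qed.

Lemma ebounded_block i : ebounded (block i).
Proof.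
have [a [s h]] := ebounded_cube (block_center i).
by exists a, s => x /block_sub_cube/h.
Qed.

Lemma ebounded_centered_cube : ebounded centered_cube.
Proof.
exists [tuple (0 : R) | k < n], (2^-1 * L * n%:R + 1) => x hx; rewrite /eball/=.
apply: le_lt_trans (_ : _ <= 2^-1 * L * n%:R) _; last by rewrite ltrDl.
by apply: dist_le => [|k]; [rewrite mulr_ge0|rewrite tnth_mktuple sub0r normrN].
Qed.

Lemma coord_le_dist x y k : `|tnth x k - tnth y k| <= dist x y.
Proof.
rewrite /dist -sqrtr_sqr; apply: ler_wsqrtr.
by rewrite (bigD1 k)//= lerDl sumr_ge0// => l _; exact: sqr_ge0.
Qed.

Lemma eball_sub_fattened i x : block i x -> eball x r `<=` fattened i.
Proof.
move=> [_ h] y xy k; have /andP[h1 h2] := h k.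
have := le_lt_trans (coord_le_dist x y k) xy.
by rewrite ltr_norml => /andP[h3 h4]; apply/andP; split; lra.
Qed.

(** Some coordinate of the indices differs by at least rho + 1. The width 1 of a block and the two
    margins [r] are lost, leaving rho - 2 r >= r. *)
Lemma fattened_set_dist (rho : nat) S T : 3 * r <= rho%:R ->
  (forall i j, i \in S -> j \in T -> j \notin block_nbhd rho i) ->
  (r%:E <= set_dist (fattened_union S) (fattened_union T))%E.
Proof.
move=> rrho far; apply: le_ereal_inf_tmp => _ [[x y] [[i /= iS xi] [j /= jT yj]] <-].
rewrite lee_fin/=; have := far i j iS jT.
rewrite inE negb_forall => /existsP[k]; rewrite -ltnNge => hk.
apply: le_trans (coord_le_dist x y k).
have /andP[x1 x2] := xi k; have /andP[y1 y2] := yj k.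
have : rho%:R + 1 <= `|(i k)%:R - (j k)%:R| :> R.
  rewrite natr1 -[X in _ <= X](_ : (`|(i k)%:Z - (j k)%:Z|%N)%:R = _) ?ler_nat//.
  by rewrite natr_absz intr_norm rmorphB.
have n1 := ler_norm (tnth x k - tnth y k).
have := ler_norm (- (tnth x k - tnth y k)); rewrite normrN => n2.
case: (leP 0 ((i k)%:R - (j k)%:R : R)) => h; last by rewrite ltr0_norm// => hh; lra.
by rewrite ger0_norm// => hh; lra.
Qed.

Lemma fattened_union_disjoint S T : 0 < r ->
  (r%:E <= set_dist (fattened_union S) (fattened_union T))%E ->
  fattened_union S `&` fattened_union T = set0.
Proof.
move=> r0 h; apply/seteqP; split => // x [xS xT].
have : (r%:E <= (dist x x)%:E)%E.
  by apply: le_trans h _; apply: ereal_inf_lbound; exists (x, x).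
rewrite lee_fin /dist big1 ?sqrtr0 ?leNgt ?r0// => k _.
by rewrite subrr expr0n.
Qed.

Lemma fattened_diam S (D : R) : n%:R * (m%:R + 2 * r) <= D ->
  (diam (fattened_union S) <= D%:E)%E.
Proof.
move=> hD; rewrite /diam ge_max; apply/andP; split.
  by rewrite lee_fin (le_trans _ hD)// mulr_ge0// addr_ge0// mulr_ge0.
apply: ge_ereal_sup => _ [[x y] [[i /= iS xi] [j /= jT yj]] <-].
rewrite lee_fin (le_trans _ hD)// mulrC; apply: dist_le => [|k /=].
  by rewrite addr_ge0// mulr_ge0.
have /andP[x1 x2] := xi k; have /andP[y1 y2] := yj k.
have im : (i k)%:R + 1 <= m%:R :> R by rewrite natr1 ler_nat.
have jm : (j k)%:R + 1 <= m%:R :> R by rewrite natr1 ler_nat.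
have i0 : 0 <= (i k)%:R :> R by [].
have j0 : 0 <= (j k)%:R :> R by [].
by rewrite ler_norml; apply/andP; split; lra.
Qed.

End blocks.

Section block_sums.
Context {R : realType} {n : nat} {dO dM : measure_display}
  {Omega : measurableType dO} {M : measurableType dM} {P : probability Omega R}.
Variables (m : nat) (L r : R).
Hypotheses (L_ge0 : 0 <= L) (L_lt : L < m%:R) (r_ge0 : 0 <= r).
Local Notation conf := (mconf R n M).
Local Notation pt := ((Rvec R n * M) * conf)%type.
Local Notation index := {ffun 'I_n -> 'I_m}.

Lemma block_unique (x : Rvec R n) : centered_cube L x ->
  exists i : index, forall j : index, (x \in block L j) = (j == i).
Proof.
move=> xL.
have x0 k : 0 <= tnth x k + L / 2.
  by have := xL k; rewrite ler_norml => /andP[h1 h2]; lra.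
have xm k : (Num.truncn (tnth x k + L / 2) < m)%N.
  rewrite truncn_lt_nat//; apply: le_lt_trans L_lt.
  by have := xL k; rewrite ler_norml => /andP[h1 h2]; lra.
exists [ffun k => Ordinal (xm k)] => j; apply/idP/eqP => [/set_mem[_ h]|->].
  apply/ffunP => k; apply/val_inj; rewrite ffunE/=.
  have := h k; rewrite natr1 => h'.
  by rewrite (truncn_def h').
apply/mem_set; split => // k; rewrite ffunE/= natr1; exact: truncn_itv.
Qed.

Lemma psum_blocks (g : pt -> R) (Y : conf) :
  psum (centered_cube L) g Y = \sum_(i : index) psum (block L i) g Y.
Proof.
have fin := pts_finite Y (@ebounded_centered_cube R n L L_ge0).
have blockE i : psum (block L i) g Y =
    \sum_(p \in pts (centered_cube L) Y) (if p.1 \in block L i then g (p, Y) else 0).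
  rewrite /psum (_ : pts (block L i) Y = pts (centered_cube L) Y `&` (block L i `*` setT)).
    rewrite fsbig_mkcondr; apply: eq_fsbigr => p _.
    have [pi|pi] := boolP (p.1 \in block L i).
      by rewrite mem_set//; split => //; exact/set_mem.
    rewrite memNset// => -[pi' _]; move/negP: pi; apply; exact/mem_set.
  apply/seteqP; split => p /=; first by move=> [Yp [[xL h] _]].
  by move=> [[Yp [xL _]] h].
under eq_bigr do rewrite blockE fsbig_finite//.
rewrite exchange_big /psum fsbig_finite//=.
rewrite big_seq [RHS]big_seq; apply: eq_bigr => p.
rewrite in_fset_set// => /set_mem[_ [pL _]].
have [i iE] := block_unique pL.
rewrite (bigD1 i)//= iE eqxx big1 ?addr0// => j ji.
by rewrite iE (negbTE ji).
Qed.

Variables (X : {RV P >-> conf}) (xir : score_fun R n M) (lam : R).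
Hypothesis lam_gt0 : 0 < lam.
Hypothesis xir_short : short_range P X r xir.

Lemma is_local_block (i : index) (A : set (Rvec R n)) : fattened L r i `<=` A ->
  measurable (window lam : set (Rvec R n)) ->
  is_local X A (psum (block L i) (fun z => xir z.1 z.2 (window lam))).
Proof.
move=> iA mW; split.
  apply: measurable_psum; first exact: measurable_block.
    exact: ebounded_block.
  exact: (xir_short.1 _ mW).
have := xir_short.2 lam lam_gt0; apply: filterS => w h.
rewrite /psum (_ : pts (block L i) (restr A (X w)) = pts (block L i) (X w)); last first.
  apply/seteqP; split => p /=; first by move=> [[Xp _] Bp].
  move=> [Xp [Bp _]]; split => //; split => //; split => //.
  by apply: iA; exact: block_sub_fattened.
apply: eq_fsbigr => p /set_mem[Xp [Bp _]].
(* Restricting to any region that contains the ball does not change the score; this is used for [A]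
   and for the whole space. *)
have key C : eball p.1 r `<=` C ->
   xir p (restr C (X w)) (window lam) = xir p (restr (eball p.1 r) (X w)) (window lam).
  move=> pC; rewrite -(h p (restr (C `\` eball p.1 r) (X w)))//; last first.
    by move=> z /= [_ [[_ hz] _]].
  congr xir; apply: lfset_eq => /=.
  rewrite -setIUr; congr (_ `&` _); apply/seteqP; split => z /=.
    move=> [Cz _]; have [bz|bz] := pselect (eball p.1 r z.1); first by left.
    by right.
  by move=> [[bz _]|[[Cz _] _]]; split => //; exact: pC.
rewrite key; last by apply: subset_trans iA; exact: eball_sub_fattened.
rewrite -(key setT)//; congr xir; apply: lfset_eq => /=.
by rewrite setXTT setIT.
Qed.

End block_sums.

(** * Normal approximation on a fixed window *)

Section block_approximation.
Context {R : realType} {d} {T : measurableType d} (P : probability T R).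
Local Notation L1 := (L1 P).
Local Notation E := (Ex P).

Lemma expectationE (f : T -> R) : fine ('E_P[f])%E = E f.
Proof. by rewrite unlock. Qed.

Lemma L1_expectation (f : T -> R) : L1 f -> ('E_P[f])%E = (E f)%:E.
Proof.
by move=> fi; rewrite -expectationE fineK// unlock; exact: integrable_fin_num fi.
Qed.

Lemma varianceE_Ex (f : T -> R) :
  fine ('V_P[f])%E = E (fun w => (f w - E f) ^+ 2).
Proof.
by rewrite /variance covariance.unlock expectationE unlock; congr fine.
Qed.

(** [Hb] and [Ub] model the block sums of the score and of its estimator; [S], [S'] and [AD] are the
    block sums of absolute values of the score, of the estimator and of their difference. [Phi] is
    the stabilization error. *)
Variables (I : finType) (Hb Ub S S' AD : I -> T -> R) (N N' : I -> {set I}).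
Variables (M3 K Phi kappa e Lc : R).
Hypotheses (mH : forall i, measurable_fun setT (Hb i)).
Hypotheses (mU : forall i, measurable_fun setT (Ub i)).
Hypotheses (HS : forall i w, `|Hb i w| <= S i w).
Hypotheses (US : forall i w, `|Ub i w| <= S' i w).
Hypotheses (HUD : forall i w, `|Hb i w - Ub i w| <= AD i w).
Hypotheses (iS : forall i, L1 (fun w => S i w ^+ 3)).
Hypotheses (iS' : forall i, L1 (fun w => S' i w ^+ 3)).
Hypotheses (mS : forall i, measurable_fun setT (S i)).
Hypotheses (mS' : forall i, measurable_fun setT (S' i)).
Hypotheses (ES : forall i, E (fun w => S i w ^+ 3) <= M3).
Hypotheses (ES' : forall i, E (fun w => S' i w ^+ 3) <= M3).
Hypotheses (iD : forall i, L1 (AD i)) (ED : forall i, E (AD i) <= K * Phi).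
Hypotheses (iDS : forall i j, L1 (fun w => AD i w * S j w)).
Hypotheses (EDS : forall i j, E (fun w => AD i w * S j w) <= K * Phi).
Hypotheses (iDS' : forall i j, L1 (fun w => AD i w * S' j w)).
Hypotheses (EDS' : forall i j, E (fun w => AD i w * S' j w) <= K * Phi).
Hypotheses (N_le : forall i, #|N i|%:R <= kappa).
Hypotheses (N'_le : forall i, #|N' i|%:R <= kappa).
Hypothesis (Lc_ge1 : 1 <= Lc).

Let H w := \sum_i Hb i w.
Let V i w := Ub i w - E (Ub i).
Let sigma := Num.sqrt (fine ('V_P[H])%E).
Hypothesis sigma_ge1 : 1 <= sigma.
Let M := 4 * (M3 + (1 + M3) ^+ 3).
Let n : R := #|I|%:R.

Hypothesis decor1 : forall (f : R -> R) i, measurable_fun setT f ->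
  (forall x, `|f x| <= Lc) ->
  `|E (fun w => V i w * f ((\sum_j V j w - \sum_(j in N i) V j w) / sigma))| <= e.
Hypothesis decor2 : forall (f : R -> R) i, measurable_fun setT f ->
  (forall x, `|f x| <= Lc) ->
  `|E (fun w => V i w * (\sum_(j in N i) V j w) * f ((\sum_j V j w - \sum_(j in N' i) V j w) / sigma)) -
    E (fun w => V i w * (\sum_(j in N i) V j w)) *
    E (fun w => f ((\sum_j V j w - \sum_(j in N' i) V j w) / sigma))| <= e.
Hypothesis decor3 : forall i,
  `|E (fun w => V i w * (\sum_j V j w - \sum_(j in N i) V j w))| <= e.

Let S0 i w : 0 <= S i w. Proof. exact: le_trans (HS i w). Qed.
Let S'0 i w : 0 <= S' i w. Proof. exact: le_trans (US i w). Qed.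
Let AD0 i w : 0 <= AD i w. Proof. exact: le_trans (HUD i w). Qed.

Lemma L1_root3 (F : T -> R) : measurable_fun setT F -> (forall w, 0 <= F w) ->
  L1 (fun w => F w ^+ 3) -> L1 F /\ E F <= 1 + E (fun w => F w ^+ 3).
Proof.
move=> mF F0 iF.
have i1 : L1 (fun w => 1 + F w ^+ 3) by apply: L1D => //; exact: L1_cst.
have le w : F w <= 1 + F w ^+ 3.
  by have := norm_le_cube (F w); rewrite ger0_norm.
have iF1 : L1 F by apply: (L1_dom _ i1) => // w; rewrite ger0_norm.
split => //; have := Ex_le iF1 i1 le; rewrite ExD ?(Ex_cst P 1)//.
exact: L1_cst.
Qed.

Let iS1 i : L1 (S i) /\ E (S i) <= 1 + M3.
Proof.
have [h1 h2] := L1_root3 (mS i) (S0 i) (iS i).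
by split => //; apply: le_trans h2 _; rewrite lerD2l.
Qed.

Let iS'1 i : L1 (S' i) /\ E (S' i) <= 1 + M3.
Proof.
have [h1 h2] := L1_root3 (mS' i) (S'0 i) (iS' i).
by split => //; apply: le_trans h2 _; rewrite lerD2l.
Qed.

Let iU i : L1 (Ub i). Proof. by apply: (L1_dom _ (iS'1 i).1). Qed.
Let iH i : L1 (Hb i). Proof. by apply: (L1_dom _ (iS1 i).1). Qed.

Let mV i : measurable_fun setT (V i). Proof. exact: measurable_funB. Qed.

(** Convexity of the cube and |E U| <= 1 + M3 explain the form of [M]. *)
Lemma centered_moment i : L1 (fun w => `|V i w| ^+ 3) /\ E (fun w => `|V i w| ^+ 3) <= M.
Proof.
pose c := `|E (Ub i)|.
have M30 : 0 <= M3 by apply: le_trans (ES i); apply: Ex_ge0 => w; rewrite exprn_ge0.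
have c3 : c ^+ 3 <= (1 + M3) ^+ 3.
  have cle : c <= 1 + M3.
    apply: le_trans (iS'1 i).2; apply: Ex_norm_le => //; exact: (iS'1 i).1.
  by rewrite lerXn2r// nnegrE ?addr_ge0// normr_ge0.
have ib : L1 (fun w => 4 * (S' i w ^+ 3 + c ^+ 3)).
  by apply: L1Z; apply: L1D => //; exact: L1_cst.
have le w : `|V i w| ^+ 3 <= 4 * (S' i w ^+ 3 + c ^+ 3).
  apply: le_trans (cubeD_le (S'0 i w) (normr_ge0 _)).
  rewrite lerXn2r// ?nnegrE ?addr_ge0//.
  by rewrite /V (le_trans (ler_normB _ _))// lerD.
have iV3 : L1 (fun w => `|V i w| ^+ 3).
  apply: (L1_dom _ ib); first by apply: measurable_funX; exact: measurableT_comp.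
  by move=> w; rewrite ger0_norm// exprn_ge0.
split => //; apply: le_trans (Ex_le iV3 ib le) _.
rewrite ExZ; last by apply: L1D => //; exact: L1_cst.
rewrite ler_pM2l// ExD//; last exact: L1_cst.
by rewrite (Ex_cst P (c ^+ 3)) lerD.
Qed.

Let L1_sumI (F : I -> T -> R) : (forall i, L1 (F i)) -> L1 (fun w => \sum_i F i w).
Proof. by move=> h; exact: L1_sum. Qed.

Let Usum w := \sum_i Ub i w.
Let W w := \sum_i V i w.
Let Tot w := \sum_j (S j w + S' j w).
Let ADs w := \sum_i AD i w.

Let iHs : L1 H. Proof. exact: L1_sumI. Qed.
Let iUs : L1 Usum. Proof. exact: L1_sumI. Qed.
Let iAD : L1 ADs. Proof. exact: L1_sumI. Qed.
Let iTot : L1 Tot.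
Proof. by apply: L1_sumI => j; apply: L1D; [exact: (iS1 j).1|exact: (iS'1 j).1]. Qed.

Let WE w : W w = Usum w - E Usum.
Proof. by rewrite /W /V sumrB /Usum Ex_sum. Qed.

Let sum_const (c : R) : \sum_(i : I) c = n * c.
Proof. by rewrite sumr_const -[LHS]mulr_natl. Qed.

Let EAD : E ADs <= n * (K * Phi).
Proof. by rewrite Ex_sum// -sum_const; exact: ler_sum. Qed.

Let ETot : E Tot <= n * (2 * (1 + M3)).
Proof.
rewrite Ex_sum => [|j _]; last by apply: L1D; [exact: (iS1 j).1|exact: (iS'1 j).1].
rewrite -sum_const; apply: ler_sum => j _.
have [h1 h2] := iS1 j; have [h3 h4] := iS'1 j.
by rewrite ExD//; lra.
Qed.

Let iADT : L1 (fun w => ADs w * Tot w) /\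
  E (fun w => ADs w * Tot w) <= n * (n * (2 * (K * Phi))).
Proof.
have eqf : (fun w => ADs w * Tot w) =
    fun w => \sum_i \sum_j (AD i w * S j w + AD i w * S' j w).
  apply/funext => w; rewrite /ADs mulr_suml; apply: eq_bigr => i _.
  by rewrite mulr_sumr; apply: eq_bigr => j _; rewrite mulrDr.
have ij i j : L1 (fun w => AD i w * S j w + AD i w * S' j w) by exact: L1D.
have ii i : L1 (fun w => \sum_j (AD i w * S j w + AD i w * S' j w)) by exact: L1_sumI.
rewrite eqf; split; first exact: L1_sumI.
rewrite Ex_sum// -sum_const; apply: ler_sum => i _.
rewrite Ex_sum// -sum_const; apply: ler_sum => j _.
rewrite ExD//; have := EDS i j; have := EDS' i j; lra.
Qed.

Let HUle w : `|H w - Usum w| <= ADs w.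
Proof.
rewrite /H /Usum -sumrB (le_trans (ler_norm_sum _ _ _))//; exact: ler_sum.
Qed.

Let HUTot w : `|H w + Usum w| <= Tot w.
Proof.
rewrite /H /Usum -big_split (le_trans (ler_norm_sum _ _ _))//.
by apply: ler_sum => i _ /=; rewrite (le_trans (ler_normD _ _))// lerD.
Qed.

Let mUs : measurable_fun setT Usum. Proof. exact: L1_measurable iUs. Qed.
Let mHs : measurable_fun setT H. Proof. exact: L1_measurable iHs. Qed.

Let iF3 i : L1 (fun w => (S i w + S' i w) ^+ 3).
Proof.
have ib : L1 (fun w => 4 * (S i w ^+ 3 + S' i w ^+ 3)) by apply: L1Z; exact: L1D.
apply: (L1_dom _ ib); first by apply: measurable_funX; exact: measurable_funD.
by move=> w; rewrite ger0_norm ?cubeD_le// exprn_ge0// addr_ge0.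
Qed.

Let iTot2 : L1 (fun w => Tot w ^+ 2).
Proof.
have -> : (fun w => Tot w ^+ 2) =
    fun w => \sum_i \sum_j (S i w + S' i w) * (S j w + S' j w).
  apply/funext => w; rewrite expr2 /Tot mulr_suml; apply: eq_bigr => i _.
  by rewrite mulr_sumr.
apply: L1_sumI => i; apply: L1_sumI => j.
apply: (@L1_dom _ _ _ _ _ (fun w => (S i w + S' i w) ^+ 3 + (S j w + S' j w) ^+ 3 + 1)).
- by apply: measurable_funM; exact: measurable_funD.
- by apply: L1D; [exact: L1D|exact: L1_cst].
move=> w; rewrite normrM; have := normM_le_cube (S i w + S' i w) (S j w + S' j w).
by rewrite !(ger0_norm (addr_ge0 _ _)).
Qed.

Let Hle w : `|H w| <= Tot w.
Proof.
rewrite /H (le_trans (ler_norm_sum _ _ _))//; apply: ler_sum => i _.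
by rewrite (le_trans (HS i w))// lerDl.
Qed.

Let Ule w : `|Usum w| <= Tot w.
Proof.
rewrite /Usum (le_trans (ler_norm_sum _ _ _))//; apply: ler_sum => i _.
by rewrite (le_trans (US i w))// lerDr.
Qed.

Let iCentered2 (F : T -> R) c : measurable_fun setT F -> L1 F ->
  (forall w, `|F w| <= Tot w) -> L1 (fun w => (F w - c) ^+ 2).
Proof.
move=> mF iF FT.
have iF2 : L1 (fun w => F w ^+ 2).
  apply: (L1_dom _ iTot2); first exact: measurable_funX.
  by move=> w; rewrite normrX lerXn2r// nnegrE (le_trans _ (FT w)).
have -> : (fun w => (F w - c) ^+ 2) = fun w => F w ^+ 2 - (2 * c) * F w + c ^+ 2.
  by apply/funext => w; ring.
apply: L1D; last exact: L1_cst.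
by apply: L1B => //; exact: L1Z.
Qed.

Let sigma0 : 0 < sigma. Proof. exact: lt_le_trans sigma_ge1. Qed.

Let sigma2 : sigma ^+ 2 = E (fun w => (H w - E H) ^+ 2).
Proof.
rewrite /sigma sqr_sqrtr varianceE_Ex//.
by apply: Ex_ge0 => w; exact: sqr_ge0.
Qed.

(** The difference of the variances is E [(H - U)(H + U)] - E (H - U) (E H + E U). Each product runs
    over pairs of blocks, and every pair costs a multiple of [Phi]. *)
Lemma variance_error :
  `|E (fun w => W w ^+ 2) - sigma ^+ 2| <= 2 * n ^+ 2 * (K * Phi) * (2 + M3).
Proof.
have iH2 := iCentered2 (E H) mHs iHs Hle.
have iU2 := iCentered2 (E Usum) mUs iUs Ule.
rewrite sigma2 distrC.
have -> : E (fun w => W w ^+ 2) = E (fun w => (Usum w - E Usum) ^+ 2).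
  by congr Ex; apply/funext => w; rewrite WE.
rewrite -ExB//.
pose c := E H + E Usum.
have iHU : L1 (fun w => H w - Usum w) by exact: L1B.
have mTot : measurable_fun setT Tot by exact: L1_measurable iTot.
have iP : L1 (fun w => (H w - Usum w) * (H w + Usum w)).
  apply: (L1_dom _ iADT.1).
    by apply: measurable_funM; [exact: measurable_funB|exact: measurable_funD].
  by move=> w; rewrite normrM ler_pM.
have -> : E (fun w => (H w - E H) ^+ 2 - (Usum w - E Usum) ^+ 2) =
    E (fun w => (H w - Usum w) * (H w + Usum w)) - E (fun w => H w - Usum w) * c.
  have eqf : (fun w => (H w - E H) ^+ 2 - (Usum w - E Usum) ^+ 2) =
      fun w => (H w - Usum w) * (H w + Usum w) - (2 * E H) * H w + (2 * E Usum) * Usum w +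
        (E H ^+ 2 - E Usum ^+ 2).
    by apply/funext => w; ring.
  have i1 : L1 (fun w => 2 * E H * H w) by exact: L1Z.
  have i2 : L1 (fun w => 2 * E Usum * Usum w) by exact: L1Z.
  have i3 := L1B iP i1; have i4 := L1D i3 i2.
  rewrite eqf ExD//; last exact: L1_cst.
  rewrite ExD// ExB// !ExZ// (Ex_cst P (E H ^+ 2 - E Usum ^+ 2)) ExB// /c.
  ring.
have Ec : `|c| <= n * (2 * (1 + M3)).
  apply: le_trans ETot; rewrite /c -ExD//.
  by apply: Ex_norm_le => //; exact: L1D.
rewrite (le_trans (ler_normB _ _))//.
have b1 : `|E (fun w => (H w - Usum w) * (H w + Usum w))| <= n * (n * (2 * (K * Phi))).
  apply: le_trans iADT.2; apply: Ex_norm_le => //; first exact: iADT.1.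
  by move=> w; rewrite normrM ler_pM.
have b2 : `|E (fun w => H w - Usum w) * c| <= n * (K * Phi) * (n * (2 * (1 + M3))).
  rewrite normrM ler_pM//; apply: le_trans EAD; exact: Ex_norm_le.
apply: le_trans (lerD b1 b2) _.
by rewrite le_eqVlt; apply/orP; left; apply/eqP; ring.
Qed.

(** Both sums are divided by the same [sigma], so only H - U and its mean matter, each at most the
    sum of the [AD i] in mean. *)
Lemma standardize_error (h : R -> R) : lipschitz1 h ->
  L1 (h \o standardize P H) /\ L1 (h \o (fun w => W w / sigma)) /\
  `|E (h \o standardize P H) - E (h \o (fun w => W w / sigma))| <= 2 * n * (K * Phi) / sigma.
Proof.
move=> hl.
have mh : measurable_fun setT h by exact: continuous_measurable_fun (lipschitz1_continuous hl).
have iLip (F : T -> R) : L1 F -> L1 (h \o F).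
  move=> iF; have iB : L1 (fun w => `|F w| + `|h 0|) by apply: L1D; [exact: L1_norm|exact: L1_cst].
  apply: (L1_dom _ iB); first by apply: measurableT_comp => //; exact: L1_measurable iF.
  move=> w /=; rewrite -[h (F w)](subrK (h 0)) (le_trans (ler_normD _ _))// lerD2r.
  by rewrite -[X in _ <= `|X|]subr0.
have stE : standardize P H = fun w => sigma^-1 * (H w - E H).
  by apply/funext => w; rewrite /standardize expectationE mulrC.
have iW : L1 (fun w => W w / sigma).
  have -> : (fun w => W w / sigma) = fun w => sigma^-1 * (Usum w - E Usum).
    by apply/funext => w; rewrite WE mulrC.
  by apply: L1Z; apply: L1B => //; exact: L1_cst.
have iSt : L1 (standardize P H).
  by rewrite stE; apply: L1Z; apply: L1B => //; exact: L1_cst.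
split; first exact: iLip. split; first exact: iLip.
rewrite -ExB; [|exact: iLip|exact: iLip].
have si0 : 0 <= sigma^-1 by rewrite invr_ge0 ltW.
have iB : L1 (fun w => sigma^-1 * (ADs w + E ADs)).
  by apply: L1Z; apply: L1D => //; exact: L1_cst.
have bnd w : `|(h \o standardize P H) w - (h \o (fun w => W w / sigma)) w| <=
    sigma^-1 * (ADs w + E ADs).
  rewrite /= (le_trans (hl _ _))// stE WE [X in _ - X]mulrC -mulrBr normrM (ger0_norm si0).
  rewrite ler_wpM2l// (_ : _ - _ = (H w - Usum w) - E (fun w => H w - Usum w)); last first.
    by rewrite ExB//; ring.
  rewrite (le_trans (ler_normB _ _))// lerD//.
  by apply: Ex_norm_le => //; exact: L1B.
apply: le_trans (Ex_norm_le _ iB bnd) _.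
  by apply: L1B; exact: iLip.
rewrite ExZ; last by apply: L1D => //; exact: L1_cst.
rewrite ExD ?(Ex_cst P (E ADs))//; last exact: L1_cst.
rewrite mulrC ler_wpM2r//; have := EAD; lra.
Qed.

Lemma dissociated_dW {dZ} {OmegaZ : measurableType dZ} (PZ : probability OmegaZ R)
    (Z : {RV PZ >-> R}) :
  stein_bounded PZ Z Lc ->
  0 <= e -> 1 <= M3 ->
  (dW P (standardize P H) PZ Z <=
    (2 * n * (K * Phi) / sigma +
     Lc * (2 * n ^+ 2 * (K * Phi) * (2 + M3)) / sigma ^+ 2 +
     (Lc + 2) * n * e +
     n * (12 * Lc * kappa ^+ 2 * M ^+ 2) / sigma ^+ 3)%:E)%E.
Proof.
move=> stein e0 M31.
apply: ge_ereal_sup => _ [h hl <-].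
have [ihZ [f [f' [df f'E fL f'L f'lip]]]] := stein h hl.
have [ih [ihW hHW]] := standardize_error hl.
have L0 : 0 <= Lc by exact: le_trans Lc_ge1.
have mf : measurable_fun setT f.
  apply: continuous_measurable_fun => x; apply/differentiable_continuous/derivable1_diffP.
  by apply: ex_derive; exact: df.
have mf' : measurable_fun setT f'.
  have -> : f' = fun x => x * f x + (h x - fine ('E_PZ[h \o Z])%E) by apply/funext.
  apply: measurable_funD; first exact: measurable_funM.
  by apply: measurable_funB => //; exact: continuous_measurable_fun (lipschitz1_continuous hl).
have M1 : 1 <= M.
  rewrite /M; have : 0 <= (1 + M3) ^+ 3 by rewrite exprn_ge0// addr_ge0// (le_trans _ M31).
  lra.
have key := stein_dissociated mV (fun i => (centered_moment i).1) (fun i => (centered_moment i).2)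
  M1 N_le N'_le sigma0 L0 df fL f'L f'lip (fun i => decor1 i mf fL)
  (fun i => decor2 i mf' f'L) decor3 variance_error.
(* Stein's equation evaluated at W / sigma. *)
have keyE : E (fun w => f' (W w / sigma) - W w / sigma * f (W w / sigma)) =
    E (h \o (fun w => W w / sigma)) - fine ('E_PZ[h \o Z])%E.
  rewrite -[X in _ = _ - X](Ex_cst P) -ExB//; last exact: L1_cst.
  by congr Ex; apply/funext => w; rewrite f'E /=; ring.
rewrite keyE in key.
have EZ : ('E_PZ[h \o Z])%E = (fine ('E_PZ[h \o Z])%E)%:E.
  by rewrite fineK// unlock; exact: integrable_fin_num ihZ.
rewrite L1_expectation// EZ -EFinB abse_EFin lee_fin.
rewrite -(subrKA (E (h \o (fun w => W w / sigma)))) (le_trans (ler_normD _ _))//.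
apply: le_trans (lerD hHW key) _.
rewrite -/n -!addrA lerD2l.
(* As sigma >= 1, the decorrelation errors may drop their powers of 1 / sigma. *)
have s1 : 1 <= sigma ^+ 2 by rewrite exprn_ege1.
have s2 : 0 < sigma ^+ 2 by exact: lt_le_trans s1.
have n0 : 0 <= n by rewrite /n.
have es : e / sigma <= e by rewrite ler_pdivrMr// ler_peMr.
have es2 : e / sigma ^+ 2 <= e by rewrite ler_pdivrMr// ler_peMr.
set c := 12 * Lc * kappa ^+ 2 * M ^+ 2.
have -> : n * (e / sigma + (e / sigma ^+ 2 + c / sigma ^+ 3)) =
  n * (e / sigma) + n * (e / sigma ^+ 2) + n * c / sigma ^+ 3 by ring.
set e' := 2 * n ^+ 2 * _ * _.
have -> : Lc * (e' + n * e) / sigma ^+ 2 = Lc * e' / sigma ^+ 2 + Lc * (n * (e / sigma ^+ 2)) by ring.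
have h1 : n * (e / sigma) <= n * e by rewrite ler_wpM2l.
have h2 : n * (e / sigma ^+ 2) <= n * e by rewrite ler_wpM2l.
have h3 : Lc * (n * (e / sigma ^+ 2)) <= Lc * (n * e) by rewrite ler_wpM2l.
have -> : (Lc + 2) * n * e = Lc * (n * e) + n * e + n * e by ring.
lra.
Qed.

End block_approximation.

(** * Application to the blocks of one window *)

Section fixed_window.
Context {R : realType} {n : nat} {dO dM : measure_display}
  {Omega : measurableType dO} {M : measurableType dM} {P : probability Omega R}.
Context (X : {RV P >-> mconf R n M}).
Hypothesis X_marks : {ae P, forall w, unique_marks (X w)}.
Hypothesis X_stationary : stationary P (fun w => ground (X w)).
Context (mu : R) (mu_gt0 : 0 < mu).
Context (palm : R.-pker (Rvec R n) ~> (M * mconf R n M)%type).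
Hypothesis palmP : is_palm P X mu palm.
Context (p1 p : R) (p1_ge2 : 2 <= p1) (p_ge1 : 1 <= p).
Hypothesis X_moment : point_moment P (fun w => ground (X w)) p1.
Local Notation q := (p1 * p / (p1 + p - 1)).
Hypothesis q_ge3 : 3 <= q.
Local Notation pt := ((Rvec R n * M) * mconf R n M)%type.
Local Notation conf := (mconf R n M).
Local Notation cm := (@count_moment R n dO dM Omega M P X p1).

Variables (xi xir : score_fun R n M) (lam r C Phi s delta Lc : R) (rho : nat).
Hypotheses (xi_meas : measurable_score xi) (xir_short : short_range P X r xir).
Hypotheses (lam_gt0 : 0 < lam) (r_gt0 : 0 < r) (C_ge0 : 0 <= C) (Phi_gt0 : 0 < Phi).
Local Notation W := (@window R n lam).
Hypothesis xiC : forall x, W x ->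
  (\int[palm x]_y (`|xi (x, y.1) y.2 W| `^ p)%:E <= C%:E)%E.
Hypothesis xirC : forall x, W x ->
  (\int[palm x]_y (`|xir (x, y.1) y.2 W| `^ p)%:E <= C%:E)%E.
Hypotheses (s_gt1 : 1 < s) (sq : s / (s - 1) <= q / 2).
Hypothesis xiPhi : forall x, W x ->
  (\int[palm x]_y (`|xi (x, y.1) y.2 W - xir (x, y.1) y.2 W| `^ s)%:E <= (Phi `^ s)%:E)%E.
Hypothesis r_rho : 3 * r <= rho%:R.

Local Notation L := (lam `^ n%:R^-1).
Local Notation m := (Num.truncn L).+1.
Local Notation index := {ffun 'I_n -> 'I_m}.

Hypotheses (delta_gt0 : 0 < delta) (Lc_ge1 : 1 <= Lc).
Hypothesis tv : forall S T : {set index},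
  (forall i j, i \in S -> j \in T -> j \notin block_nbhd rho i) ->
  (dTV (pushforward P (restr (fattened_union L r S `|` fattened_union L r T) \o X))
     (pushforward (P \x P) (fun w => cunion
        (restr (fattened_union L r S) (X w.1))
        (restr (fattened_union L r T) (X w.2)))) <= (delta ^+ 3)%:E)%E.

Let L0 : 0 <= L. Proof. exact: powR_ge0. Qed.
Let Lm : L < m%:R. Proof. exact: truncnS_gt. Qed.
Let r0 : 0 <= r. Proof. exact: ltW. Qed.

Let gx (z : pt) : R := xi z.1 z.2 W.
Let gr (z : pt) : R := xir z.1 z.2 W.
Let mW : measurable W. Proof. exact: measurable_centered_cube. Qed.
Let mgx : measurable_fun setT gx. Proof. exact: (xi_meas mW). Qed.
Let mgr : measurable_fun setT gr. Proof. exact: (xir_short.1 _ mW). Qed.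
Let mgd : measurable_fun setT (fun z => gx z - gr z).
Proof. exact: measurable_funB. Qed.

Let B (i : index) := block L i.
Let mB i : measurable (B i). Proof. exact: measurable_block. Qed.
Let bB i : ebounded (B i). Proof. exact: ebounded_block. Qed.
Let Bc i : B i `<=` cube (block_center L i). Proof. exact: block_sub_cube. Qed.
Let BW i : B i `<=` W. Proof. by move=> x []. Qed.

Let Hb i w := psum (B i) gx (X w).
Let Ub i w := psum (B i) gr (X w).
Let Sx i w := psum (B i) (fun z => `|gx z|) (X w).
Let Sr i w := psum (B i) (fun z => `|gr z|) (X w).
Let AD i w := psum (B i) (fun z => `|gx z - gr z|) (X w).

Definition block_q_moment : R := 2 `^ q * (cm + mu * C).
Local Notation A := block_q_moment.

Let mpsum i (g : pt -> R) : measurable_fun setT g ->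
  measurable_fun setT (fun w => psum (B i) g (X w)).
Proof. by move=> mg; apply: measurableT_comp => //; exact: measurable_psum. Qed.

Let Sxq i : L1 P (fun w => Sx i w `^ q) /\ Ex P (fun w => Sx i w `^ q) <= A.
Proof.
apply: (block_moment X_marks X_stationary mu_gt0 palmP p1_ge2 p_ge1 X_moment (mB i) (@Bc i) mgx C_ge0).
by move=> x /BW; exact: xiC.
Qed.

Let Srq i : L1 P (fun w => Sr i w `^ q) /\ Ex P (fun w => Sr i w `^ q) <= A.
Proof.
apply: (block_moment X_marks X_stationary mu_gt0 palmP p1_ge2 p_ge1 X_moment (mB i) (@Bc i) mgr C_ge0).
by move=> x /BW; exact: xirC.
Qed.

Let psum_norm_ge0 i (g : pt -> R) w : 0 <= psum (B i) (fun z => `|g z|) (X w).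
Proof. by apply: fsumr_ge0 => z _. Qed.

Let cube_of_q (F : Omega -> R) : measurable_fun setT F -> (forall w, 0 <= F w) ->
  L1 P (fun w => F w `^ q) -> Ex P (fun w => F w `^ q) <= A ->
  L1 P (fun w => F w ^+ 3) /\ Ex P (fun w => F w ^+ 3) <= 1 + A.
Proof.
move=> mF F0 iF EF.
have i1 : L1 P (fun w => 1 + F w `^ q) by apply: L1D => //; exact: L1_cst.
have le w : F w ^+ 3 <= 1 + F w `^ q by rewrite -powR_mulrn// powR_le1D.
have i3 : L1 P (fun w => F w ^+ 3).
  apply: (L1_dom _ i1); first exact: measurable_funX.
  by move=> w; rewrite ger0_norm// exprn_ge0.
split => //; apply: le_trans (Ex_le i3 i1 le) _.
by rewrite ExD ?(Ex_cst P 1)// ?lerD2l//; exact: L1_cst.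
Qed.

Let mabs (g : pt -> R) : measurable_fun setT g -> measurable_fun setT (fun z => `|g z|).
Proof. by move=> mg; exact: measurableT_comp. Qed.

Let A0 (i : index) : 0 <= A.
Proof. by apply: le_trans (Sxq i).2; apply: Ex_ge0 => w; exact: powR_ge0. Qed.

Let cm0 : 0 <= cm.
Proof. by apply: fine_ge0; apply: integral_ge0 => w _; rewrite lee_fin powR_ge0. Qed.

(** The constant of [block_error]; [1 + A] covers both choices of [Y], a block sum and the constant
    1. *)
Let K : R := mu + 2 * cm + 1 + A.

Let AD_Y i (Y : Omega -> R) : measurable_fun setT Y -> (forall w, 0 <= Y w) ->
  L1 P (fun w => Y w `^ q) -> Ex P (fun w => Y w `^ q) <= 1 + A ->
  L1 P (fun w => AD i w * Y w) /\ Ex P (fun w => AD i w * Y w) <= K * Phi.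
Proof.
move=> mY Y0 iY EY.
have [h1 h2] := block_error X_marks X_stationary mu_gt0 palmP p1_ge2 X_moment
  (mB i) (@Bc i) mgd Phi_gt0 s_gt1 sq (fun x Bx => xiPhi (BW Bx)) mY Y0 iY.
split => //; apply: le_trans h2 _.
by rewrite mulrC ler_wpM2r ?(ltW Phi_gt0)// /K -(addrA _ 1) lerD2l.
Qed.

Let AD1 i : L1 P (AD i) /\ Ex P (AD i) <= K * Phi.
Proof.
have i1 : L1 P (fun w : Omega => (cst 1 w : R) `^ q).
  rewrite (_ : (fun w : Omega => _) = cst 1); first exact: L1_cst.
  by apply/funext => w; rewrite powR1.
have E1 : Ex P (fun w : Omega => (cst 1 w : R) `^ q) <= 1 + A.
  rewrite (_ : (fun w : Omega => _) = cst 1); last by apply/funext => w; rewrite powR1.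
  by rewrite Ex_cst lerDl (A0 i).
have [] := @AD_Y i (cst 1) (measurable_cst _) (fun=> ler01) i1 E1.
rewrite (_ : (fun w => AD i w * cst 1 w) = AD i)//.
by apply/funext => w; rewrite mulr1.
Qed.

Let le_psum i (g h : pt -> R) (k : pt -> R) w :
  (forall z, `|g z - h z| <= k z) ->
  `|psum (B i) g (X w) - psum (B i) h (X w)| <= psum (B i) k (X w).
Proof.
move=> gh; have fin := pts_finite (X w) (bB i).
rewrite /psum !(fsbig_finite _ _ fin)/= -sumrB (le_trans (ler_norm_sum _ _ _))//.
by apply: ler_sum => z _; exact: gh.
Qed.

Let norm_psum i (g : pt -> R) w :
  `|psum (B i) g (X w)| <= psum (B i) (fun z => `|g z|) (X w).
Proof.
have fin := pts_finite (X w) (bB i).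
by rewrite /psum !(fsbig_finite _ _ fin)/= ler_norm_sum.
Qed.

Let M3 : R := 1 + A.
Let MM : R := 4 * (M3 + (1 + M3) ^+ 3).
Let N : R := #|{: index}|%:R.

Let Vf i (Y : conf) := psum (B i) gr Y - Ex P (Ub i).
Let sS (S : {set index}) (Y : conf) := \sum_(j in S) `|Vf j Y|.

Let local_Vf (S : {set index}) i : i \in S -> is_local X (fattened_union L r S) (Vf i).
Proof.
move=> iS; apply: is_localD; last exact: is_local_cst.
apply: (is_local_block r0 lam_gt0 xir_short _ mW).
by move=> x xi'; exists i.
Qed.

Let local_sS S : is_local X (fattened_union L r S) (sS S).
Proof.
apply: is_local_sum => i iS.
by apply: (is_local_comp _ (local_Vf iS)); exact: normr_measurable.
Qed.

Let Sx3 i := cube_of_q (mpsum i (mabs mgx)) (psum_norm_ge0 i gx) (Sxq i).1 (Sxq i).2.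
Let Sr3 i := cube_of_q (mpsum i (mabs mgr)) (psum_norm_ge0 i gr) (Srq i).1 (Srq i).2.

Let mUb i : measurable_fun setT (Ub i). Proof. exact: mpsum. Qed.

Let V3 i : L1 P (fun w => `|Vf i (X w)| ^+ 3) /\ Ex P (fun w => `|Vf i (X w)| ^+ 3) <= MM.
Proof.
exact: (@centered_moment _ _ _ P _ Hb Ub Sx Sr M3 mUb (fun i w => norm_psum i gx w)
  (fun i w => norm_psum i gr w) (fun i => (Sr3 i).1) (fun i => mpsum i (mabs mgr))
  (fun i => (Sx3 i).2) (fun i => (Sr3 i).2) i).
Qed.

Let MM0 (i : index) : 0 <= MM.
Proof. by apply: le_trans (V3 i).2; apply: Ex_ge0 => w; rewrite exprn_ge0. Qed.

Let Q (Y : conf) := \sum_i `|Vf i Y| ^+ 3.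

(** Expanding the cube gives [N ^+ 3] products, each at most [3 * Q Y]. The bound is crude but does
    not depend on [S]. *)
Let sS_cube S Y : sS S Y ^+ 3 <= 3 * N ^+ 3 * Q Y.
Proof.
have Q0 : 0 <= Q Y by apply: sumr_ge0 => i _; rewrite exprn_ge0.
have leQ i : `|Vf i Y| ^+ 3 <= Q Y.
  by rewrite /Q (bigD1 i)//= lerDl sumr_ge0// => j _; rewrite exprn_ge0.
have sall : sS S Y <= \sum_i `|Vf i Y|.
  by rewrite /sS big_mkcond/=; apply: ler_sum => i _; case: ifP.
have s0 : 0 <= sS S Y by apply: sumr_ge0.
have Nsum c : \sum_(i : index) c = N * c by rewrite sumr_const -[LHS]mulr_natl.
apply: le_trans (_ : (\sum_i `|Vf i Y|) ^+ 3 <= _).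
  by rewrite lerXn2r// nnegrE// (le_trans s0).
rewrite !exprS expr0 mulr1.
rewrite (_ : 3 * _ * _ = N * (N * (N * (3 * Q Y)))); last by ring.
rewrite -!Nsum big_distrl/=; apply: ler_sum => i _.
rewrite big_distrl big_distrr/=; apply: ler_sum => j _.
rewrite mulrA big_distrr/=; apply: ler_sum => k _.
apply: le_trans (normM3_le_cube _ _ _) _.
rewrite (_ : 3 * Q Y = Q Y + Q Y + Q Y); first by rewrite !lerD.
by move: (Q Y) => x; ring.
Qed.

Let iQ : L1 P (Q \o X) /\ Ex P (Q \o X) <= N * MM.
Proof.
split; first by apply: L1_sum => i _; exact: (V3 i).1.
rewrite /Q /comp Ex_sum => [|i _]; last exact: (V3 i).1.
apply: le_trans (_ : \sum_(i : index) MM <= _).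
  by apply: ler_sum => i _; exact: (V3 i).2.
by rewrite sumr_const -[leLHS]mulr_natl.
Qed.

(** One local majorant for all the functionals to be decorrelated: [sS S] dominates the sums over
    [S], while the constant and the factor [Lc] dominate the bounded functions supplied by Stein's
    equation. *)
Let aS S (Y : conf) := Lc * (1 + sS S Y).

Let Lc0 : 0 <= Lc. Proof. exact: le_trans Lc_ge1. Qed.

Let sS0 S Y : 0 <= sS S Y. Proof. by apply: sumr_ge0. Qed.

Let aS0 S Y : 0 <= aS S Y.
Proof. by rewrite mulr_ge0// addr_ge0// sS0. Qed.

Let local_aS S : is_local X (fattened_union L r S) (aS S).
Proof.
apply: is_localM; first exact: is_local_cst.
by apply: is_localD; [exact: is_local_cst|exact: local_sS].
Qed.

Let aS3 S : L1 P (fun w => aS S (X w) ^+ 3) /\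
  Ex P (fun w => aS S (X w) ^+ 3) <= 4 * Lc ^+ 3 * (1 + 3 * N ^+ 4 * MM).
Proof.
have [iQ1 EQ] := iQ.
have ib : L1 P (fun w => 4 * Lc ^+ 3 * (1 + 3 * N ^+ 3 * Q (X w))).
  by apply: L1Z; apply: L1D; [exact: L1_cst|exact: L1Z].
have L30 : 0 <= Lc ^+ 3 by rewrite exprn_ge0.
have le w : aS S (X w) ^+ 3 <= 4 * Lc ^+ 3 * (1 + 3 * N ^+ 3 * Q (X w)).
  rewrite /aS exprMn (_ : 4 * _ * _ = Lc ^+ 3 * (4 * (1 + 3 * N ^+ 3 * Q (X w)))); last first.
    by rewrite (mulrC 4) -(mulrA (Lc ^+ 3)).
  apply: (ler_wpM2l L30).
  apply: le_trans (cubeD_le ler01 (sS0 S (X w))) _.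
  by rewrite ler_pM2l// expr1n lerD2l sS_cube.
have mS := is_local_measurable (local_aS S).
have i3 : L1 P (fun w => aS S (X w) ^+ 3).
  apply: (L1_dom _ ib); first exact: measurable_funX.
  by move=> w; rewrite ger0_norm ?exprn_ge0// aS0.
split => //; apply: le_trans (Ex_le i3 ib le) _.
have iQ3 : L1 P (fun w => 3 * N ^+ 3 * Q (X w)) by exact: L1Z.
rewrite ExZ; last by apply: L1D => //; exact: L1_cst.
rewrite ler_wpM2l ?mulr_ge0// ExD ?(Ex_cst P 1)//; last exact: L1_cst.
rewrite ExZ// lerD2l (_ : 3 * N ^+ 4 * MM = 3 * N ^+ 3 * (N * MM)); last by ring.
by rewrite ler_wpM2l// mulr_ge0// exprn_ge0.
Qed.

Let e := delta * (2 + 64 * Lc ^+ 3 * (1 + 3 * N ^+ 4 * MM)).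

Let decor_blocks (S T : {set index}) (u v : conf -> R) :
  (forall i j, i \in S -> j \in T -> j \notin block_nbhd rho i) ->
  is_local X (fattened_union L r S) u -> is_local X (fattened_union L r T) v ->
  (forall Y Y', `|u Y * v Y'| <= (aS S Y + aS T Y') ^+ 2) ->
  L1 P (u \o X) -> L1 P (v \o X) ->
  `|Ex P (fun w => u (X w) * v (X w)) - Ex P (u \o X) * Ex P (v \o X)| <= e.
Proof.
move=> far lu lv uv iu iv.
have dj : fattened_union L r S `&` fattened_union L r T = set0.
  by apply: fattened_union_disjoint r_gt0 _; apply: fattened_set_dist r_rho far.
have mf (S' : {set index}) : measurable (fattened_union L r S') by exact: measurable_fattened_union.
apply: le_trans (decor_local (mf S) (mf T) delta_gt0 dj (tv far) lu lv (local_aS S) (local_aS T)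
  (aS0 S) (aS0 T) uv iu iv (aS3 S).1 (aS3 T).1) _.
rewrite /e ler_pM2l// lerD2l.
rewrite (_ : 64 * _ * _ = 8 * (4 * Lc ^+ 3 * (1 + 3 * N ^+ 4 * MM) +
  4 * Lc ^+ 3 * (1 + 3 * N ^+ 4 * MM))); last by move: MM N => x y; ring.
by rewrite ler_pM2l// lerD// ?(aS3 S).2 ?(aS3 T).2.
Qed.

Let iV i : L1 P (fun w => Vf i (X w)).
Proof.
have ib : L1 P (fun w => 1 + `|Vf i (X w)| ^+ 3).
  by apply: L1D; [exact: L1_cst|exact: (V3 i).1].
apply: (L1_dom _ ib); last by move=> w; exact: norm_le_cube.
by apply: measurable_funB => //; exact: mUb.
Qed.

Let EV i : Ex P (fun w => Vf i (X w)) = 0.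
Proof.
have iU : L1 P (Ub i).
  rewrite (_ : Ub i = fun w => Vf i (X w) + Ex P (Ub i)).
    by apply: L1D => //; exact: L1_cst.
  by apply/funext => w; rewrite /Vf subrK.
by rewrite /Vf ExB ?(Ex_cst P (Ex P (Ub i))) ?subrr//; exact: L1_cst.
Qed.

Let sumC (S : {set index}) Y : \sum_j Vf j Y - \sum_(j in S) Vf j Y = \sum_(j in ~: S) Vf j Y.
Proof.
rewrite (bigID (mem S))/= addrC addrK; apply: eq_bigl => j.
by rewrite inE.
Qed.

Let le_sS (S : {set index}) i Y : i \in S -> `|Vf i Y| <= sS S Y.
Proof. by move=> iS; rewrite /sS (bigD1 i)//= lerDl sumr_ge0. Qed.

Let norm_sumV (S : {set index}) Y : `|\sum_(j in S) Vf j Y| <= sS S Y.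
Proof. exact: ler_norm_sum. Qed.

Let local_sumV (S : {set index}) :
  is_local X (fattened_union L r S) (fun Y => \sum_(j in S) Vf j Y).
Proof. by apply: is_local_sum => j jS; exact: local_Vf. Qed.

Let nbhd_refl (i : index) : i \in block_nbhd rho i.
Proof. by rewrite inE; apply/forallP => l; rewrite subrr. Qed.

Let prod_iV i j : L1 P (fun w => Vf i (X w) * Vf j (X w)).
Proof.
apply: (@L1_prod2 _ _ _ P _ (fun i w => Vf i (X w))) => [k|k]; last exact: (V3 k).1.
exact: L1_measurable (iV k).
Qed.

(** For V_i times a function bounded by [Lc]: the base is at least 1, so squaring enlarges it. *)
Let sq_bound (x y : R) : 0 <= x -> 0 <= y -> Lc * x <= (Lc * (1 + x) + y) ^+ 2.
Proof.
move=> x0 y0; have L1 := Lc_ge1.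
have h0 : 0 <= Lc * x by rewrite mulr_ge0.
have h1 : 1 <= Lc * (1 + x) + y by rewrite mulrDr; lra.
apply: le_trans (_ : Lc * (1 + x) + y <= _); first by rewrite mulrDr; lra.
by rewrite expr2 ler_peMr// (le_trans ler01).
Qed.

(** For V_i eta_i times a function bounded by [Lc]. *)
Let sq_bound2 (x y : R) : 0 <= x -> 0 <= y -> Lc * x ^+ 2 <= (Lc * (1 + x) + y) ^+ 2.
Proof.
move=> x0 y0; have L1 := Lc_ge1.
have h0 : 0 <= Lc * x by rewrite mulr_ge0.
apply: le_trans (_ : (Lc * x) ^+ 2 <= _).
  by rewrite exprMn ler_wpM2r ?sqr_ge0// expr2 ler_peMr.
by rewrite lerXn2r ?nnegrE//; rewrite mulrDr; lra.
Qed.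

(** For V_i times the sum over the blocks far from i. *)
Let mul_bound (x y : R) : 0 <= x -> 0 <= y ->
  x * y <= (Lc * (1 + x) + Lc * (1 + y)) ^+ 2.
Proof.
move=> x0 y0; have L1 := Lc_ge1.
have hx : x <= Lc * (1 + x).
  by apply: le_trans (_ : 1 + x <= _); [rewrite lerDr|rewrite ler_peMl// addr_ge0].
have hy : y <= Lc * (1 + y).
  by apply: le_trans (_ : 1 + y <= _); [rewrite lerDr|rewrite ler_peMl// addr_ge0].
apply: le_trans (_ : (x + y) ^+ 2 <= _); last first.
  by rewrite lerXn2r ?nnegrE ?addr_ge0 ?lerD// (le_trans _ hx, le_trans _ hy).
nra.
Qed.

Let HbE : Hsum X xi lam = fun w => \sum_(i : index) Hb i w.
Proof. by apply/funext => w; exact: (psum_blocks L0 Lm gx (X w)). Qed.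

(** [sigma] is defined through [fine], which sends an infinite variance to 0; finiteness makes the
    assumed lower bound on the variance usable for [sigma]. *)
Lemma fixed_window_variance : ('V_P[Hsum X xi lam] < +oo)%E.
Proof.
have mH i : measurable_fun setT (Hb i) by exact: mpsum.
have iH3 i : L1 P (fun w => `|Hb i w| ^+ 3).
  apply: (L1_dom _ (Sx3 i).1).
    by apply: measurable_funX; exact: measurableT_comp.
  move=> w; rewrite ger0_norm ?exprn_ge0//.
  by rewrite lerXn2r// ?nnegrE// ?norm_psum// (le_trans _ (norm_psum i gx w)).
have iHH i j : L1 P (fun w => Hb i w * Hb j w) by exact: (@L1_prod2 _ _ _ P _ Hb).
have iH i : L1 P (Hb i).
  have i1 : L1 P (fun w => 1 + `|Hb i w| ^+ 3) by apply: L1D => //; exact: L1_cst.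
  by apply: (L1_dom (mH i) i1) => w; exact: norm_le_cube.
rewrite /variance covariance.unlock unlock HbE.
set c := fine _; pose g w := \sum_(i : index) \sum_(j : index) Hb i w * Hb j w +
  (- (2 * c)) * (\sum_(i : index) Hb i w) + c ^+ 2.
have ig : L1 P g.
  apply: L1D; last exact: L1_cst.
  apply: L1D; last by apply: L1Z; apply: L1_sum => i _.
  by apply: L1_sum => i _; apply: L1_sum.
have : (\int[P]_w (EFin \o g) w)%E \is a fin_num by exact: integrable_fin_num ig.
rewrite fin_numElt => /andP[_].
apply: le_lt_trans; rewrite le_eqVlt; apply/orP; left; apply/eqP.
apply: eq_integral => w _; congr EFin => /=; rewrite /g.
rewrite (_ : \sum_i \sum_j _ = (\sum_(i : index) Hb i w) * \sum_(i : index) Hb i w).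
  transitivity ((\sum_i Hb i w - c) * (\sum_i Hb i w - c)) => //.
  by move: (\sum_i Hb i w) => x; rewrite expr2 mulrBl !mulrBr; ring.
by rewrite big_distrl/=; apply: eq_bigr => i _; rewrite big_distrr.
Qed.

Lemma fixed_window_dW {dZ} {OmegaZ : measurableType dZ} (PZ : probability OmegaZ R)
    (Z : {RV PZ >-> R}) :
  stein_bounded PZ Z Lc ->
  let sigma := Num.sqrt (fine ('V_P[Hsum X xi lam])%E) in
  1 <= sigma ->
  (dW P (standardize P (Hsum X xi lam)) PZ Z <=
    (2 * N * (K * Phi) / sigma +
     Lc * (2 * N ^+ 2 * (K * Phi) * (2 + M3)) / sigma ^+ 2 +
     (Lc + 2) * N * e +
     N * (12 * Lc * ((4 * rho + 1) ^ n)%:R ^+ 2 * MM ^+ 2) / sigma ^+ 3)%:E)%E.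
Proof.
move=> stein sigma.
rewrite /sigma HbE => s1.
have e0 : 0 <= e.
  have i0 : index by exact: [ffun=> ord0].
  have h1 : 0 <= 1 + 3 * N ^+ 4 * MM.
    by apply: addr_ge0 => //; apply: mulr_ge0 (MM0 i0); rewrite mulr_ge0 ?exprn_ge0.
  apply: mulr_ge0 (ltW delta_gt0) _; apply: addr_ge0 => //; apply: mulr_ge0 h1.
  by apply: mulr_ge0 => //; exact: exprn_ge0.
have M31 : 1 <= M3.
  have i0 : index by exact: [ffun=> ord0].
  by rewrite /M3 lerDl (A0 i0).
set sg := Num.sqrt _ in s1 *.
have sg0 : 0 <= sg by exact: le_trans s1.
have si0 : 0 <= sg^-1 by rewrite invr_ge0.
have mfs (f : R -> R) S : measurable_fun setT f ->
    is_local X (fattened_union L r S) (fun Y => f ((\sum_(j in S) Vf j Y) / sg)).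
  move=> mf.
  apply: (@is_local_comp _ _ _ _ _ _ _ _ _ (fun Y => (\sum_(j in S) Vf j Y) / sg) f mf).
  by apply: is_localM; [exact: local_sumV|exact: is_local_cst].
(* Blocks outside range 2 rho of [i] are outside range rho of every neighbour of [i]. The larger
   neighbourhood has at most (2 (2 rho) + 1)^n blocks. *)
apply: (@dissociated_dW _ _ _ P _ Hb Ub Sx Sr AD (block_nbhd rho) (block_nbhd (2 * rho))
  M3 K Phi ((4 * rho + 1) ^ n)%:R e Lc) => //.
- by move=> i; exact: mpsum.
- by move=> i w; exact: norm_psum.
- by move=> i w; exact: norm_psum.
- by move=> i w; exact: le_psum.
- by move=> i; exact: (Sx3 i).1.
- by move=> i; exact: (Sr3 i).1.
- by move=> i; exact: (mpsum i (mabs mgx)).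
- by move=> i; exact: (mpsum i (mabs mgr)).
- by move=> i; exact: (Sx3 i).2.
- by move=> i; exact: (Sr3 i).2.
- by move=> i; exact: (AD1 i).1.
- by move=> i; exact: (AD1 i).2.
- move=> i j; apply: (AD_Y i (mpsum j (mabs mgx)) (psum_norm_ge0 j gx) (Sxq j).1 _).1.
  by rewrite (le_trans (Sxq j).2)// lerDr.
- move=> i j; apply: (AD_Y i (mpsum j (mabs mgx)) (psum_norm_ge0 j gx) (Sxq j).1 _).2.
  by rewrite (le_trans (Sxq j).2)// lerDr.
- move=> i j; apply: (AD_Y i (mpsum j (mabs mgr)) (psum_norm_ge0 j gr) (Srq j).1 _).1.
  by rewrite (le_trans (Srq j).2)// lerDr.
- move=> i j; apply: (AD_Y i (mpsum j (mabs mgr)) (psum_norm_ge0 j gr) (Srq j).1 _).2.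
  by rewrite (le_trans (Srq j).2)// lerDr.
- move=> i; rewrite ler_nat (leq_trans (card_block_nbhd _ _))//.
  by elim: (n) => // k ih; rewrite !expnS leq_mul// leq_add2r leq_mul2r orbT.
- by move=> i; rewrite ler_nat (leq_trans (card_block_nbhd _ _))// mulnA.
- move=> f i mf fL.
  have far j k : j \in [set i]%SET -> k \in ~: block_nbhd rho i -> k \notin block_nbhd rho j.
    by rewrite !inE => /eqP ->.
  have lv := mfs f (~: block_nbhd rho i) mf.
  have lu := local_Vf (set11 i).
  rewrite [X in Ex P X](_ : _ = fun w => Vf i (X w) *
      f ((\sum_(j in ~: block_nbhd rho i) Vf j (X w)) / sg)); last first.
    by apply/funext => w; rewrite -sumC.
  have := @decor_blocks _ _ (Vf i) _ far lu lv _ (iV i).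
  (* The product of expectations vanishes because V_i is centred. *)
  rewrite (EV i) mul0r subr0; apply.
  + move=> Y Y'; rewrite normrM.
    apply: le_trans (sq_bound (sS0 [set i]%SET Y) (aS0 (~: block_nbhd rho i) Y')).
    by rewrite mulrC ler_pM//; exact: le_sS (set11 i).
  + by apply: (@L1_bounded _ _ _ _ _ Lc) => [|w]; [exact: is_local_measurable lv|exact: fL].
- move=> f i mf fL.
  have far j k : j \in block_nbhd rho i -> k \in ~: block_nbhd (2 * rho) i ->
      k \notin block_nbhd rho j.
    by move=> ij; rewrite finset.in_setC; exact: block_nbhd_far.
  have lv := mfs f (~: block_nbhd (2 * rho) i) mf.
  have lu : is_local X (fattened_union L r (block_nbhd rho i))
      (fun Y => Vf i Y * \sum_(j in block_nbhd rho i) Vf j Y).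
    by apply: is_localM; [exact: local_Vf|exact: local_sumV].
  rewrite [X in Ex P X - _](_ : _ = fun w => (Vf i (X w) * \sum_(j in block_nbhd rho i) Vf j (X w)) *
      f ((\sum_(j in ~: block_nbhd (2 * rho) i) Vf j (X w)) / sg)); last first.
    by apply/funext => w; rewrite -sumC.
  rewrite [X in _ * Ex P X](_ : _ = fun w =>
      f ((\sum_(j in ~: block_nbhd (2 * rho) i) Vf j (X w)) / sg)); last first.
    by apply/funext => w; rewrite -sumC.
  apply: (decor_blocks far lu lv).
  + move=> Y Y'; rewrite !normrM.
    apply: le_trans (sq_bound2 (sS0 (block_nbhd rho i) Y) (aS0 (~: block_nbhd (2 * rho) i) Y')).
    rewrite mulrC expr2; apply: ler_pM => //.
    by apply: ler_pM => //; exact: le_sS.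
  + rewrite /comp; under eq_fun do rewrite mulr_sumr.
    by apply: L1_sum => j _; exact: prod_iV.
  + by apply: (@L1_bounded _ _ _ _ _ Lc) => [|w]; [exact: is_local_measurable lv|exact: fL].
- move=> i.
  have far j k : j \in [set i]%SET -> k \in ~: block_nbhd rho i -> k \notin block_nbhd rho j.
    by rewrite !inE => /eqP ->.
  have lu := local_Vf (set11 i).
  rewrite [X in Ex P X](_ : _ = fun w => Vf i (X w) *
      \sum_(j in ~: block_nbhd rho i) Vf j (X w)); last first.
    by apply/funext => w; rewrite -sumC.
  have := @decor_blocks _ _ (Vf i) _ far lu (local_sumV (~: block_nbhd rho i)) _ (iV i).
  rewrite (EV i) mul0r subr0; apply.
  + move=> Y Y'; rewrite normrM.
    apply: le_trans (mul_bound (sS0 [set i]%SET Y) (sS0 (~: block_nbhd rho i) Y')).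
    by apply: ler_pM => //; exact: le_sS (set11 i).
  + by apply: L1_sum => j _; exact: iV.
Qed.

End fixed_window.

(** * Rates *)

Section decay.
Context {R : realType} {n : nat}.
Implicit Types A B : set (Rvec R n).

Lemma diam_ge0 A : (0 <= diam A)%E.
Proof. by rewrite /diam le_max lexx. Qed.

(** The EDD bound grows with the diameters and decreases with the distance, so the real bounds [D]
    and [r] may replace them. Extended reals are kept up to this point because an empty family of
    blocks is at distance [+oo] from every other. *)
Lemma decay_bound A B (theta0 theta1 theta2 theta3 D r : R) (t : \bar R) :
  0 <= theta0 -> 0 < theta1 -> 0 < theta2 -> 0 < theta3 -> 1 <= D ->
  (diam A <= D%:E)%E -> (diam B <= D%:E)%E ->
  theta3 * Num.max (ln D) 1 <= r -> (r%:E <= set_dist A B)%E ->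
  (theta3%:E * maxe (lne (maxe (diam A) (diam B))) 1 <= set_dist A B ->
   t <= theta1%:E * maxe (poweR (diam A) theta0) 1 * maxe (poweR (diam B) theta0) 1
     * expeR (- (theta2%:E * set_dist A B)))%E ->
  (t <= (theta1 * (D `^ theta0) ^+ 2 * expR (- (theta2 * r)))%:E)%E.
Proof.
move=> t00 t10 t20 t30 D1 DA DB Dr rAB H.
have D0 : 0 < D by exact: lt_le_trans D1.
have pw (S : set (Rvec R n)) : (diam S <= D%:E)%E ->
    (maxe (poweR (diam S) theta0) 1 <= (D `^ theta0)%:E)%E.
  move=> SD; rewrite ge_max; apply/andP; split.
    have iS : diam S \in `[0%E, +oo%E] by rewrite in_itv/= leey andbT diam_ge0.
    have iD : D%:E \in `[0%E, +oo%E] by rewrite in_itv/= leey andbT lee_fin ltW.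
    by rewrite -poweR_EFin; exact: (gt0_ler_poweR t00 iS iD SD).
  by rewrite lee_fin -[leLHS](powRr0 D) ler_powR.
have mp0 (S : set (Rvec R n)) : (0 <= maxe (poweR (diam S) theta0) 1)%E by rewrite le_max lee01 orbT.
apply: le_trans (H _) _.
  apply: le_trans rAB; apply: le_trans (_ : (theta3 * Num.max (ln D) 1)%:E <= _)%E; last first.
    by rewrite lee_fin.
  rewrite EFinM lee_pmul2l ?lte_fin// EFin_max ge_max !le_max lexx orbT andbT.
  apply/orP; left; rewrite -lne_EFin// lee_lne ?in_itv/= ?leey ?andbT//.
  - by rewrite ge_max DA.
  - by rewrite le_max diam_ge0.
  - by rewrite lee_fin ltW.
rewrite EFinM; apply: lee_pmul.
- by rewrite !mule_ge0// lee_fin ltW.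
- exact: expeR_ge0.
- rewrite expr2 mulrA !EFinM; apply: lee_pmul => //; last exact: pw.
    by rewrite mule_ge0// lee_fin ltW.
  by apply: lee_pmul => //; [rewrite lee_fin ltW|exact: pw].
- rewrite -[leRHS]/(expeR (- (theta2 * r)%:E)%E) lee_expeR leeN2 EFinM.
  by rewrite lee_pmul2l ?lte_fin.
Qed.

End decay.

Section growth.
Context {R : realType}.
Implicit Types x a k : R.

(** With ln z < z at z = x^(a/2), one half of the power beats the logarithm and the other half the
    constant. *)
Lemma mul_ln_le_powR k a : 0 < k -> 0 < a ->
  \forall x \near +oo, k * ln x <= x `^ a.
Proof.
move=> k0 a0; have b0 : 0 < a / 2 by rewrite divr_gt0.
have c0 : 0 <= k * (a / 2)^-1 by rewrite ltW// mulr_gt0// invr_gt0.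
near=> x.
have x0 : 0 < x by near: x; exact: nbhs_pinfty_gt.
have xb : (k * (a / 2)^-1) `^ (a / 2)^-1 <= x.
  by near: x; apply: nbhs_pinfty_ge; exact: num_real.
have big : k * (a / 2)^-1 <= x `^ (a / 2).
  rewrite [leLHS](_ : _ = ((k * (a / 2)^-1) `^ (a / 2)^-1) `^ (a / 2)).
    by apply: powR_le_mono => //; [exact: ltW|exact: powR_ge0].
  by rewrite -powRrM mulVf ?gt_eqF// powRr1.
have -> : k * ln x = k * (a / 2)^-1 * ln (x `^ (a / 2)).
  by rewrite ln_powR mulrA mulrVK// unitfE gt_eqF.
apply: le_trans (_ : k * (a / 2)^-1 * x `^ (a / 2) <= _).
  by rewrite ler_wpM2l// ltW// ln_sublinear// powR_gt0.
have -> : x `^ a = x `^ (a / 2) * x `^ (a / 2).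
  by rewrite -powRD ?gt_eqF ?implybT// -splitr.
by rewrite ler_wpM2r// powR_ge0.
Unshelve. all: by end_near. Qed.

End growth.

Section exponents.
Context {R : realType}.
Implicit Types p q s : R.

(** [pbar] never exceeds [p1], because p <= p1 + p - 1. The bound 2 serves to compare the square of
    a count with its power [p1]. *)
Lemma exponent_ge2 (p1 p : R) : 1 <= p1 -> 1 <= p -> 3 <= p1 * p / (p1 + p - 1) -> 2 <= p1.
Proof.
move=> p11 pge1; rewrite ler_pdivlMr; last by lra.
by have [//|p12] := leP 2 p1; nra.
Qed.

(** Equality q / (q - 2) = s means that q / 2 is the conjugate exponent of [s]; this links the
    assumption on [p3] to [block_error]. *)
Lemma conjugate_exponent q s : 3 <= q -> q / (q - 2) <= s -> 1 < s /\ s / (s - 1) <= q / 2.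
Proof.
move=> q3; rewrite ler_pdivrMr; last by lra.
move=> h; have s1 : 1 < s by nra.
split => //; rewrite ler_pdivrMr ?subr_gt0//; nra.
Qed.

Lemma lt_pinfty_bound (x : \bar R) : (x < +oo)%E -> exists2 b : R, 0 <= b & (x <= b%:E)%E.
Proof.
case: x => [x _|//|_]; last by exists 0; rewrite ?leNye.
by exists `|x| => //; rewrite lee_fin ler_norm.
Qed.

End exponents.

Section palm_moments.
Context {R : realType} {n : nat} {dM : measure_display} {M : measurableType dM}.
Variable palm : R.-pker (Rvec R n) ~> (M * mconf R n M)%type.
Implicit Types (f : score_fun R n M) (p b lam : R).

Lemma palm_sup_norm_integral f p b lam x : 0 < p -> 0 <= b ->
  (palm_sup_norm palm p f <= b%:E)%E -> 0 < lam -> window lam x ->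
  (\int[palm x]_y (`|f (x, y.1) y.2 (window lam)| `^ p)%:E <= (b `^ p)%:E)%E.
Proof.
move=> p0 b0 fb lam0 xW; apply: Lnorm_le_integral => //; apply: le_trans fb.
apply: le_trans (_ : _ <= ereal_sup [set Lnorm (palm x) p%:E
  (fun y => (f (x, y.1) y.2 (window lam))%:E) | x in window lam])%E _.
  by apply: ereal_sup_ubound; exists x.
by apply: ereal_sup_ubound; exists lam.
Qed.

Lemma palm_moment f p (p' : R) b lam x : measurable_score f -> 0 < p -> p <= p' -> 0 <= b ->
  (palm_sup_norm palm p' f <= b%:E)%E -> 0 < lam -> window lam x ->
  (\int[palm x]_y (`|f (x, y.1) y.2 (window lam)| `^ p)%:E <= (1 + b `^ p')%:E)%E.
Proof.
move=> mf p0 pp' b0 fb lam0 xW; have p'0 : 0 < p' by exact: lt_le_trans pp'.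
have mW : measurable (window lam : set (Rvec R n)) by exact: measurable_centered_cube.
have mfx : measurable_fun setT (fun y : M * mconf R n M => f (x, y.1) y.2 (window lam)).
  pose pt (y : M * mconf R n M) : (Rvec R n * M) * mconf R n M := ((x, y.1), y.2).
  suff mpt : measurable_fun setT pt by exact: (measurableT_comp (mf _ mW) mpt).
  apply: measurable_fun_pair => //; apply: (measurableT_comp (pair1_measurable x)).
  exact: measurable_fst.
have mfp a : measurable_fun setT
    (fun y : M * mconf R n M => (`|f (x, y.1) y.2 (window lam)| `^ a)%:E).
  by apply/measurable_EFinP/measurable_powR_fun; exact: measurableT_comp.
apply: le_trans (_ : \int[palm x]_y (1%:E + (`|f (x, y.1) y.2 (window lam)| `^ p')%:E) <= _)%E.
  apply: ge0_le_integral.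
  - exact: measurableT.
  - by move=> y _; rewrite lee_fin powR_ge0.
  - exact: mfp.
  - by apply: emeasurable_funD => //; exact: mfp.
  - by move=> y _; rewrite -EFinD lee_fin powR_le1D// ltW.
rewrite ge0_integralD; last 5 first.
- exact: measurableT.
- by move=> y _; rewrite lee_fin.
- exact: measurable_cst.
- by move=> y _; rewrite lee_fin powR_ge0.
- exact: mfp.
rewrite EFinD; apply: leeD; last exact: palm_sup_norm_integral.
rewrite integral_cst// mul1e; exact: sprob_kernel_le1.
Qed.

End palm_moments.

Section rate_arithmetic.
Context {R : realType}.
Implicit Types x y r a lam : R.

Lemma ler_div x x' y y' : 0 <= x -> x <= x' -> 0 < y' -> y' <= y -> x / y <= x' / y'.
Proof.
move=> x0 xx' y'0 yy'; have y0 : 0 < y by exact: lt_le_trans yy'.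
by apply: ler_pM => //; rewrite ?invr_ge0 ?lef_pV2 ?posrE// ltW.
Qed.

Lemma rate_bound (N a lam h sg K Phi M3 Lc e E M kap kp : R) :
  0 <= N -> N <= a * lam -> 0 < h -> h <= sg -> 0 <= K -> 0 <= Phi -> 0 <= M3 -> 0 <= Lc ->
  e <= E -> 0 <= E -> kap ^+ 2 <= kp ->
  2 * N * (K * Phi) / sg + Lc * (2 * N ^+ 2 * (K * Phi) * (2 + M3)) / sg ^+ 2 +
  (Lc + 2) * N * e + N * (12 * Lc * kap ^+ 2 * M ^+ 2) / sg ^+ 3 <=
  2 * a * K * (lam * Phi / h) + Lc * (2 * a ^+ 2 * K * (2 + M3)) * (lam ^+ 2 * Phi / h ^+ 2) +
  (Lc + 2) * a * (lam * E) + 12 * a * Lc * M ^+ 2 * (lam * kp / h ^+ 3).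
Proof.
move=> N0 Na h0 hs K0 P0 M30 L0 eE E0 kk.
have KP0 : 0 <= K * Phi by exact: mulr_ge0.
have al0 : 0 <= a * lam by exact: le_trans Na.
have N2 : N ^+ 2 <= (a * lam) ^+ 2 by rewrite lerXn2r.
have hX k : h ^+ k <= sg ^+ k.
  by rewrite lerXn2r// nnegrE ltW// (lt_le_trans _ hs).
have hX0 k : 0 < h ^+ k by exact: exprn_gt0.
apply: lerD; first apply: lerD; first apply: lerD.
- rewrite (_ : 2 * a * K * _ = 2 * (a * lam) * (K * Phi) / h); last by ring.
  by apply: ler_div => //; rewrite ?mulr_ge0// ler_wpM2r// ler_wpM2l.
- rewrite (_ : Lc * _ * (lam ^+ 2 * _ / _) =
    Lc * (2 * (a * lam) ^+ 2 * (K * Phi) * (2 + M3)) / h ^+ 2); last by ring.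
  have M2 : 0 <= 2 + M3 by exact: addr_ge0.
  apply: ler_div => //; first by rewrite !mulr_ge0// sqr_ge0.
  by rewrite ler_wpM2l// ler_wpM2r// ler_wpM2r// ler_wpM2l.
- rewrite (_ : (Lc + 2) * a * _ = (Lc + 2) * (a * lam) * E); last by ring.
  have L2 : 0 <= Lc + 2 by exact: addr_ge0.
  apply: le_trans (_ : (Lc + 2) * N * E <= _).
    by rewrite ler_wpM2l// mulr_ge0.
  by rewrite ler_wpM2r// ler_wpM2l.
- rewrite (_ : 12 * a * Lc * _ * _ = (a * lam) * (12 * Lc * kp * M ^+ 2) / h ^+ 3); last by ring.
  have c0 : 0 <= 12 * Lc * kap ^+ 2 * M ^+ 2 by rewrite mulr_ge0 ?sqr_ge0// mulr_ge0 ?sqr_ge0// mulr_ge0.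
  apply: ler_div => //; first exact: mulr_ge0.
  by apply: ler_pM => //; rewrite ler_wpM2r ?sqr_ge0// ler_wpM2l// mulr_ge0.
Qed.

Lemma card_blocks_le (n : nat) lam : (0 < n)%N -> 1 <= lam ->
  let m := (Num.truncn (lam `^ n%:R^-1)).+1 in
  m%:R <= 2 * lam `^ n%:R^-1 /\ (m ^ n)%:R <= 2 ^+ n * lam.
Proof.
move=> n0 lam1 m; have L0 : 0 <= lam `^ n%:R^-1 by exact: powR_ge0.
have n0R : n%:R != 0 :> R by rewrite pnatr_eq0 -lt0n.
have L1 : 1 <= lam `^ n%:R^-1.
  by rewrite -[leLHS](powRr0 lam) ler_powR// invr_ge0.
have mL : m%:R <= 2 * lam `^ n%:R^-1.
  rewrite /m -natr1 mulrDl mul1r lerD//.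
  by rewrite truncn_le.
split => //; rewrite natrX.
apply: le_trans (_ : (2 * lam `^ n%:R^-1) ^+ n <= _).
  by apply: lerXn2r mL; rewrite nnegrE ?ler0n// mulr_ge0.
rewrite exprMn ler_pM2l ?exprn_gt0// -powR_mulrn// -powRrM mulVf// powRr1//.
exact: le_trans lam1.
Qed.

Lemma dependency_radius (n : nat) r : 1 <= r ->
  let rho := (Num.truncn (3 * r)).+1 in
  3 * r <= rho%:R /\ ((4 * rho + 1) ^ n)%:R ^+ 2 <= 17 ^+ (2 * n) * r ^+ (2 * n).
Proof.
move=> r1 rho; have r0 : 0 <= 3 * r by lra.
split; first by rewrite ltW// truncnS_gt.
have rr : rho%:R <= 3 * r + 1 by rewrite /rho -natr1 lerD2r truncn_le.
(* 4 (3 r + 1) + 1 <= 17 r, because r >= 1. *)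
rewrite natrX -exprM (mulnC n) -exprMn; apply: lerXn2r; rewrite ?nnegrE ?ler0n//; first by lra.
by rewrite natrD natrM; lra.
Qed.

Lemma powR_expR_ln a lam : 0 < lam -> expR (a * ln lam) = lam `^ a.
Proof. by move=> l0; rewrite /powR gt_eqF. Qed.

(* With this choice of delta and k, the total variation bound is at most
   delta^3 for configurations of diameter at most D = 4 n lam^g. *)
Lemma decay_delta (theta0 theta1 theta2 g b k lam r c : R) :
  0 <= theta1 -> 0 < theta2 -> 1 <= lam -> 0 <= c -> 0 <= ln lam ->
  (3 * b + 2 * g * theta0) / theta2 <= k -> k * ln lam <= r ->
  theta1 * ((c * lam `^ g) `^ theta0) ^+ 2 * expR (- (theta2 * r)) <=
  ((1 + theta1 * (c `^ theta0) ^+ 2) * lam `^ (- b)) ^+ 3.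
Proof.
move=> t10 t20 lam1 c0 l0 hk kr.
have lam0 : 0 < lam by exact: lt_le_trans lam1.
rewrite powRM ?powR_ge0// !exprMn mulrA.
set T := theta1 * (c `^ theta0) ^+ 2.
have T0 : 0 <= T by rewrite mulr_ge0// sqr_ge0.
have e1 : expR (- (theta2 * r)) <= lam `^ (- (theta2 * k)).
  rewrite -powR_expR_ln// ler_expR mulNr lerN2 -mulrA ler_pM2l//.
rewrite -mulrA; apply: ler_pM => //.
- by rewrite mulr_ge0// sqr_ge0.
- apply: le_trans (_ : 1 + T <= _); first by rewrite lerDr.
  by apply: ler_eXnr => //; rewrite lerDl.
apply: le_trans (ler_wpM2l (sqr_ge0 _) e1) _.
rewrite -!powR_mulrn ?powR_ge0// -!powRrM -powRD ?(gt_eqF lam0) ?implybT//.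
rewrite ler_powR//; move: hk; rewrite ler_pdivrMr//; lra.
Qed.

Lemma error_factor (N a lam L M : R) : 0 <= N -> N <= a * lam -> 1 <= lam -> 0 <= L -> 0 <= M ->
  2 + L * (1 + 3 * N ^+ 4 * M) <= (2 + L * (1 + 3 * a ^+ 4 * M)) * lam ^+ 4.
Proof.
move=> N0 Na l1 L0 M0.
have N4 : N ^+ 4 <= a ^+ 4 * lam ^+ 4.
  by rewrite -exprMn; apply: lerXn2r => //; rewrite nnegrE (le_trans N0).
have l4 : 1 <= lam ^+ 4 by exact: exprn_ege1.
rewrite (_ : (2 + _) * _ = 2 * lam ^+ 4 +
  L * (lam ^+ 4 + 3 * (a ^+ 4 * lam ^+ 4) * M)); last by ring.
apply: lerD; first by rewrite ler_peMr.
by rewrite ler_wpM2l// lerD// ler_wpM2r// ler_wpM2l.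
Qed.

Lemma weighted_sum_le (C1 C2 C3 C4 u1 u2 u3 : R) :
  0 <= C1 -> 0 <= C2 -> 0 <= C3 -> 0 <= C4 -> 0 <= u1 -> 0 <= u2 -> 0 <= u3 ->
  C1 * u1 + C2 * u2 + C3 * u3 + C4 * u3 <= (1 + C1 + C2 + C3 + C4) * (u1 + u2 + u3).
Proof.
move=> C10 C20 C30 C40 u10 u20 u30; rewrite -subr_ge0.
rewrite (_ : _ - _ = u1 + u2 + u3 + C1 * (u2 + u3) + C2 * (u1 + u3) + (C3 + C4) * (u1 + u2));
  last by ring.
by rewrite !(addr_ge0, mulr_ge0).
Qed.

End rate_arithmetic.

Section rate.
Context {R : realType} {n : nat} {dO dM dZ : measure_display}
  {Omega : measurableType dO} {M : measurableType dM} {P : probability Omega R}.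
Hypothesis n_gt0 : (0 < n)%N.
Context (X : {RV P >-> mconf R n M}).
Hypothesis X_marks : {ae P, forall w, unique_marks (X w)}.
Hypothesis X_stationary : stationary P (fun w => ground (X w)).
Context (mu : R) (mu_gt0 : 0 < mu).
Context (palm : R.-pker (Rvec R n) ~> (M * mconf R n M)%type).
Hypothesis palmP : is_palm P X mu palm.
Variables (xi : score_fun R n M) (xih : R -> score_fun R n M).
Hypotheses (xi_meas : measurable_score xi)
  (xih_short : forall r : R, 0 < r -> short_range P X r (xih r)).
Variables (p1 p2 p2' : R).
Hypotheses (p1_ge1 : 1 <= p1) (p2_ge1 : 1 <= p2) (p2'_ge1 : 1 <= p2')
  (pbar_ge3 : 3 <= pbar p1 p2 p2')
  (X_moment : point_moment P (fun w => ground (X w)) p1)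
  (X_EDD : EDD P X)
  (xi_moment : score_moment palm xi p2)
  (xih_moment : family_moment palm xih p2').
Context {OmegaZ : measurableType dZ} (PZ : probability OmegaZ R) (Z : {RV PZ >-> R}).
Hypothesis Z_normal : forall V, measurable V -> distribution PZ Z V = normal_prob 0 1 V.
Variables (nu c s g : R).
Hypotheses (c_gt0 : 0 < c) (s_ge : pbar p1 p2 p2' / (pbar p1 p2 p2' - 2) <= s) (g_ge1 : 1 <= g).

Local Notation p := (Num.min p2' p2).
Let p_ge1 : 1 <= p. Proof. by rewrite le_min p2'_ge1. Qed.
Let p1_ge2 : 2 <= p1. Proof. exact: exponent_ge2 p1_ge1 p_ge1 pbar_ge3. Qed.

Let score_moments : exists2 C : R, 0 <= C & forall lam x, 0 < lam -> window lam x ->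
  (\int[palm x]_y (`|xi (x, y.1) y.2 (window lam)| `^ p)%:E <= C%:E)%E /\
  forall r, 0 < r ->
  (\int[palm x]_y (`|xih r (x, y.1) y.2 (window lam)| `^ p)%:E <= C%:E)%E.
Proof.
have [b b0 xib] := lt_pinfty_bound xi_moment.
have [b' b'0 xihb] := lt_pinfty_bound xih_moment.
have p0 : 0 < p by exact: lt_le_trans p_ge1.
have e0 (a e : R) : 0 <= 1 + a `^ e by rewrite addr_ge0// powR_ge0.
exists ((1 + b `^ p2) + (1 + b' `^ p2')) => [|lam x lam0 xW]; first exact: addr_ge0.
split=> [|r r0].
  apply: le_trans (palm_moment xi_meas p0 _ b0 xib lam0 xW) _.
    by rewrite ge_min lexx orbT.
  by rewrite lee_fin lerDl.
apply: le_trans (@palm_moment _ _ _ _ palm (xih r) p p2' b' lam x (xih_short r0).1 p0 _ b'0 _ lam0 xW) _.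
- by rewrite ge_min lexx.
- by apply: le_trans xihb; apply: ereal_sup_ubound; exists r.
- by rewrite lee_fin lerDr.
Qed.

Let stein_constant : exists2 Lc : R, 1 <= Lc & stein_bounded PZ Z Lc.
Proof.
have [C C0 stein] := stein_solution Z_normal.
exists (Num.max C 1) => [|h hl]; first by rewrite le_max lexx orbT.
have [ih [f [f' [df fE fC f'C f'lip]]]] := stein h hl.
have CM : C <= Num.max C 1 by rewrite le_max lexx.
split => //; exists f, f'; split => //.
- by move=> x; exact: le_trans (fC x) CM.
- by move=> x; exact: le_trans (f'C x) CM.
- by move=> x y; apply: le_trans (f'lip x y) _; rewrite ler_wpM2r.
Qed.

Lemma normal_approximation_rate : exists2 k : R, 1 <= k & exists2 C : R, 0 < C &
  forall lam r Phi : R, 1 <= lam -> 1 <= ln lam -> ln (4 * n%:R) <= ln lam ->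
  k * ln lam <= r -> r <= lam `^ g -> 1 <= c * lam `^ nu ->
  ((c * lam `^ nu)%:E <= 'V_P[Hsum X xi lam])%E ->
  0 < Phi -> (phi palm xi xih s r <= Phi%:E)%E ->
  (dW P (standardize P (Hsum X xi lam)) PZ Z <=
    (C * (lam `^ (1 - nu / 2) * Phi + lam `^ (2 - nu) * Phi +
          lam `^ (1 - 3 / 2 * nu) * r ^+ (2 * n)))%:E)%E.
Proof.
have [C C0 momC] := score_moments.
have [Lc Lc1 stein] := stein_constant.
have [t0 [t1 [t2 [t3 [t00 t10 t20 t30 edd]]]]] := X_EDD.
have [s1 sq] := conjugate_exponent pbar_ge3 s_ge.
(* With delta of order lam^(-b), the decorrelation errors of all blocks sum to order lam^(5 - b),
   which is lam^(1 - 3/2 nu). *)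
pose b := 4 + 3 / 2 * nu.
(* The first summand ensures k >= 1, the second the distance condition of EDD, where ln D <= (1 + g)
   ln lam, and the third the decay required by [decay_delta]. *)
pose k := 1 + t3 * (1 + g) + `|(3 * b + 2 * g * t0) / t2|.
have k1 : 1 <= k.
  by rewrite /k -addrA lerDl addr_ge0// mulr_ge0 ?(ltW t30)// addr_ge0// (le_trans ler01).
exists k => //.
pose A := @block_q_moment R n dO dM Omega M P X mu p1 p C.
pose cm := @count_moment R n dO dM Omega M P X p1.
have cm0 : 0 <= cm by apply: fine_ge0; apply: integral_ge0 => w _; rewrite lee_fin powR_ge0.
have A0 : 0 <= A.
  by rewrite /A /block_q_moment mulr_ge0 ?powR_ge0// addr_ge0// mulr_ge0// ltW.
pose K := mu + 2 * cm + 1 + A.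
have K0 : 0 <= K by rewrite !addr_ge0 ?(ltW mu_gt0)// mulr_ge0.
pose M3 := 1 + A; have M30 : 0 <= M3 by exact: addr_ge0.
pose MM := 4 * (M3 + (1 + M3) ^+ 3).
have MM0 : 0 <= MM by rewrite mulr_ge0// addr_ge0// exprn_ge0// addr_ge0.
have Lc0 : 0 <= Lc by exact: le_trans Lc1.
pose a : R := 2 ^+ n; have a0 : 0 < a by exact: exprn_gt0.
pose c4 : R := 4 * n%:R.
pose T := 1 + t1 * (c4 `^ t0) ^+ 2.
have T1 : 1 <= T by rewrite lerDl mulr_ge0 ?sqr_ge0// ltW.
have T0 : 0 < T by exact: lt_le_trans T1.
pose c0 := Num.sqrt c; have c00 : 0 < c0 by rewrite sqrtr_gt0.
pose G := 2 + 64 * Lc ^+ 3 * (1 + 3 * a ^+ 4 * MM).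
have G0 : 0 <= G.
  by rewrite !(addr_ge0, mulr_ge0)// ?exprn_ge0// ltW.
pose C1 := 2 * a * K / c0; pose C2 := Lc * (2 * a ^+ 2 * K * (2 + M3)) / c0 ^+ 2.
pose C3 := (Lc + 2) * a * (T * G); pose C4 := 12 * a * Lc * MM ^+ 2 * 17 ^+ (2 * n) / c0 ^+ 3.
have C10 : 0 <= C1 by rewrite !(divr_ge0, mulr_ge0)// ltW.
have C20 : 0 <= C2.
  by rewrite divr_ge0 ?exprn_ge0 ?(ltW c00)// !(mulr_ge0, addr_ge0)// ?exprn_ge0// ltW.
have C30 : 0 <= C3.
  by rewrite mulr_ge0 ?mulr_ge0 ?(ltW a0) ?(ltW T0)// addr_ge0.
have C40 : 0 <= C4.
  rewrite divr_ge0 ?exprn_ge0 ?(ltW c00)// mulr_ge0 ?exprn_ge0// mulr_ge0 ?exprn_ge0//.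
  by rewrite mulr_ge0// mulr_ge0// ltW.
exists (1 + C1 + C2 + C3 + C4); first by rewrite -!addrA ltr_pwDl// !addr_ge0.
move=> lam r Phi lam1 ln1 ln4 kr rg cnu vlow Phi0 phiPhi.
have lam0 : 0 < lam by exact: lt_le_trans lam1.
have r1 : 1 <= r by apply: le_trans kr; rewrite -[leLHS]mulr1 ler_pM.
have r0 : 0 < r by exact: lt_le_trans r1.
have [mL NL] := card_blocks_le n_gt0 lam1.
have [rrho kap] := dependency_radius n r1.
set rho := (Num.truncn (3 * r)).+1 in rrho kap.
set m := (Num.truncn (lam `^ n%:R^-1)).+1 in mL NL.
pose delta := T * lam `^ (- b).
have delta0 : 0 < delta by rewrite mulr_gt0// powR_gt0.
have xiC x : window lam x -> (\int[palm x]_y (`|xi (x, y.1) y.2 (window lam)| `^ p)%:E <= C%:E)%E.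
  by move=> xW; exact: (momC lam x lam0 xW).1.
have xirC x : window lam x ->
    (\int[palm x]_y (`|xih r (x, y.1) y.2 (window lam)| `^ p)%:E <= C%:E)%E.
  by move=> xW; exact: (momC lam x lam0 xW).2.
have xiPhi x : window lam x ->
    (\int[palm x]_y (`|xi (x, y.1) y.2 (window lam) - xih r (x, y.1) y.2 (window lam)| `^ s)%:E
      <= (Phi `^ s)%:E)%E.
  move=> xW; have s0 : 0 < s by exact: lt_trans s1.
  exact: (palm_sup_norm_integral s0 (ltW Phi0) phiPhi lam0 xW).
have Vfin := fixed_window_variance X_marks X_stationary mu_gt0 palmP p1_ge2 p_ge1 X_moment
  pbar_ge3 xi_meas C0 xiC.
have V0 : c * lam `^ nu <= fine ('V_P[Hsum X xi lam])%E.
  rewrite -lee_fin fineK// ge0_fin_numE//.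
  by apply: le_trans vlow; rewrite lee_fin (le_trans ler01).
pose y := lam `^ (nu / 2); have y0 : 0 < y by exact: powR_gt0.
have y2 : y ^+ 2 = lam `^ nu by rewrite -powR_mulrn ?ltW// -powRrM mulfVK.
have sig : c0 * y <= Num.sqrt (fine ('V_P[Hsum X xi lam])%E).
  rewrite -[leLHS]ger0_norm ?mulr_ge0 ?(ltW c00) ?(ltW y0)// -sqrtr_sqr ler_wsqrtr//.
  by rewrite exprMn y2 sqr_sqrtr// ltW.
have sig1 : 1 <= Num.sqrt (fine ('V_P[Hsum X xi lam])%E).
  by rewrite -sqrtr1 ler_wsqrtr// (le_trans cnu).
have n1 : 1 <= n%:R :> R by rewrite ler1n.
(* Bounds n (m + 2 r), as both m and 2 r are at most 2 lam^g. *)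
pose D := c4 * lam `^ g.
have lg1 : 1 <= lam `^ g by rewrite -[leLHS](powRr0 lam) ler_powR// (le_trans ler01).
have D1 : 1 <= D.
  by rewrite -[leLHS]mulr1 ler_pM// -[leLHS]mulr1 /c4 ler_pM// ler1n.
have hD : n%:R * (m%:R + 2 * r) <= D.
  rewrite /D /c4 mulrAC (mulrC _ n%:R) ler_wpM2l//.
  have lL : lam `^ n%:R^-1 <= lam `^ g.
    by rewrite ler_powR// (le_trans _ g_ge1)// invf_le1// (lt_le_trans _ n1).
  rewrite (_ : 4 * lam `^ g = 2 * lam `^ g + 2 * lam `^ g); last by rewrite -mulrDl -natrD.
  by rewrite lerD ?ler_pM2l// (le_trans mL)// ler_pM2l.
have t3D : t3 * Num.max (ln D) 1 <= r.
  apply: le_trans kr; apply: le_trans (_ : t3 * ((1 + g) * ln lam) <= _).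
    rewrite ler_wpM2l ?(ltW t30)// ge_max; apply/andP; split.
      by rewrite lnM ?posrE ?powR_gt0// ?ln_powR ?mulr_gt0 ?ltr0n// mulrDl mul1r lerD2r.
    by rewrite -[leLHS]mulr1 ler_pM// lerDl (le_trans ler01).
  rewrite mulrA ler_wpM2r ?(le_trans ler01)// /k.
  by rewrite addrAC lerDr addr_ge0.
have ln0 : 0 <= ln lam by exact: le_trans ln1.
have hk : (3 * b + 2 * g * t0) / t2 <= k.
  apply: le_trans (ler_norm _) _; rewrite /k lerDr addr_ge0// mulr_ge0 ?(ltW t30)//.
  by rewrite addr_ge0// (le_trans ler01).
have c40 : 0 <= c4 by rewrite mulr_ge0.
have tvD := decay_delta (ltW t10) t20 lam1 c40 ln0 hk kr.
have tv (S S' : {set {ffun 'I_n -> 'I_m}}) :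
  (forall i j, i \in S -> j \in S' -> j \notin block_nbhd rho i) ->
  (dTV (pushforward P (restr (fattened_union (lam `^ n%:R^-1) r S `|`
                              fattened_union (lam `^ n%:R^-1) r S') \o X))
     (pushforward (P \x P) (fun w => cunion
        (restr (fattened_union (lam `^ n%:R^-1) r S) (X w.1))
        (restr (fattened_union (lam `^ n%:R^-1) r S') (X w.2)))) <= (delta ^+ 3)%:E)%E.
  move=> far.
  have mf (S1 : {set {ffun 'I_n -> 'I_m}}) :
      measurable (fattened_union (lam `^ n%:R^-1) r S1 : set (Rvec R n)).
    exact: measurable_fattened_union.
  have := decay_bound t00 t10 t20 t30 D1 (fattened_diam _ (ltW r0) S hD)
    (fattened_diam _ (ltW r0) S' hD) t3D (fattened_set_dist _ rrho far)
    (edd _ _ (mf S) (mf S')).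
  by move=> h; apply: le_trans h _; rewrite lee_fin.
have := fixed_window_dW X_marks X_stationary mu_gt0 palmP p1_ge2 p_ge1 X_moment
  pbar_ge3 xi_meas (xih_short r0) lam0 r0 C0 Phi0 xiC xirC s1 sq xiPhi rrho delta0 Lc1 tv
  stein sig1.
move=> h; apply: le_trans h _; rewrite lee_fin.
rewrite card_ffun !card_ord -/A -/cm -/K -/M3 -/MM.
set N : R := (m ^ n)%:R.
have Na : N <= a * lam by exact: NL.
have N0 : 0 <= N by exact: ler0n.
have y3 : y ^+ 3 = lam `^ (3 / 2 * nu).
  by rewrite -powR_mulrn ?ltW// -powRrM; congr (_ `^ _); ring.
have lamD x z : lam `^ (x + z) = lam `^ x * lam `^ z.
  by rewrite powRD// (gt_eqF lam0) implybT.
have lamX j : lam ^+ j = lam `^ j%:R by rewrite powR_mulrn// ltW.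
set u1 := lam `^ (1 - nu / 2) * Phi; set u2 := lam `^ (2 - nu) * Phi.
set u3 := lam `^ (1 - 3 / 2 * nu) * r ^+ (2 * n).
have u10 : 0 <= u1 by rewrite mulr_ge0 ?powR_ge0// ltW.
have u20 : 0 <= u2 by rewrite mulr_ge0 ?powR_ge0// ltW.
have u30 : 0 <= u3 by rewrite mulr_ge0 ?powR_ge0// exprn_ge0// ltW.
have E0 : 0 <= delta * (G * lam ^+ 4).
  by rewrite mulr_ge0 ?(ltW delta0)// mulr_ge0// exprn_ge0// ltW.
have eE : delta * (2 + 64 * Lc ^+ 3 * (1 + 3 * N ^+ 4 * MM)) <= delta * (G * lam ^+ 4).
  rewrite ler_pM2l//; apply: error_factor => //.
  by rewrite mulr_ge0// exprn_ge0.
apply: le_trans (rate_bound MM N0 Na (mulr_gt0 c00 y0) sig K0 (ltW Phi0) M30 Lc0 eE E0 kap) _.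
have -> : lam * Phi / (c0 * y) = u1 / c0.
  rewrite /u1 lamD powRr1 ?(ltW lam0)// powRN -/y; field.
  by rewrite !gt_eqF.
have -> : lam ^+ 2 * Phi / (c0 * y) ^+ 2 = u2 / c0 ^+ 2.
  rewrite /u2 lamD -lamX powRN -y2; field.
  by rewrite !gt_eqF.
have -> : lam * (17 ^+ (2 * n) * r ^+ (2 * n)) / (c0 * y) ^+ 3 = 17 ^+ (2 * n) * (u3 / c0 ^+ 3).
  rewrite /u3 lamD powRr1 ?(ltW lam0)// powRN -y3.
  move: (17 ^+ (2 * n)) (r ^+ (2 * n)) => z z'; field.
  by rewrite !gt_eqF.
have h3 : lam * (delta * (G * lam ^+ 4)) <= T * G * u3.
  rewrite (_ : lam * _ = T * G * (lam `^ (- b) * lam ^+ 5)); last by rewrite /delta; ring.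
  rewrite ler_wpM2l//; first by rewrite mulr_ge0// ltW.
  rewrite lamX -lamD (_ : - b + 5%:R = 1 - 3 / 2 * nu); last by rewrite /b; ring.
  by rewrite /u3 ler_peMr ?powR_ge0// exprn_ege1.
apply: le_trans (weighted_sum_le C10 C20 C30 C40 u10 u20 u30).
rewrite /C1 /C2 /C3 /C4.
apply: lerD; first apply: lerD; first apply: lerD.
- by rewrite mulrA mulrAC.
- by rewrite mulrA mulrAC.
- by rewrite -[leRHS]mulrA ler_wpM2l// mulr_ge0 ?(ltW a0)// addr_ge0.
- by rewrite le_eqVlt; apply/orP; left; apply/eqP; ring.
Qed.

End rate.

(** * The two choices of the radius *)

Section conclusions.
Context {R : realType}.
Implicit Types lam nu a r : R.

Lemma near_ln_ge (t : R) : \forall lam \near +oo, t <= ln lam.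
Proof.
near=> lam.
have h : expR t <= lam by near: lam; apply: nbhs_pinfty_ge; exact: num_real.
by rewrite -ler_expR lnK// posrE (lt_le_trans (expR_gt0 t)).
Unshelve. all: by end_near. Qed.

Lemma near_powR_ge (c nu : R) : 0 < c -> 0 < nu -> \forall lam \near +oo, 1 <= c * lam `^ nu.
Proof.
move=> c0 nu0; near=> lam.
have h : c^-1 `^ nu^-1 <= lam by near: lam; apply: nbhs_pinfty_ge; exact: num_real.
rewrite -ler_pdivrMl// mulr1.
rewrite [leLHS](_ : _ = (c^-1 `^ nu^-1) `^ nu).
  by apply: powR_le_mono => //; [exact: ltW|exact: powR_ge0].
by rewrite -powRrM mulVf ?gt_eqF// powRr1// invr_ge0 ltW.
Unshelve. all: by end_near. Qed.

Let powRDE lam (x y : R) : 1 <= lam -> lam `^ x * lam `^ y = lam `^ (x + y).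
Proof. by move=> l1; rewrite powRD// (gt_eqF (lt_le_trans ltr01 l1)) implybT. Qed.

(** The two lower bounds on C2 k bring the exponents 1 - nu / 2 and 2 - nu of the error terms down
    to 1 - 3/2 nu. *)
Lemma logarithmic_rate (n : nat) lam nu (C1 C2 k Phi : R) :
  1 <= lam -> 1 <= ln lam -> 0 < C1 -> 0 <= k -> nu <= C2 * k -> 1 + nu / 2 <= C2 * k ->
  Phi = C1 * expR (- (C2 * (k * ln lam))) ->
  lam `^ (1 - nu / 2) * Phi + lam `^ (2 - nu) * Phi +
    lam `^ (1 - 3 / 2 * nu) * (k * ln lam) ^+ (2 * n) <=
  (2 * C1 + k ^+ (2 * n)) * (ln lam ^+ (3 * n) * lam `^ (- (3 / 2) * nu + 1)).
Proof.
move=> l1 ln1 C10 k0 h1 h2 ->; have lam0 := lt_le_trans ltr01 l1.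
have -> : expR (- (C2 * (k * ln lam))) = lam `^ (- (C2 * k)).
  by rewrite -powR_expR_ln// mulNr mulrA.
rewrite (_ : - (3 / 2) * nu + 1 = 1 - 3 / 2 * nu); last by ring.
set u := lam `^ (1 - 3 / 2 * nu); have u0 : 0 <= u by exact: powR_ge0.
set l := ln lam ^+ (3 * n); have lge1 : 1 <= l by exact: exprn_ege1.
have term x : x - C2 * k <= 1 - 3 / 2 * nu ->
    lam `^ x * (C1 * lam `^ (- (C2 * k))) <= C1 * (l * u).
  move=> hx; rewrite mulrCA powRDE// ler_pM2l//.
  apply: le_trans (_ : u <= _); first by rewrite ler_powR.
  by rewrite ler_peMl.
rewrite (_ : (2 * C1 + _) * _ = C1 * (l * u) + C1 * (l * u) + k ^+ (2 * n) * (l * u)); last by ring.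
apply: lerD; first by apply: lerD; apply: term; lra.
rewrite exprMn mulrCA ler_wpM2l ?exprn_ge0// mulrC ler_wpM2r//.
by rewrite ler_weXn2l// leq_mul2r orbT.
Qed.

(** [a] is the exponent of the radius r = lam^a, so that r^(3 n) = lam^tau. The lower bound on a (3
    n + beta) comes from the first member of the maximum in [tau]. *)
Lemma tau_exponent (n : nat) nu (beta : R) : (0 < n)%N -> 0 < nu -> 0 < beta ->
  let a := tau nu n beta / (3 * n%:R) in
  [/\ 0 < a, 3 * n%:R * a = tau nu n beta & nu + 2 <= a * (3 * n%:R + beta)].
Proof.
move=> n0 nu0 b0 a; have n0R : 0 < n%:R :> R by rewrite ltr0n.
pose mx := Num.max ((2 * nu + 4) / (3 * n%:R + beta)) ((nu + 4) / (n%:R + beta)).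
have aE : a = mx / 2.
  by rewrite /a /tau -/mx; field; rewrite gt_eqF.
have d0 : 0 < 3 * n%:R + beta by rewrite addr_gt0// mulr_gt0.
have mxge : (2 * nu + 4) / (3 * n%:R + beta) <= mx by rewrite le_max lexx.
have h : nu + 2 <= a * (3 * n%:R + beta).
  by move: mxge; rewrite ler_pdivrMr// aE; lra.
split => //.
  by rewrite -(pmulr_lgt0 _ d0); apply: lt_le_trans h; rewrite addr_gt0.
by rewrite /a mulrCA divff ?mulr1// mulf_neq0// gt_eqF.
Qed.

(** The [Phi] terms need nu and 1 + nu / 2 to be at most a (3 n + beta), and both are below nu + 2.
    The remainder has r^(2 n) <= r^(3 n). *)
Lemma power_rate (n : nat) lam nu (beta C a t Phi : R) :
  1 <= lam -> 0 < C -> 0 < nu -> 0 < a ->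
  3 * n%:R * a = t -> nu + 2 <= a * (3 * n%:R + beta) ->
  Phi = C * (lam `^ a) `^ (- beta) ->
  lam `^ (1 - nu / 2) * Phi + lam `^ (2 - nu) * Phi +
    lam `^ (1 - 3 / 2 * nu) * (lam `^ a) ^+ (2 * n) <=
  (2 * C + 1) * lam `^ (- (3 / 2) * nu + 1 + t).
Proof.
move=> l1 C0 nu0 a0 ta h ->; rewrite -powRrM.
set u := lam `^ (_ + t).
have term x : x + a * - beta <= - (3 / 2) * nu + 1 + t ->
    lam `^ x * (C * lam `^ (a * - beta)) <= C * u.
  by move=> hx; rewrite mulrCA powRDE// ler_pM2l// ler_powR.
rewrite (_ : (2 * C + 1) * u = C * u + C * u + u); last by ring.
apply: lerD; first by apply: lerD; apply: term; lra.
rewrite -powR_mulrn ?powR_ge0// -powRrM powRDE// ler_powR// natrM -ta.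
have : 0 <= n%:R * a by rewrite mulr_ge0// ltW.
lra.
Qed.

End conclusions.

Theorem corollary1p14 (R : realType) (d : nat) (d_ge1 : (1 <= d)%N)
  (dO dM dZ : measure_display)
  (Omega : measurableType dO) (P : probability Omega R)
  (M : measurableType dM)
  (X : {RV P >-> mconf R d M})
  (X_marks : {ae P, forall w, unique_marks (X w)})
  (X_stationary : stationary P (fun w => ground (X w)))
  (mu : R) (mu_gt0 : 0 < mu)
  (X_intensity : has_intensity P (fun w => ground (X w)) mu)
  (palm : R.-pker (Rvec R d) ~> (M * mconf R d M)%type)
  (palmP : is_palm P X mu palm)
  (xi : score_fun R d M) (xi_score : is_score xi)
  (xih : R -> score_fun R d M)
  (xih_short : forall r : R, 0 < r -> short_range P X r (xih r))
  (p1 p2 p2' : R) (p1_ge1 : 1 <= p1) (p2_ge1 : 1 <= p2) (p2'_ge1 : 1 <= p2')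
  (pbar_ge3 : 3 <= pbar p1 p2 p2')
  (X_moment : point_moment P (fun w => ground (X w)) p1)
  (X_EDD : EDD P X)
  (xi_moment : score_moment palm xi p2)
  (xih_moment : family_moment palm xih p2')
  (nu : R) (nu_gt : 2 / 3 < nu)
  (var_lower : exists2 c : R, 0 < c &
     \forall lam \near +oo, ((c * lam `^ nu)%:E <= 'V_P[Hsum X xi lam])%E)
  (OmegaZ : measurableType dZ) (PZ : probability OmegaZ R)
  (Z : {RV PZ >-> R})
  (Z_normal : forall V, measurable V ->
     distribution PZ Z V = normal_prob 0 1 V) :
  (forall p3 : R, 0 < p3 ->
     pbar p1 p2 p2' / (pbar p1 p2 p2' - 2) <= p3 ->
     exp_stabilizing palm xi xih p3 ->
     exists2 C : R, 0 < C & \forall lam \near +oo,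
       (dW P (standardize P (Hsum X xi lam)) PZ Z <=
          (C * (ln lam ^+ (3 * d) * lam `^ (- (3 / 2) * nu + 1)))%:E)%E)
  /\
  (forall p3 beta : R, 0 < p3 ->
     pbar p1 p2 p2' / (pbar p1 p2 p2' - 2) <= p3 ->
     0 < beta ->
     poly_stabilizing palm xi xih p3 beta ->
     exists2 C : R, 0 < C & \forall lam \near +oo,
       (dW P (standardize P (Hsum X xi lam)) PZ Z <=
          (C * lam `^ (- (3 / 2) * nu + 1 + tau nu d beta))%:E)%E).
Proof.
have nu0 : 0 < nu by exact: lt_trans nu_gt.
have [c c0 vlow] := var_lower.
have rate g s := normal_approximation_rate d_ge1 X_marks X_stationary mu_gt0 palmP xi_score.1
  xih_short p1_ge1 p2_ge1 p2'_ge1 pbar_ge3 X_moment X_EDD xi_moment xih_moment Z_normal nu c0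
  (s := s) (g := g).
split => [s _ s_ge [C1 [C2 [C10 C20 stab]]]|s beta _ s_ge beta0 [C1 [C10 stab]]].
- have [k k1 [C C0 bound]] := rate 1 s s_ge (lexx 1).
  (* Enlarging [k] makes the stabilization error beat both powers of [lam] required by
     [logarithmic_rate]. *)
  pose k' := k + (nu + (1 + nu / 2)) / C2.
  have e0 : 0 <= nu / 2 by rewrite divr_ge0// ltW.
  have kk' : k <= k' by rewrite lerDl divr_ge0 ?(ltW C20)// !addr_ge0// ltW.
  have k'0 : 0 < k' by apply: lt_le_trans kk'; exact: lt_le_trans k1.
  have C2k' : nu + (1 + nu / 2) <= C2 * k'.
    rewrite /k' mulrDr mulrC mulrCA divff ?gt_eqF// mulr1 lerDr mulr_ge0 ?(ltW C20)//.
    exact: le_trans k1.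
  have h1 : nu <= C2 * k' by apply: le_trans C2k'; rewrite lerDl addr_ge0.
  have h2 : 1 + nu / 2 <= C2 * k' by apply: le_trans C2k'; rewrite lerDr ltW.
  exists (C * (2 * C1 + k' ^+ (2 * d))).
    by rewrite mulr_gt0// ltr_pwDl ?exprn_ge0 ?(ltW k'0)// mulr_gt0.
  near=> lam.
  have lam1 : 1 <= lam by near: lam; apply: nbhs_pinfty_ge; exact: num_real.
  have ln1 : 1 <= ln lam by near: lam; exact: near_ln_ge.
  have ln4 : ln (4 * d%:R) <= ln lam by near: lam; exact: near_ln_ge.
  have rg : k' * ln lam <= lam `^ 1 by near: lam; exact: mul_ln_le_powR.
  have cnu : 1 <= c * lam `^ nu by near: lam; exact: near_powR_ge.
  have v : ((c * lam `^ nu)%:E <= 'V_P[Hsum X xi lam])%E by near: lam.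
  have ln0 : 0 <= ln lam by exact: le_trans ln1.
  have r0 : 0 < k' * ln lam by rewrite mulr_gt0// (lt_le_trans _ ln1).
  have Phi0 : 0 < C1 * expR (- (C2 * (k' * ln lam))) by rewrite mulr_gt0// expR_gt0.
  apply: le_trans (bound lam _ _ lam1 ln1 ln4 (ler_wpM2r ln0 kk') rg cnu v Phi0 (stab _ r0)) _.
  rewrite lee_fin -(mulrA C) ler_pM2l//.
  exact: (logarithmic_rate d lam1 ln1 C10 (ltW k'0) h1 h2 erefl).
- have [a0 atau ageq] := tau_exponent d_ge1 nu0 beta0.
  set a := tau _ _ _ / _ in a0 atau ageq.
  (* The diameter exponent must dominate both the side of the window and the radius lam^a; 1 + a
     does. *)
  have g1 : 1 <= 1 + a by rewrite lerDl ltW.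
  have [k k1 [C C0 bound]] := rate (1 + a) s s_ge g1.
  have k0 : 0 < k by exact: lt_le_trans k1.
  exists (C * (2 * C1 + 1)); first by rewrite mulr_gt0// addr_gt0// mulr_gt0.
  near=> lam.
  have lam1 : 1 <= lam by near: lam; apply: nbhs_pinfty_ge; exact: num_real.
  have ln1 : 1 <= ln lam by near: lam; exact: near_ln_ge.
  have ln4 : ln (4 * d%:R) <= ln lam by near: lam; exact: near_ln_ge.
  have kr : k * ln lam <= lam `^ a by near: lam; exact: mul_ln_le_powR.
  have rg : lam `^ a <= lam `^ (1 + a) by rewrite ler_powR// lerDr.
  have cnu : 1 <= c * lam `^ nu by near: lam; exact: near_powR_ge.
  have v : ((c * lam `^ nu)%:E <= 'V_P[Hsum X xi lam])%E by near: lam.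
  have r0 : 0 < lam `^ a by rewrite powR_gt0// (lt_le_trans _ lam1).
  have Phi0 : 0 < C1 * (lam `^ a) `^ (- beta) by rewrite mulr_gt0// powR_gt0.
  apply: le_trans (bound lam _ _ lam1 ln1 ln4 kr rg cnu v Phi0 (stab _ r0)) _.
  rewrite lee_fin -(mulrA C) ler_pM2l//.
  exact: (power_rate lam1 C10 nu0 a0 atau ageq erefl).
Unshelve. all: by end_near. Qed.
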